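(* Write $Y=Y_\hbar(\mathfrak g)$. The Laurent expansions $$\Delta_{D,s}(t_{i,r})=\tau_s(t_{i,r})\otimes1+1\otimes t_{i,r},$$ $$\Delta_{D,s}(x^+_{i,r})=\tau_s(x^+_{i,r})\otimes1+1\otimes x^+_{i,r}+\hbar\sum_{N\ge0}\Big(\sum_{n=0}^N(-1)^{n+1}\binom Nn\,\xi_{i,n}\otimes x^+_{i,r+N-n}\Big)s^{-N-1},$$ $$\Delta_{D,s}(x^-_{i,r})=\tau_s(x^-_{i,r})\otimes1+1\otimes x^-_{i,r}+\hbar\sum_{N\ge0}\Big(\sum_{n=0}^N(-1)^{n+1}\binom Nn\,x^-_{i,r+n}\otimes\xi_{i,N-n}\Big)s^{-N-1}$$ ($i\in\mathbf I$, $r\ge0$) give rise to an algebra homomorphism $\Delta_{D,s}:Y\to(Y\otimes Y)((s^{-1}))$. This deformed Drinfeld coproduct $\Delta_{D,s}$ has the following properties. (1) It is compatible with the counit $\epsilon$, that is $(\epsilon\otimes\mathbf 1)\circ\Delta_{D,s}=\mathbf 1$ and $(\mathbf 1\otimes\epsilon)\circ\Delta_{D,s}=\tau_s$. (2) For every $x\in Y$, the following holds in $(Y\otimes Y[a])((s^{-1}))$: $$(\tau_a\otimes\tau_a)\circ\Delta_{D,s}(x)=\Delta_{D,s}\circ\tau_a(x)\quad\text{and}\quad(\tau_a\otimes\mathbf 1)\circ\Delta_{D,s}(x)=\Delta_{D,s+a}(x).$$ (3) $\Delta_{D,s}$ is a filtered homomorphism, that is $\Delta_{D,s}(\mathcal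 F_k(Y))\subset\mathcal F_k(Y^{\otimes2}((s^{-1})))$ for each $k\ge0$.
   Context: $\mathfrak g$ is a complex semisimple Lie algebra with an invariant symmetric nondegenerate bilinear form $(\cdot,\cdot)$, simple roots $\{\alpha_i\}_{i\in\mathbf I}$, and Cartan matrix $a_{ij}=2(\alpha_i,\alpha_j)/(\alpha_i,\alpha_i)$; the form is normalised so that short roots have square length $2$, and $d_i=(\alpha_i,\alpha_i)/2$. Fix $\hbar\in\mathbb C^\times$. The Yangian $Y=Y_\hbar(\mathfrak g)$ is the unital associative $\mathbb C$-algebra generated by $\{x^\pm_{i,r},\xi_{i,r}\}_{i\in\mathbf I,r\ge0}$ with relations: $[\xi_{i,r},\xi_{j,s}]=0$; $[\xi_{i,0},x^\pm_{j,s}]=\pm d_ia_{ij}x^\pm_{j,s}$; $[\xi_{i,r+1},x^\pm_{j,s}]-[\xi_{i,r},x^\pm_{j,s+1}]=\pm\hbar\frac{d_ia_{ij}}2(\xi_{i,r}x^\pm_{j,s}+x^\pm_{j,s}\xi_{i,r})$; $[x^\pm_{i,r+1},x^\pm_{j,s}]-[x^\pm_{i,r},x^\pm_{j,s+1}]=\pm\hbar\frac{d_ia_{ij}}2(x^\pm_{i,r}x^\pm_{j,s}+x^\pm_{j,s}x^\pm_{i,r})$; $[x^+_{i,r},x^-_{j,s}]=\delta_{ij}\xi_{i,r+s}$; and for $i\ne j$, $m=1-a_{ij}$, $r_1,\dots,r_m,s\ge0$: $\sum_{\pi\in\mathfrak S_m}[x^\pm_{i,r_{\pi(1)}},[x^\pm_{i,r_{\pi(2)}},[\cdots,[x^\pm_{i,r_{\pi(m)}},x^\pm_{j,s}]\cdots]]]=0$.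 The elements $t_{i,r}$ are defined by $\hbar\sum_{r\ge0}t_{i,r}u^{-r-1}=\log(1+\hbar\sum_{r\ge0}\xi_{i,r}u^{-r-1})$; they generate the same subalgebra as the $\xi_{i,r}$. $\tau_a$ is the automorphism of $Y$ (for $a\in\mathbb C$; a homomorphism $Y\to Y[a]$ for $a$ a variable) with $\tau_a(y_r)=\sum_{k=0}^r\binom rka^{r-k}y_k$ for $y$ any of $\xi_i,t_i,x_i^\pm$. $\mathbf 1$ denotes the identity map, and the counit $\epsilon:Y\to\mathbb C$ is the algebra homomorphism sending all generators $x_{i,r}^\pm,\xi_{i,r}$ to $0$. $A((s^{-1}))$ denotes Laurent series in $s^{-1}$ with coefficients in $A$ (finitely many positive powers of $s$); expressions in $s+a$ are expanded in powers of $s^{-1}$. $\mathcal F_\bullet(Y)$ is the algebra filtration defined by $\deg(y_r)=r$ for $y=\xi_i,x_i^\pm$, $\mathcal F_\bullet(Y^{\otimes2})$ is the tensor product filtration, and $\mathcal F_k(Y^{\otimes2}((s^{-1})))=s^k\prod_{n\ge0}\mathcal F_n(Y^{\otimes2})s^{-n}$. Origin of the formulae: they are the expressions the source gives for the Laurent expansions at $s=\infty$ of the deformed Drinfeld tensor product action on a tensor product of two finite-dimensional representations, namely $\xi_i(u)\mapsto\xi_i(u-s)\otimes\xi_i(u)$, $x_i^+(u)\mapsto x_i^+(u-s)\otimes1+\oint_{C_2}\frac1{u-v}\xi_i(v-s)\otimes x_i^+(v)\,dv$, $x_i^-(u)\mapsto\oint_{C_1}\frac1{u-v}x_i^-(v-s)\otimes\xi_i(v)\,dv+1\otimes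 x_i^-(u)$, where $x_i^\pm(u)=\hbar\sum_{r\ge 0} x^\pm_{i,r}u^{-r-1}$, $\xi_i(u)=1+\hbar\sum_{r\ge 0}\xi_{i,r}u^{-r-1}$ (rational functions of $u$ on finite-dimensional representations), $C_1$ encloses the poles of the first tensor factor shifted by $s$ and none of those of the second, and $C_2$ encloses the poles of the second tensor factor and none of the shifted poles of the first.
   Formalization: In Δ_{D,s}(x^-_{i,r}) the last term, false as printed, is replaced by the contour-integral expansion ħ Σ_{k=0}^r C(r,k) s^{r-k} Σ_{N≥0} (Σ_{n=0}^N (-1)^n C(N,n) x^-_{i,n+k} ⊗ ξ_{i,N-n}) s^{-N-1}; at r=0 only the sign changes. *)

(* Defs.v *)
From HB Require Import structures.
From mathcomp Require Import all_boot all_order all_algebra.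
From mathcomp Require Import generic_quotient boolp classical_sets fsbigop reals.
From mathcomp Require Import perm complex zify.

Set Implicit Arguments.
Unset Strict Implicit.
Unset Printing Implicit Defensive.

Import Order.TTheory GRing.Theory Num.Theory.
Local Open Scope ring_scope.
Local Open Scope quotient_scope.

(* A[a] for a central variable a, as an algebra over F: the library only makes
   {poly A} a module over A itself. *)
Section PolyAlgebra.
Context (F : fieldType) (A : algType F).

Definition polyalg : Type := {poly A}.
HB.instance Definition _ := GRing.NzRing.on polyalg.

Definition polyalg_scale (c : F) (p : polyalg) : polyalg := (c%:A)%:P * p.

Lemma polyalg_scaleA b c p :
  polyalg_scale b (polyalg_scale c p) = polyalg_scale (b * c) p.
Proof. by rewrite /polyalg_scale mulrA -polyCM -scalerAl mul1r scalerA. Qed.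

Lemma polyalg_scale1 : left_id 1 polyalg_scale.
Proof. by move=> p; rewrite /polyalg_scale scale1r mul1r. Qed.

Lemma polyalg_scaleDr : right_distributive polyalg_scale +%R.
Proof. by move=> c p q; rewrite /polyalg_scale mulrDr. Qed.

Lemma polyalg_scaleDl p : {morph polyalg_scale^~ p : b c / b + c}.
Proof. by move=> b c; rewrite /polyalg_scale scalerDl polyCD mulrDl. Qed.

HB.instance Definition _ := GRing.Zmodule_isLmodule.Build F polyalg
  polyalg_scaleA polyalg_scale1 polyalg_scaleDr polyalg_scaleDl.

Lemma polyalg_scaleAl (c : F) (p q : polyalg) : c *: (p * q) = (c *: p) * q.
Proof. exact: mulrA. Qed.

HB.instance Definition _ :=
  GRing.Lmodule_isLalgebra.Build F polyalg polyalg_scaleAl.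

Lemma polyalg_scaleAr (c : F) (p q : polyalg) : c *: (p * q) = p * (c *: q).
Proof.
rewrite /GRing.scale /= /polyalg_scale !mulrA; congr (_ * _).
apply/polyP => i; rewrite coefCM coefMC.
by rewrite -scalerAl mul1r -scalerAr mulr1.
Qed.

HB.instance Definition _ :=
  GRing.Lalgebra_isAlgebra.Build F polyalg polyalg_scaleAr.

Lemma coef_polyalgZ (c : F) (p : polyalg) i :
  (c *: p : {poly A})`_i = c *: (p : {poly A})`_i.
Proof. by rewrite /GRing.scale /= /polyalg_scale coefCM -scalerAl mul1r. Qed.

Lemma polyalgCZ (c : F) (x : A) : (c *: x)%:P = c *: (x%:P : polyalg).
Proof.
by apply/polyP => i; rewrite coef_polyalgZ !coefC; case: eqP; rewrite ?scaler0.
Qed.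

End PolyAlgebra.

(* An element of A((s^-1)) is the function sending k to its coefficient of s^k,
   which vanishes for k large. *)
Definition lbounded (A : zmodType) (f : int -> A) (M : int) :=
  forall k : int, M < k -> f k = 0.

Record laurent (A : zmodType) := Laurent {
  lcoef :> int -> A;
  _ : `[< exists M, lbounded lcoef M >] }.

HB.instance Definition _ (A : zmodType) := [isSub for @lcoef A].
HB.instance Definition _ (A : zmodType) := gen_eqMixin (laurent A).
HB.instance Definition _ (A : zmodType) := gen_choiceMixin (laurent A).

Section LaurentModule.
Context (A : zmodType).
Implicit Types f g h : laurent A.

Lemma laurentP f g : (forall k, f k = g k) -> f = g.
Proof. by move=> fg; apply/val_inj/funext. Qed.

Lemma lbound_ex f : exists M, lbounded f M.
Proof. by apply/asboolP; case: f. Qed.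

Lemma lbound2 f g : exists M, lbounded f M /\ lbounded g M.
Proof.
have [M fM] := lbound_ex f; have [N gN] := lbound_ex g.
by exists (Num.max M N); split=> k; rewrite gt_max => /andP[? ?]; auto.
Qed.

Definition mkLaurent (f : int -> A) (M : int) (fM : lbounded f M) : laurent A :=
  Laurent (asboolT (ex_intro _ M fM)).

Lemma lconst_bounded (x : A) : lbounded (fun k => if k == 0 then x else 0) 0.
Proof. by move=> k; case: eqP => // ->; rewrite ltxx. Qed.
Definition lconst (x : A) : laurent A := mkLaurent (@lconst_bounded x).

Lemma lopp_subproof f : `[< exists M, lbounded (fun k => - f k) M >].
Proof.
by have [M fM] := lbound_ex f; apply/asboolP; exists M => k /fM->; rewrite oppr0.
Qed.
Definition lopp f : laurent A := Laurent (lopp_subproof f).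

Lemma ladd_subproof f g : `[< exists M, lbounded (fun k => f k + g k) M >].
Proof.
have [M [fM gM]] := lbound2 f g; apply/asboolP; exists M => k kM.
by rewrite fM ?gM ?addr0.
Qed.
Definition ladd f g : laurent A := Laurent (ladd_subproof f g).

Lemma laddA : associative ladd.
Proof. by move=> f g h; apply: laurentP => k; rewrite /= addrA. Qed.
Lemma laddC : commutative ladd.
Proof. by move=> f g; apply: laurentP => k; rewrite /= addrC. Qed.
Lemma ladd0 : left_id (lconst 0) ladd.
Proof. by move=> f; apply: laurentP => k; rewrite /= if_same add0r. Qed.
Lemma laddN : left_inverse (lconst 0) lopp ladd.
Proof. by move=> f; apply: laurentP => k; rewrite /= if_same addNr. Qed.

HB.instance Definition _ :=
  GRing.isZmodule.Build (laurent A) laddA laddC ladd0 laddN.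

Lemma lcoef0 k : (0 : laurent A) k = 0. Proof. exact: if_same. Qed.
Lemma lcoefD f g k : (f + g) k = f k + g k. Proof. by []. Qed.
Lemma lcoefN f k : (- f) k = - f k. Proof. by []. Qed.
Lemma lcoefB f g k : (f - g) k = f k - g k. Proof. by []. Qed.
Lemma lcoefMn f n k : (f *+ n) k = f k *+ n.
Proof. by elim: n => [|n IH]; rewrite ?lcoef0 // !mulrS lcoefD IH. Qed.
Lemma lcoef_sum (J : Type) (r : seq J) (P : pred J) (G : J -> laurent A) k :
  (\sum_(j <- r | P j) G j) k = \sum_(j <- r | P j) G j k.
Proof. by elim/big_rec2: _ => [|j y1 y2 _ <-]; rewrite ?lcoef0. Qed.

(* sum_(N >= 0) c_N s^(M - N) *)
Lemma lseries_bounded (M : int) (c : nat -> A) :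
  lbounded (fun k => if M - k is Posz n then c n else 0) M.
Proof. by move=> k kM; case E: (M - k) => [n|//]; lia. Qed.
Definition lseries (M : int) (c : nat -> A) : laurent A :=
  mkLaurent (@lseries_bounded M c).

End LaurentModule.

Section LaurentRing.
Context (A : nzRingType).
Implicit Types f g h : laurent A.

Definition lmul_coef f g (k : int) : A :=
  (\sum_(i \in [set: int]) f i * g (k - i)%R)%R.

Lemma lmul_coefE f g M N (k : int) (n : nat) :
    lbounded f M -> lbounded g N -> k = M + N - n%:Z ->
  lmul_coef f g k = \sum_(j < n.+1) f (M - j%:Z) * g (N - (n - j)%N%:Z).
Proof.
move=> fM gN kE; pose r := [seq M - j%:Z | j <- iota 0 n.+1].
have r_uniq : uniq r.
  by rewrite map_inj_uniq ?iota_uniq // => i j /addrI/oppr_inj[].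
rewrite /lmul_coef -(fsbig_widen [set` r]) //; last first.
  move=> i [_ /= ir]; case: (ltP M i) => [/fM->|iM]; first by rewrite mul0r.
  case: (ltP N (k - i)) => [/gN->|ki]; first by rewrite mulr0.
  case: ir; apply/mapP; exists `|M - i|%N; last by lia.
  by rewrite mem_iota; lia.
rewrite -fsbig_seq // big_map -{1}[n.+1]subn0 -/(index_iota 0 n.+1) big_mkord.
apply: eq_bigr => j _; congr (_ * g _).
by have := ltn_ord j; lia.
Qed.

Lemma lmul_coef0 f g M N (k : int) :
  lbounded f M -> lbounded g N -> M + N < k -> lmul_coef f g k = 0.
Proof.
move=> fM gN kMN; rewrite /lmul_coef fsbig1 // => i _.
case: (ltP M i) => [/fM->|iM]; first by rewrite mul0r.
by rewrite gN ?mulr0 //; lia.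
Qed.

Lemma lmul_subproof f g : `[< exists M, lbounded (lmul_coef f g) M >].
Proof.
have [M fM] := lbound_ex f; have [N gN] := lbound_ex g.
by apply/asboolP; exists (M + N) => k; apply: lmul_coef0.
Qed.
Definition lmul f g : laurent A := Laurent (lmul_subproof f g).

Definition ltrunc f (M : int) n : {poly A} := \poly_(j < n) f (M - j%:Z).

Lemma lmul_trunc f g M N (k : int) (n m : nat) :
    lbounded f M -> lbounded g N -> k = M + N - n%:Z -> (n < m)%N ->
  lmul f g k = (ltrunc f M m * ltrunc g N m)`_n.
Proof.
move=> fM gN kE nm; rewrite /= (lmul_coefE fM gN kE) coefM.
by apply: eq_bigr => j _; rewrite !coef_poly !ifT //; have := ltn_ord j; lia.
Qed.

Lemma lmul_bounded f g M N :
  lbounded f M -> lbounded g N -> lbounded (lmul f g) (M + N).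
Proof. by move=> fM gN k; apply: lmul_coef0. Qed.

Lemma ltrunc_mul f g M N n i :
    lbounded f M -> lbounded g N -> (i < n)%N ->
  (ltrunc (lmul f g) (M + N) n)`_i = (ltrunc f M n * ltrunc g N n)`_i.
Proof.
by move=> fM gN im; rewrite coef_poly im; apply: lmul_trunc.
Qed.

Lemma lmulA : associative lmul.
Proof.
move=> f g h; have [M fM] := lbound_ex f; have [N gN] := lbound_ex g.
have [P hP] := lbound_ex h; apply: laurentP => k.
case: (ltP (M + N + P) k) => kB.
  rewrite /= (lmul_coef0 fM (lmul_bounded gN hP)) ?addrA //.
  by rewrite (lmul_coef0 (lmul_bounded fM gN) hP).
pose n := `|(M + N + P - k)%R|%N.
rewrite (@lmul_trunc _ _ M (N + P) k n n.+1) //; try by [exact: lmul_bounded | lia].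
rewrite (@lmul_trunc _ _ (M + N) P k n n.+1) //; try by [exact: lmul_bounded | lia].
transitivity ((ltrunc f M n.+1 * (ltrunc g N n.+1 * ltrunc h P n.+1))`_n).
  rewrite !(coefM (ltrunc f M n.+1)); apply: eq_bigr => j _.
  by rewrite ltrunc_mul //; lia.
rewrite mulrA !(coefM _ (ltrunc h P n.+1)); apply: eq_bigr => j _.
by rewrite ltrunc_mul.
Qed.

Lemma lmul1l : left_id (lconst 1) lmul.
Proof.
move=> f; apply: laurentP => k; have [M fM] := lbound_ex f.
case: (ltP M k) => kM.
  by rewrite fM //= (@lmul_coef0 (lconst 1) f 0 M k (@lconst_bounded _ _) fM) ?add0r.
rewrite /= (@lmul_coefE _ _ 0 M k `|M - k|%N) //; last by lia.
  rewrite big_ord_recl big1 => [|j _]; last by rewrite /= mul0r.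
  by rewrite /= mul1r addr0; congr (f _); lia.
exact: lconst_bounded.
Qed.

Lemma lmul1r : right_id (lconst 1) lmul.
Proof.
move=> f; apply: laurentP => k; have [M fM] := lbound_ex f.
case: (ltP M k) => kM.
  by rewrite fM //= (@lmul_coef0 f (lconst 1) M 0 k fM (@lconst_bounded _ _)) ?addr0.
rewrite /= (@lmul_coefE _ _ M 0 k `|M - k|%N) //; last by lia.
  rewrite big_ord_recr big1 => [|j _] /=; last first.
    by rewrite ifF ?mulr0 //; apply/eqP; have := ltn_ord j; lia.
  by rewrite subnn /= mulr1 add0r; congr (f _); lia.
exact: lconst_bounded.
Qed.

Lemma lmulDl : left_distributive lmul +%R.
Proof.
move=> f g h; have [M [fM gM]] := lbound2 f g; have [N hN] := lbound_ex h.
have fgM : lbounded (f + g) M by move=> k kM; rewrite lcoefD fM ?gM ?addr0.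
apply: laurentP => k; rewrite lcoefD /=; case: (ltP (M + N) k) => kB.
  by rewrite (lmul_coef0 fgM hN) ?(lmul_coef0 fM hN) ?(lmul_coef0 gM hN) ?addr0.
have kE : k = M + N - `|(M + N - k)%R|%N%:Z by lia.
rewrite (lmul_coefE fgM hN kE) (lmul_coefE fM hN kE) (lmul_coefE gM hN kE).
by rewrite -big_split; apply: eq_bigr => j _; rewrite /= mulrDl.
Qed.

Lemma lmulDr : right_distributive lmul +%R.
Proof.
move=> h f g; have [M [fM gM]] := lbound2 f g; have [N hN] := lbound_ex h.
have fgM : lbounded (f + g) M by move=> k kM; rewrite lcoefD fM ?gM ?addr0.
apply: laurentP => k; rewrite lcoefD /=; case: (ltP (N + M) k) => kB.
  by rewrite (lmul_coef0 hN fgM) ?(lmul_coef0 hN fM) ?(lmul_coef0 hN gM) ?addr0.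
have kE : k = N + M - `|(N + M - k)%R|%N%:Z by lia.
rewrite (lmul_coefE hN fgM kE) (lmul_coefE hN fM kE) (lmul_coefE hN gM kE).
by rewrite -big_split; apply: eq_bigr => j _; rewrite /= mulrDr.
Qed.

Lemma lone_neq0 : lconst 1 != 0 :> laurent A.
Proof.
by apply/eqP => /(congr1 (fun f : laurent A => f 0))/eqP; rewrite /= oner_eq0.
Qed.

HB.instance Definition _ := GRing.Zmodule_isNzRing.Build (laurent A)
  lmulA lmul1l lmul1r lmulDl lmulDr lone_neq0.

End LaurentRing.

Section LaurentLmodule.
Context (R : pzRingType) (A : lmodType R).
Implicit Types f g : laurent A.

Lemma lscale_subproof (c : R) f : `[< exists M, lbounded (fun k => c *: f k) M >].
Proof.
by have [M fM] := lbound_ex f; apply/asboolP; exists M => k /fM->; rewrite scaler0.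
Qed.
Definition lscale (c : R) f : laurent A := Laurent (lscale_subproof c f).

Lemma lscaleA b c f : lscale b (lscale c f) = lscale (b * c) f.
Proof. by apply: laurentP => k; rewrite /= scalerA. Qed.
Lemma lscale1 : left_id 1 lscale.
Proof. by move=> f; apply: laurentP => k; rewrite /= scale1r. Qed.
Lemma lscaleDr : right_distributive lscale +%R.
Proof. by move=> c f g; apply: laurentP => k; rewrite /= scalerDr. Qed.
Lemma lscaleDl f : {morph lscale^~ f : b c / b + c}.
Proof. by move=> b c; apply: laurentP => k; rewrite /= scalerDl. Qed.

HB.instance Definition _ := GRing.Zmodule_isLmodule.Build R (laurent A)
  lscaleA lscale1 lscaleDr lscaleDl.

Lemma lcoefZ (c : R) f k : (c *: f) k = c *: f k. Proof. by []. Qed.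

End LaurentLmodule.

Section LaurentAlgebra.
Context (R : pzRingType) (A : algType R).
Implicit Types f g : laurent A.

Lemma lscaleAl (c : R) f g : c *: (f * g) = (c *: f) * g.
Proof.
have [M fM] := lbound_ex f; have [N gN] := lbound_ex g.
have cfM : lbounded (c *: f) M by move=> k /fM e; rewrite lcoefZ e scaler0.
apply: laurentP => k; rewrite lcoefZ /=; case: (ltP (M + N) k) => kB.
  by rewrite (lmul_coef0 cfM gN) ?(lmul_coef0 fM gN) ?scaler0.
have kE : k = M + N - `|(M + N - k)%R|%N%:Z by lia.
rewrite (lmul_coefE cfM gN kE) (lmul_coefE fM gN kE) scaler_sumr.
by apply: eq_bigr => j _; rewrite /= scalerAl.
Qed.

HB.instance Definition _ :=
  GRing.Lmodule_isLalgebra.Build R (laurent A) lscaleAl.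

Lemma lscaleAr (c : R) f g : c *: (f * g) = f * (c *: g).
Proof.
have [M fM] := lbound_ex f; have [N gN] := lbound_ex g.
have cgN : lbounded (c *: g) N by move=> k /gN e; rewrite lcoefZ e scaler0.
apply: laurentP => k; rewrite lcoefZ /=; case: (ltP (M + N) k) => kB.
  by rewrite (lmul_coef0 fM cgN) ?(lmul_coef0 fM gN) ?scaler0.
have kE : k = M + N - `|(M + N - k)%R|%N%:Z by lia.
rewrite (lmul_coefE fM cgN kE) (lmul_coefE fM gN kE) scaler_sumr.
by apply: eq_bigr => j _; rewrite /= scalerAr.
Qed.

HB.instance Definition _ :=
  GRing.Lalgebra_isAlgebra.Build R (laurent A) lscaleAr.

End LaurentAlgebra.

Section LaurentMaps.
Context (A : zmodType).

Lemma lmap_subproof (B : zmodType) (h : {additive A -> B}) (f : laurent A) :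
  `[< exists M, lbounded (fun k => h (f k)) M >].
Proof.
by have [M fM] := lbound_ex f; apply/asboolP; exists M => k /fM->; rewrite raddf0.
Qed.
Definition lmap (B : zmodType) (h : {additive A -> B}) (f : laurent A) :
  laurent B := Laurent (lmap_subproof h f).

Definition lbound (f : laurent A) : int := projT1 (cid (lbound_ex f)).

Lemma lboundP (f : laurent A) : lbounded f (lbound f).
Proof. exact: projT2 (cid (lbound_ex f)). Qed.

End LaurentMaps.

Section LaurentPoly.
Context (A : nzRingType).

Lemma lpoly_bounded (p : {poly A}) :
  lbounded (fun k => if k is Posz n then p`_n else 0) (size p)%:Z.
Proof.
by move=> [n|//]; rewrite ltz_nat => /ltnW np; rewrite nth_default.
Qed.
Definition lpoly (p : {poly A}) : laurent A := mkLaurent (@lpoly_bounded p).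

(* The generalized binomial coefficient k (k - 1) ... (k - j + 1) / j!,
   with Negz n = - (n + 1). *)
Definition binz (k : int) (j : nat) : int :=
  match k with
  | Posz n => 'C(n, j)%:Z
  | Negz n => (-1) ^+ j * 'C(n + j, j)%:Z
  end.

(* The substitution s |-> s + a, a series in s with coefficients in A[a]:
   the coefficient of a^j s^m is binz (m + j) j times that of s^(m + j);
   the size bound only serves to make the coefficients polynomials
   (coef_ltranslate). *)
Definition ltranslate_coef (f : laurent A) (m : int) : {poly A} :=
  \poly_(j < `|lbound f - m|.+1) (f (m + j%:Z) *~ binz (m + j%:Z) j).

Lemma coef_ltranslate (f : laurent A) m j :
  (ltranslate_coef f m)`_j = f (m + j%:Z) *~ binz (m + j%:Z) j.
Proof.
rewrite coef_poly; case: ltnP => // jB.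
by rewrite lboundP ?mul0rz //; lia.
Qed.

Lemma ltranslate_bounded (f : laurent A) : lbounded (ltranslate_coef f) (lbound f).
Proof.
move=> m mB; apply/polyP => j; rewrite coef_ltranslate coef0.
by rewrite lboundP ?mul0rz //; lia.
Qed.
Definition ltranslate (f : laurent A) : laurent {poly A} :=
  mkLaurent (@ltranslate_bounded f).

Definition monomial_map (j : nat) (x : A) : {poly A} := x *: 'X^j.
Lemma monomial_map_additive j : zmod_morphism (monomial_map j).
Proof. by move=> x y; rewrite /monomial_map scalerBl. Qed.
HB.instance Definition _ j := GRing.isZmodMorphism.Build A {poly A}
  (monomial_map j) (monomial_map_additive j).

(* The extension of D : B -> A((s^-1)) to a map B[a] -> A[a]((s^-1)) that is
   linear in a. *)
Definition lextend (B : nzRingType) (D : B -> laurent A) (p : {poly B}) :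
    laurent {poly A} :=
  \sum_(j < size p) lmap (monomial_map j) (D p`_j).

End LaurentPoly.

(* The tensor product consists of formal sums of pairs, identified when all
   bilinear maps agree on them. *)
Section Tensor.
Context (F : fieldType) (A B : algType F).

Record bilinear_map (V : lmodType F) (f : A -> B -> V) : Prop := {
  bilinearPl : forall y, linear (f^~ y);
  bilinearPr : forall x, linear (f x) }.

Section BilinearTheory.
Context (V : lmodType F) (f : A -> B -> V) (fP : bilinear_map f).

Lemma bilinDl x x' y : f (x + x') y = f x y + f x' y.
Proof. by have := bilinearPl fP y 1 x x'; rewrite !scale1r. Qed.
Lemma bilinDr x y y' : f x (y + y') = f x y + f x y'.
Proof. by have := bilinearPr fP x 1 y y'; rewrite !scale1r. Qed.
Lemma bilin0l y : f 0 y = 0.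
Proof. by apply: (addrI (f 0 y)); rewrite -bilinDl !addr0. Qed.
Lemma bilin0r x : f x 0 = 0.
Proof. by apply: (addrI (f x 0)); rewrite -bilinDr !addr0. Qed.
Lemma bilinZl c x y : f (c *: x) y = c *: f x y.
Proof. by have := bilinearPl fP y c x 0; rewrite bilin0l !addr0. Qed.
Lemma bilinZr c x y : f x (c *: y) = c *: f x y.
Proof. by have := bilinearPr fP x c y 0; rewrite bilin0r !addr0. Qed.
Lemma bilinNl x y : f (- x) y = - f x y.
Proof. by rewrite -[- x]scaleN1r bilinZl scaleN1r. Qed.

End BilinearTheory.

Definition tsum (V : lmodType F) (f : A -> B -> V) (t : seq (A * B)) : V :=
  \sum_(w <- t) f w.1 w.2.

Definition teqv (t u : seq (A * B)) : bool :=
  `[< forall (V : lmodType F) (f : A -> B -> V),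
      bilinear_map f -> tsum f t = tsum f u >].

Lemma teqv_refl : reflexive teqv. Proof. by move=> t; apply/asboolP. Qed.
Lemma teqv_sym : symmetric teqv.
Proof. by move=> t u; apply/asboolP/asboolP => tu V f fP; rewrite tu. Qed.
Lemma teqv_trans : transitive teqv.
Proof.
by move=> u t v /asboolP tu /asboolP uv; apply/asboolP => V f fP; rewrite tu ?uv.
Qed.

Canonical teqv_equiv := EquivRel teqv teqv_refl teqv_sym teqv_trans.
Definition tensor : Type := {eq_quot teqv}.
HB.instance Definition _ := Choice.on tensor.
HB.instance Definition _ := EqQuotient.on tensor.

Definition tens (x : A) (y : B) : tensor := \pi_tensor [:: (x, y)].

Definition tlift (V : lmodType F) (f : A -> B -> V) of bilinear_map f :
  tensor -> V := fun t => tsum f (repr t).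

Lemma tlift_pi (V : lmodType F) (f : A -> B -> V) (fP : bilinear_map f) t :
  tlift fP (\pi_tensor t) = tsum f t.
Proof.
rewrite /tlift; suff /asboolP -> : teqv (repr (\pi_tensor t)) t by [].
by apply/eqmodP; rewrite reprK.
Qed.

Lemma tlift_tens (V : lmodType F) (f : A -> B -> V) (fP : bilinear_map f) x y :
  tlift fP (tens x y) = f x y.
Proof. by rewrite tlift_pi /tsum big_seq1. Qed.

Lemma tensorP (t u : tensor) :
  (forall (V : lmodType F) (f : A -> B -> V) (fP : bilinear_map f),
     tlift fP t = tlift fP u) -> t = u.
Proof.
move=> tu; rewrite -[t]reprK -[u]reprK; apply/eqmodP/asboolP => V f fP.
exact: tu.
Qed.

Definition tzero : tensor := \pi_tensor [::].
Definition tadd (t u : tensor) : tensor := \pi_tensor (repr t ++ repr u).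
Definition tscale (c : F) (t : tensor) : tensor :=
  \pi_tensor [seq (c *: w.1, w.2) | w <- repr t].
Definition topp := tscale (-1).

Section LiftTheory.
Context (V : lmodType F) (f : A -> B -> V) (fP : bilinear_map f).

Lemma tlift0_ : tlift fP tzero = 0.
Proof. by rewrite tlift_pi /tsum big_nil. Qed.
Lemma tliftD_ t u : tlift fP (tadd t u) = tlift fP t + tlift fP u.
Proof. by rewrite tlift_pi /tsum big_cat. Qed.
Lemma tliftZ_ c t : tlift fP (tscale c t) = c *: tlift fP t.
Proof.
rewrite tlift_pi /tlift /tsum big_map scaler_sumr.
by apply: eq_bigr => w _; rewrite /= bilinZl.
Qed.

End LiftTheory.

Let liftE := (tlift0_, tliftD_, tliftZ_).

Lemma taddA : associative tadd.
Proof. by move=> t u v; apply: tensorP => V f fP; rewrite !liftE addrA. Qed.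
Lemma taddC : commutative tadd.
Proof. by move=> t u; apply: tensorP => V f fP; rewrite !liftE addrC. Qed.
Lemma tadd0 : left_id tzero tadd.
Proof. by move=> t; apply: tensorP => V f fP; rewrite !liftE add0r. Qed.
Lemma taddN : left_inverse tzero topp tadd.
Proof. by move=> t; apply: tensorP => V f fP; rewrite !liftE scaleN1r addNr. Qed.

HB.instance Definition _ := GRing.isZmodule.Build tensor taddA taddC tadd0 taddN.

Lemma tscaleA b c t : tscale b (tscale c t) = tscale (b * c) t.
Proof. by apply: tensorP => V f fP; rewrite !liftE scalerA. Qed.
Lemma tscale1 : left_id 1 tscale.
Proof. by move=> t; apply: tensorP => V f fP; rewrite !liftE scale1r. Qed.
Lemma tscaleDr : right_distributive tscale +%R.
Proof. by move=> c t u; apply: tensorP => V f fP; rewrite !liftE scalerDr. Qed.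
Lemma tscaleDl t : {morph tscale^~ t : b c / b + c}.
Proof. by move=> b c; apply: tensorP => V f fP; rewrite !liftE scalerDl. Qed.

HB.instance Definition _ := GRing.Zmodule_isLmodule.Build F tensor
  tscaleA tscale1 tscaleDr tscaleDl.

Lemma tlift_linear (V : lmodType F) (f : A -> B -> V) (fP : bilinear_map f) :
  linear (tlift fP).
Proof. by move=> c t u; rewrite tliftD_ tliftZ_. Qed.
HB.instance Definition _ (V : lmodType F) (f : A -> B -> V)
  (fP : bilinear_map f) := GRing.isLinear.Build F tensor V *:%R (tlift fP)
  (tlift_linear fP).

Lemma tens_bilinear : bilinear_map tens.
Proof.
split=> z c x y; apply: tensorP => V f fP; rewrite linearP /= !tlift_tens.
  by rewrite (bilinDl fP) (bilinZl fP).
by rewrite (bilinDr fP) (bilinZr fP).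
Qed.

Lemma tens_ind (P : tensor -> Prop) :
  P 0 -> (forall x y t, P t -> P (tens x y + t)) -> forall t, P t.
Proof.
move=> P0 PD t; rewrite -[t]reprK; elim: (repr t) => [//|[x y] s IH].
suff -> : \pi_tensor ((x, y) :: s) = tens x y + \pi_tensor s by apply: PD.
apply: tensorP => V f fP; rewrite linearD /= tlift_tens !tlift_pi.
by rewrite /tsum big_cons.
Qed.

Lemma tens_linear_ext (V : lmodType F) (h k : {linear tensor -> V}) :
  (forall x y, h (tens x y) = k (tens x y)) -> h =1 k.
Proof.
move=> hk; apply: tens_ind => [|x y t IH]; first by rewrite !linear0.
by rewrite !linearD hk IH.
Qed.

Definition tone : tensor := tens 1 1.
Definition tmul (t u : tensor) : tensor :=
  \pi_tensor [seq (w.1 * z.1, w.2 * z.2) | w <- repr t, z <- repr u].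

Lemma bilin_mul (V : lmodType F) (f : A -> B -> V) (fP : bilinear_map f) x y :
  bilinear_map (fun x' y' => f (x * x') (y * y')).
Proof.
split=> z c u v /=.
  by rewrite mulrDr -scalerAr (bilinDl fP) (bilinZl fP).
by rewrite mulrDr -scalerAr (bilinDr fP) (bilinZr fP).
Qed.

Lemma bilin_mulr (V : lmodType F) (f : A -> B -> V) (fP : bilinear_map f) u :
  bilinear_map (fun x y => tlift (bilin_mul fP x y) u).
Proof.
split=> z c x y; elim/tens_ind: u => [|u v t IH].
- by rewrite !linear0 ?scaler0 ?addr0.
- rewrite !linearD /= !tlift_tens IH mulrDl -scalerAl (bilinDl fP) (bilinZl fP).
  by rewrite ?scalerDr addrACA.
- by rewrite !linear0 ?scaler0 ?addr0.
rewrite !linearD /= !tlift_tens IH mulrDl -scalerAl (bilinDr fP) (bilinZr fP).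
by rewrite ?scalerDr addrACA.
Qed.

Lemma tliftM (V : lmodType F) (f : A -> B -> V) (fP : bilinear_map f) t u :
  tlift fP (tmul t u) = tlift (bilin_mulr fP u) t.
Proof.
rewrite tlift_pi /tsum big_allpairs_dep; apply: eq_bigr => w _.
by rewrite /tlift.
Qed.

Lemma tmulDl : left_distributive tmul +%R.
Proof.
by move=> t u v; apply: tensorP => V f fP; rewrite linearD /= !tliftM linearD.
Qed.
Lemma tmulDr : right_distributive tmul +%R.
Proof.
move=> t u v; apply: tensorP => V f fP; rewrite linearD /= !tliftM.
rewrite /tlift /tsum -big_split; apply: eq_bigr => w _.
exact: (linearD (tlift (bilin_mul fP w.1 w.2))).
Qed.
Lemma tmul0l t : tmul 0 t = 0.
Proof. by apply: tensorP => V f fP; rewrite tliftM !linear0. Qed.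
Lemma tmul0r t : tmul t 0 = 0.
Proof. by apply: (addrI (tmul t 0)); rewrite -tmulDr !addr0. Qed.
Lemma tmul_tens x y x' y' :
  tmul (tens x y) (tens x' y') = tens (x * x') (y * y').
Proof. by apply: tensorP => V f fP; rewrite tliftM !tlift_tens. Qed.

Lemma tmulA : associative tmul.
Proof.
move=> t u v; elim/tens_ind: t => [|x y t]; first by rewrite !tmul0l.
move=> IHt; rewrite !tmulDl IHt; congr (_ + _) => {IHt t}.
elim/tens_ind: u => [|x' y' u IHu]; first by rewrite !(tmul0l, tmul0r).
rewrite !(tmulDl, tmulDr) IHu; congr (_ + _) => {IHu u}.
elim/tens_ind: v => [|x'' y'' v IHv]; first by rewrite !tmul0r.
by rewrite !tmulDr IHv !tmul_tens !mulrA.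
Qed.
Lemma tmul1l : left_id tone tmul.
Proof.
elim/tens_ind => [|x y t IH]; first by rewrite tmul0r.
by rewrite tmulDr IH tmul_tens !mul1r.
Qed.
Lemma tmul1r : right_id tone tmul.
Proof.
elim/tens_ind => [|x y t IH]; first by rewrite tmul0l.
by rewrite tmulDl IH tmul_tens !mulr1.
Qed.

HB.instance Definition _ := GRing.Zmodule_isPzRing.Build tensor
  tmulA tmul1l tmul1r tmulDl tmulDr.

Lemma tensM x y x' y' : tens x y * tens x' y' = tens (x * x') (y * y').
Proof. exact: tmul_tens. Qed.

Lemma tscaleAl (c : F) (t u : tensor) : c *: (t * u) = (c *: t) * u.
Proof. by apply: tensorP => V f fP; rewrite linearZ /= !tliftM linearZ. Qed.

Lemma tscaleAr (c : F) (t u : tensor) : c *: (t * u) = t * (c *: u).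
Proof.
apply: tensorP => V f fP; rewrite linearZ /= !tliftM /tlift /tsum scaler_sumr.
apply: eq_bigr => w _; apply/esym.
exact: (linearZ_LR (tlift (bilin_mul fP w.1 w.2))).
Qed.

End Tensor.

Definition rcomm (A : pzRingType) (x y : A) : A := x * y - y * x.

Lemma rmorph_rcomm (A B : pzRingType) (f : {rmorphism A -> B}) x y :
  f (rcomm x y) = rcomm (f x) (f y).
Proof. by rewrite rmorphB !rmorphM. Qed.

Inductive ygen (I : Type) := GenX of bool & I & nat | GenXi of I & nat.

Inductive yterm (F I : Type) :=
  | YGen of ygen I
  | YConst of F
  | YAdd of yterm F I & yterm F I
  | YMul of yterm F I & yterm F I.

HB.instance Definition _ (F I : Type) := gen_eqMixin (yterm F I).
HB.instance Definition _ (F I : Type) := gen_choiceMixin (yterm F I).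

Section Yangian.
Context (F : fieldType) (I : finType).
Variables (hbar : F) (d : I -> F) (a : I -> I -> F).

(* The sign of x^+ and x^-: x true is x^+ and x false is x^-. *)
Definition ysign (e : bool) : F := if e then 1 else -1.

Record yangian_rel (A : algType F)
    (x : bool -> I -> nat -> A) (xi : I -> nat -> A) : Prop := YangianRel {
  yrel_xixi : forall i j r s, rcomm (xi i r) (xi j s) = 0;
  yrel_xi0x : forall e i j s,
    rcomm (xi i 0%N) (x e j s) = (ysign e * (d i * a i j)) *: x e j s;
  yrel_xix : forall e i j r s,
    rcomm (xi i r.+1) (x e j s) - rcomm (xi i r) (x e j s.+1) =
    (ysign e * (hbar * (d i * a i j / 2%:R))) *:
      (xi i r * x e j s + x e j s * xi i r);
  yrel_xx : forall e i j r s,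
    rcomm (x e i r.+1) (x e j s) - rcomm (x e i r) (x e j s.+1) =
    (ysign e * (hbar * (d i * a i j / 2%:R))) *:
      (x e i r * x e j s + x e j s * x e i r);
  yrel_xpxm : forall i j r s,
    rcomm (x true i r) (x false j s) = if i == j then xi i (r + s)%N else 0;
  yrel_serre : forall e i j (m : nat) (r : 'I_m -> nat) s,
    i != j -> m%:R = 1 - a i j ->
    \sum_(p : {perm 'I_m})
      foldr (fun k y => rcomm (x e i (r (p k))) y) (x e j s) (enum 'I_m) = 0 }.

Fixpoint yeval (A : algType F) (x : bool -> I -> nat -> A) (xi : I -> nat -> A)
    (t : yterm F I) : A :=
  match t with
  | YGen (GenX e i r) => x e i r
  | YGen (GenXi i r) => xi i r
  | YConst c => c%:A
  | YAdd t1 t2 => yeval x xi t1 + yeval x xi t2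
  | YMul t1 t2 => yeval x xi t1 * yeval x xi t2
  end.

(* The congruence generated by the algebra axioms and the relations: two
   noncommutative polynomial expressions in the generators are identified
   when they agree in every algebra in which the relations hold. *)
Definition yeqv (t u : yterm F I) : bool :=
  `[< forall (A : algType F) (x : bool -> I -> nat -> A) (xi : I -> nat -> A),
      yangian_rel x xi -> yeval x xi t = yeval x xi u >].

Lemma yeqv_refl : reflexive yeqv. Proof. by move=> t; apply/asboolP. Qed.
Lemma yeqv_sym : symmetric yeqv.
Proof. by move=> t u; apply/asboolP/asboolP => tu A x xi H; rewrite tu. Qed.
Lemma yeqv_trans : transitive yeqv.
Proof.
by move=> u t v /asboolP tu /asboolP uv; apply/asboolP => A x xi H; rewrite tu ?uv.
Qed.

Canonical yeqv_equiv := EquivRel yeqv yeqv_refl yeqv_sym yeqv_trans.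
Definition yangian : Type := {eq_quot yeqv}.
HB.instance Definition _ := Choice.on yangian.
HB.instance Definition _ := EqQuotient.on yangian.

Definition ylift (A : algType F) (x : bool -> I -> nat -> A)
    (xi : I -> nat -> A) of yangian_rel x xi : yangian -> A :=
  fun y => yeval x xi (repr y).

Definition yX (e : bool) (i : I) (r : nat) : yangian :=
  \pi_yangian (YGen F (GenX e i r)).
Definition yXi (i : I) (r : nat) : yangian := \pi_yangian (YGen F (GenXi i r)).

Definition yconst (c : F) : yangian := \pi_yangian (YConst I c).
Definition yadd (y z : yangian) : yangian := \pi_yangian (YAdd (repr y) (repr z)).
Definition ymul (y z : yangian) : yangian := \pi_yangian (YMul (repr y) (repr z)).
Definition yscale (c : F) (y : yangian) : yangian := ymul (yconst c) y.
Definition yopp : yangian -> yangian := yscale (-1).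

Section LiftTheory.
Context (A : algType F) (x : bool -> I -> nat -> A) (xi : I -> nat -> A).
Hypothesis H : yangian_rel x xi.

Lemma ylift_pi t : ylift H (\pi_yangian t) = yeval x xi t.
Proof.
rewrite /ylift; suff /asboolP -> : yeqv (repr (\pi_yangian t)) t by [].
by apply/eqmodP; rewrite reprK.
Qed.

Lemma yliftX e i r : ylift H (yX e i r) = x e i r.
Proof. exact: ylift_pi. Qed.
Lemma yliftXi i r : ylift H (yXi i r) = xi i r.
Proof. exact: ylift_pi. Qed.
Lemma ylift_const c : ylift H (yconst c) = c%:A.
Proof. exact: ylift_pi. Qed.
Lemma yliftD_ y z : ylift H (yadd y z) = ylift H y + ylift H z.
Proof. exact: ylift_pi. Qed.
Lemma yliftM_ y z : ylift H (ymul y z) = ylift H y * ylift H z.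
Proof. exact: ylift_pi. Qed.
Lemma yliftZ_ c y : ylift H (yscale c y) = c *: ylift H y.
Proof. by rewrite yliftM_ ylift_const -scalerAl mul1r. Qed.

End LiftTheory.

Lemma yangianP (y z : yangian) :
  (forall (A : algType F) (x : bool -> I -> nat -> A) (xi : I -> nat -> A)
     (H : yangian_rel x xi), ylift H y = ylift H z) -> y = z.
Proof.
move=> yz; rewrite -[y]reprK -[z]reprK; apply/eqmodP/asboolP => A x xi H.
exact: yz.
Qed.

Let liftE := (ylift_const, yliftD_, yliftM_, yliftZ_, scale0r, scale1r).

Lemma yaddA : associative yadd.
Proof. by move=> y z t; apply: yangianP => *; rewrite !liftE addrA. Qed.
Lemma yaddC : commutative yadd.
Proof. by move=> y z; apply: yangianP => *; rewrite !liftE addrC. Qed.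
Lemma yadd0 : left_id (yconst 0) yadd.
Proof. by move=> y; apply: yangianP => *; rewrite !liftE add0r. Qed.
Lemma yaddN : left_inverse (yconst 0) yopp yadd.
Proof.
move=> y; apply: yangianP => A x xi H.
by rewrite yliftD_ (yliftZ_ H (-1)) ylift_const scale0r scaleN1r addNr.
Qed.

HB.instance Definition _ := GRing.isZmodule.Build yangian yaddA yaddC yadd0 yaddN.

Lemma ymulA : associative ymul.
Proof. by move=> y z t; apply: yangianP => *; rewrite !liftE mulrA. Qed.
Lemma ymul1l : left_id (yconst 1) ymul.
Proof. by move=> y; apply: yangianP => *; rewrite !liftE mul1r. Qed.
Lemma ymul1r : right_id (yconst 1) ymul.
Proof. by move=> y; apply: yangianP => *; rewrite !liftE mulr1. Qed.
Lemma ymulDl : left_distributive ymul yadd.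
Proof. by move=> y z t; apply: yangianP => *; rewrite !liftE mulrDl. Qed.
Lemma ymulDr : right_distributive ymul yadd.
Proof. by move=> y z t; apply: yangianP => *; rewrite !liftE mulrDr. Qed.

Lemma ycounit_rel :
  yangian_rel (fun _ _ _ => 0 : F^o) (fun _ _ => 0 : F^o).
Proof.
have c0 (x : F^o) : rcomm x 0 = 0 by rewrite /rcomm mulr0 mul0r subrr.
split=> [i j r s|e i j s|e i j r s|e i j r s|i j r s|e i j m r s ij mE].
- exact: c0.
- by rewrite c0 scaler0.
- by rewrite !c0 subr0 !mulr0 addr0 scaler0.
- by rewrite !c0 subr0 !mulr0 addr0 scaler0.
- by rewrite c0 if_same.
by rewrite big1 // => p _; elim: (enum _) => //= k l ->; rewrite c0.
Qed.

Lemma yone_neq0 : yconst 1 != 0 :> yangian.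
Proof.
apply/eqP => /(congr1 (ylift ycounit_rel))/eqP.
by rewrite !ylift_const scale1r scale0r oner_eq0.
Qed.

HB.instance Definition _ := GRing.Zmodule_isNzRing.Build yangian
  ymulA ymul1l ymul1r ymulDl ymulDr yone_neq0.

Lemma yscaleA b c y : yscale b (yscale c y) = yscale (b * c) y.
Proof. by apply: yangianP => *; rewrite !yliftZ_ scalerA. Qed.
Lemma yscale1 : left_id 1 yscale.
Proof. exact: ymul1l. Qed.
Lemma yscaleDr : right_distributive yscale +%R.
Proof. by move=> c y z; apply: ymulDr. Qed.
Lemma yscaleDl y : {morph yscale^~ y : b c / b + c}.
Proof.
move=> b c; apply: yangianP => A x xi H.
by rewrite yliftZ_ scalerDl -!(yliftZ_ H) -yliftD_.
Qed.

HB.instance Definition _ := GRing.Zmodule_isLmodule.Build F yangian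
  yscaleA yscale1 yscaleDr yscaleDl.

Lemma yscaleAl (c : F) (y z : yangian) : c *: (y * z) = (c *: y) * z.
Proof. exact: ymulA. Qed.
HB.instance Definition _ := GRing.Lmodule_isLalgebra.Build F yangian yscaleAl.

Lemma yscaleAr (c : F) (y z : yangian) : c *: (y * z) = y * (c *: z).
Proof.
apply: yangianP => A x xi H; rewrite (yliftZ_ H c) yliftM_ scalerAr.
by rewrite -(yliftZ_ H c) -yliftM_.
Qed.
HB.instance Definition _ := GRing.Lalgebra_isAlgebra.Build F yangian yscaleAr.

Section LiftMorphism.
Context (A : algType F) (x : bool -> I -> nat -> A) (xi : I -> nat -> A).
Hypothesis H : yangian_rel x xi.

Lemma ylift_linear : linear (ylift H).
Proof. by move=> c y z; rewrite yliftD_ yliftZ_. Qed.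
HB.instance Definition _ :=
  GRing.isLinear.Build F yangian A *:%R (ylift H) ylift_linear.
Lemma ylift_monoid_morphism : monoid_morphism (ylift H).
Proof. by split=> [|y z]; rewrite ?ylift_const ?scale1r // yliftM_. Qed.
HB.instance Definition _ :=
  GRing.isMonoidMorphism.Build yangian A (ylift H) ylift_monoid_morphism.

End LiftMorphism.

Lemma yangian_relP : yangian_rel yX yXi.
Proof.
split=> [i j r s|e i j s|e i j r s|e i j r s|i j r s|e i j m r s ij mE];
  apply: yangianP => A x xi H.
- by rewrite rmorph_rcomm rmorph0 /= !yliftXi; apply: (yrel_xixi H).
- by rewrite rmorph_rcomm linearZ /= yliftXi yliftX; apply: (yrel_xi0x H).
- rewrite rmorphB !rmorph_rcomm linearZ rmorphD !rmorphM /= !yliftXi !yliftX.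
  exact: (yrel_xix H).
- rewrite rmorphB !rmorph_rcomm linearZ rmorphD !rmorphM /= !yliftX.
  exact: (yrel_xx H).
- rewrite rmorph_rcomm /= !yliftX (yrel_xpxm H).
  by case: ifP => _ /=; rewrite ?yliftXi // (rmorph0 (ylift H)).
rewrite rmorph_sum rmorph0 -[RHS](yrel_serre H e r s ij mE).
apply: eq_bigr => p _; elim: (enum _) => [|k l IH] /=; first by rewrite yliftX.
by rewrite rmorph_rcomm /= IH yliftX.
Qed.

Lemma yangian_ind (P : yangian -> Prop) :
    (forall c, P c%:A) -> (forall e i r, P (yX e i r)) ->
    (forall i r, P (yXi i r)) ->
    (forall y z, P y -> P z -> P (y + z)) ->
    (forall y z, P y -> P z -> P (y * z)) ->
  forall y, P y.
Proof.
move=> Pc PX PXi PD PM y; rewrite -[y]reprK.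
elim: (repr y) => [[e i r|i r]|c|t Pt u Pu|t Pt u Pu].
- exact: PX.
- exact: PXi.
- suff -> : \pi_yangian (YConst I c) = c%:A by exact: Pc.
  by apply: yangianP => *; rewrite linearZ /= rmorph1 ylift_const.
- suff -> : \pi_yangian (YAdd t u) = \pi_yangian t + \pi_yangian u by exact: PD.
  by apply: yangianP => *; rewrite rmorphD /= !ylift_pi.
suff -> : \pi_yangian (YMul t u) = \pi_yangian t * \pi_yangian u by exact: PM.
by apply: yangianP => *; rewrite rmorphM /= !ylift_pi.
Qed.

Lemma yangian_ext (A : algType F) (f g : {lrmorphism yangian -> A}) :
    (forall e i r, f (yX e i r) = g (yX e i r)) ->
    (forall i r, f (yXi i r) = g (yXi i r)) ->
  f =1 g.
Proof.
move=> fgX fgXi; apply: yangian_ind => // [c|y z fy fz|y z fy fz].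
- by rewrite !linearZ /= !rmorph1.
- by rewrite !rmorphD /= fy fz.
by rewrite !rmorphM /= fy fz.
Qed.

Definition ycounit : yangian -> F^o := ylift ycounit_rel.
HB.instance Definition _ := GRing.LRMorphism.on ycounit.

End Yangian.

Section Shift.
Context (A : nzRingType).
Implicit Types (y z : nat -> A) (f g : nat -> nat -> A).

Definition shiftp y (r : nat) : {poly A} :=
  \sum_(k < r.+1) (y k *+ 'C(r, k)) *: 'X^(r - k).

Lemma coef_shiftp y r j : (shiftp y r)`_j = y (r - j)%N *+ 'C(r, j).
Proof.
rewrite /shiftp coef_sum; case: (leqP j r) => jr; last first.
  rewrite bin_small // mulr0n big1 // => k _.
  by rewrite coefZ coefXn; case: eqP => [|_]; rewrite ?mulr0 //; lia.
rewrite (bigD1 (inord (r - j)%N)) //= big1 => [|k /eqP kj]; last first.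
  rewrite coefZ coefXn; case: eqP => [jE|_]; rewrite ?mulr0 //; case: kj.
  by apply: val_inj; rewrite /= inordK //; have := ltn_ord k; lia.
by rewrite inordK ?coefZ ?coefXn ?subKn // ?bin_sub // ?eqxx ?mulr1 ?addr0 //; lia.
Qed.

Lemma shiftpS y r :
  shiftp y r.+1 = shiftp (fun k => y k.+1) r + shiftp y r * 'X.
Proof.
apply/polyP => -[|j]; rewrite coefD coefMX !coef_shiftp /=.
  by rewrite !subn0 !bin0 addr0.
rewrite subSS binS mulrnDr; congr (_ + _).
by case: (ltnP j r) => jr; [rewrite -subSn // subSS | rewrite bin_small ?mulr0n].
Qed.

Lemma shiftpD y z r : shiftp (fun k => y k + z k) r = shiftp y r + shiftp z r.
Proof. by apply/polyP => j; rewrite coefD !coef_shiftp mulrnDl. Qed.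
Lemma shiftpN y r : shiftp (fun k => - y k) r = - shiftp y r.
Proof. by apply/polyP => j; rewrite coefN !coef_shiftp mulNrn. Qed.
Lemma shiftpMl x y r : shiftp (fun k => x * y k) r = x%:P * shiftp y r.
Proof. by apply/polyP => j; rewrite coefCM !coef_shiftp mulrnAr. Qed.
Lemma shiftpMr x y r : shiftp (fun k => y k * x) r = shiftp y r * x%:P.
Proof. by apply/polyP => j; rewrite coefMC !coef_shiftp mulrnAl. Qed.
Lemma eq_shiftp y z r : y =1 z -> shiftp y r = shiftp z r.
Proof. by move=> yz; apply/polyP => j; rewrite !coef_shiftp yz. Qed.
Lemma shiftp0 r : shiftp (fun _ => 0) r = 0.
Proof. by apply/polyP => j; rewrite coef_shiftp coef0 mul0rn. Qed.
Lemma shiftp_0 y : shiftp y 0 = (y 0%N)%:P.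
Proof. by rewrite /shiftp big_ord1 bin0 mulr1n subn0 expr0 alg_polyC. Qed.

Definition bishift f r s : {poly A} :=
  \sum_(l < s.+1) shiftp (fun k => f k l *+ 'C(s, l)) r * 'X^(s - l).

Lemma eq_bishift f g r s : f =2 g -> bishift f r s = bishift g r s.
Proof.
move=> fg; apply: eq_bigr => l _; congr (_ * _).
by apply: eq_shiftp => k; rewrite fg.
Qed.
Lemma bishiftD f g r s :
  bishift (fun k l => f k l + g k l) r s = bishift f r s + bishift g r s.
Proof.
rewrite -big_split; apply: eq_bigr => l _; rewrite /= -mulrDl -shiftpD.
by congr (_ * _); apply: eq_shiftp => k; rewrite mulrnDl.
Qed.
Lemma bishiftN f r s : bishift (fun k l => - f k l) r s = - bishift f r s.
Proof.
rewrite /bishift -sumrN; apply: eq_bigr => l _; rewrite -mulNr -shiftpN.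
by congr (_ * _); apply: eq_shiftp => k; rewrite mulNrn.
Qed.
Lemma bishiftB f g r s :
  bishift (fun k l => f k l - g k l) r s = bishift f r s - bishift g r s.
Proof. by rewrite (bishiftD f (fun k l => - g k l)) bishiftN. Qed.
Lemma bishiftMl x f r s :
  bishift (fun k l => x * f k l) r s = x%:P * bishift f r s.
Proof.
rewrite /bishift mulr_sumr; apply: eq_bigr => l _; rewrite mulrA -shiftpMl.
by congr (_ * _); apply: eq_shiftp => k; rewrite mulrnAr.
Qed.
Lemma bishift0 r s : bishift (fun _ _ => 0) r s = 0.
Proof.
apply: big1 => l _; rewrite (@eq_shiftp _ (fun _ => 0)) ?shiftp0 ?mul0r // => k.
by rewrite mul0rn.
Qed.
Lemma bishiftS f r s :
  bishift f r.+1 s = bishift (fun k => f k.+1) r s + bishift f r s * 'X.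
Proof.
rewrite /bishift mulr_suml -big_split; apply: eq_bigr => l _ /=.
by rewrite shiftpS mulrDl -!mulrA -exprS -exprSr.
Qed.

Lemma mul_shiftp y z r s :
  shiftp y r * shiftp z s = bishift (fun k l => y k * z l) r s.
Proof.
rewrite {2}/shiftp mulr_sumr; apply: eq_bigr => l _.
rewrite -mul_polyC mulrA -shiftpMr; congr (_ * _).
by apply: eq_shiftp => k; rewrite mulrnAr.
Qed.
Lemma mul_shiftpC y z r s :
  shiftp z s * shiftp y r = bishift (fun k l => z l * y k) r s.
Proof.
rewrite {1}/shiftp mulr_suml; apply: eq_bigr => l _.
rewrite -mul_polyC -mulrA -commr_polyXn mulrA -shiftpMl; congr (_ * _).
by apply: eq_shiftp => k; rewrite mulrnAl.
Qed.
Lemma rcomm_shiftp y z r s :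
  rcomm (shiftp y r) (shiftp z s) = bishift (fun k l => rcomm (y k) (z l)) r s.
Proof. by rewrite /rcomm mul_shiftp mul_shiftpC bishiftB. Qed.

Lemma bishift_add y r s : bishift (fun k l => y (k + l)%N) r s = shiftp y (r + s).
Proof.
elim: r y => [|r IH] y.
  rewrite /bishift /shiftp; apply: eq_bigr => l _.
  by rewrite big_ord1 bin0 mulr1n subn0 expr0 alg_polyC mul_polyC.
by rewrite bishiftS addSn shiftpS -(IH (fun k => y k.+1)) -(IH y).
Qed.

Lemma rcommXr (p q : {poly A}) : rcomm p (q * 'X) = rcomm p q * 'X.
Proof. by rewrite /rcomm mulrBl -!mulrA (commr_polyX p). Qed.
Lemma rcommXl (p q : {poly A}) : rcomm (p * 'X) q = rcomm p q * 'X.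
Proof. by rewrite /rcomm mulrBl -!mulrA (commr_polyX q). Qed.
Lemma rcommDl (p q t : A) : rcomm (p + q) t = rcomm p t + rcomm q t.
Proof. by rewrite /rcomm mulrDl mulrDr opprD addrACA. Qed.
Lemma rcommDr (p q t : A) : rcomm t (p + q) = rcomm t p + rcomm t q.
Proof. by rewrite /rcomm mulrDl mulrDr opprD addrACA. Qed.
Lemma rcomm0l (p : A) : rcomm 0 p = 0.
Proof. by rewrite /rcomm mul0r mulr0 subrr. Qed.
Lemma rcomm0r (p : A) : rcomm p 0 = 0.
Proof. by rewrite /rcomm mul0r mulr0 subrr. Qed.

End Shift.

Lemma shiftp_cross (A : nzRingType) (y z : nat -> A) r s :
  rcomm (shiftp y r.+1) (shiftp z s) - rcomm (shiftp y r) (shiftp z s.+1) =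
  bishift (fun k l => rcomm (y k.+1) (z l) - rcomm (y k) (z l.+1)) r s.
Proof.
rewrite !shiftpS rcommDl rcommDr rcommXl rcommXr opprD addrACA subrr addr0.
rewrite !rcomm_shiftp; apply/esym.
exact: (bishiftB (fun k l => rcomm (y k.+1) (z l))).
Qed.

(* The nested commutators of the Serre relations, as a multi-additive map. *)
Section SerreSum.
Context (A : nzRingType) (m : nat).
Implicit Types (y : 'I_m -> A) (z u v : A) (i : 'I_m) (l : seq 'I_m).
Implicit Types p : {perm 'I_m}.

Definition serre_nest (p : {perm 'I_m}) y z (l : seq 'I_m) : A :=
  foldr (fun k w => rcomm (y (p k)) w) z l.
Definition serre_sum y z : A :=
  \sum_(p : {perm 'I_m}) serre_nest p y z (enum 'I_m).

Definition upd y i v : 'I_m -> A := fun j => if j == i then v else y j.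

Lemma updE y i : upd y i (y i) = y.
Proof. by apply/funext => j; rewrite /upd; case: eqP => // ->. Qed.

Lemma serre_nestDr p y z z' l :
  serre_nest p y (z + z') l = serre_nest p y z l + serre_nest p y z' l.
Proof. by elim: l => //= k l ->; rewrite rcommDr. Qed.
Lemma serre_nest0r p y l : serre_nest p y 0 l = 0.
Proof. by elim: l => //= k l ->; rewrite rcomm0r. Qed.

Lemma serre_nest_upd p y z i u v l : i \notin [seq p k | k <- l] ->
  serre_nest p (upd y i u) z l = serre_nest p (upd y i v) z l.
Proof.
elim: l => //= k l IH; rewrite in_cons negb_or => /andP[ik /IH->].
by rewrite /upd eq_sym (negbTE ik).
Qed.

Lemma serre_nestDl p y z i u v l :
    uniq [seq p k | k <- l] -> i \in [seq p k | k <- l] ->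
  serre_nest p (upd y i (u + v)) z l =
  serre_nest p (upd y i u) z l + serre_nest p (upd y i v) z l.
Proof.
elim: l => //= k l IH /andP[kl ul]; rewrite in_cons; case: eqP => [-> _|ik /= il].
  rewrite {1 3 5}/upd eqxx rcommDl.
  by rewrite (serre_nest_upd y z (u + v) u kl) (serre_nest_upd y z v u kl).
have pki w : upd y i w (p k) = y (p k) by rewrite /upd; case: eqP => // /esym.
by rewrite IH // !pki rcommDr.
Qed.

Lemma mem_perm_enum (p : {perm 'I_m}) i : i \in [seq p k | k <- enum 'I_m].
Proof.
by apply/mapP; exists ((p^-1)%g i); rewrite ?mem_enum ?permKV.
Qed.
Lemma uniq_perm_enum (p : {perm 'I_m}) : uniq [seq p k | k <- enum 'I_m].
Proof. by rewrite map_inj_uniq ?enum_uniq //; apply: perm_inj. Qed.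

Lemma serre_sumDl y z i u v :
  serre_sum (upd y i (u + v)) z = serre_sum (upd y i u) z + serre_sum (upd y i v) z.
Proof.
rewrite -big_split; apply: eq_bigr => p _.
by apply: serre_nestDl; rewrite ?uniq_perm_enum ?mem_perm_enum.
Qed.
Lemma serre_sum0l y z i : serre_sum (upd y i 0) z = 0.
Proof. by apply: (addrI (serre_sum (upd y i 0) z)); rewrite -serre_sumDl !addr0. Qed.
Lemma serre_sumDr y z z' : serre_sum y (z + z') = serre_sum y z + serre_sum y z'.
Proof. by rewrite -big_split; apply: eq_bigr => p _; apply: serre_nestDr. Qed.
Lemma serre_sum0r y : serre_sum y 0 = 0.
Proof. by apply: big1 => p _; apply: serre_nest0r. Qed.

Inductive add_closure (S : A -> Prop) : A -> Prop :=
  | add_closure0 : add_closure S 0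
  | add_closureD u v : S u -> add_closure S v -> add_closure S (u + v).

Lemma serre_sum_closure (S S' : A -> Prop) y z :
    (forall y' z', (forall i, S (y' i)) -> S' z' -> serre_sum y' z' = 0) ->
    (forall i, add_closure S (y i)) -> add_closure S' z ->
  serre_sum y z = 0.
Proof.
move=> SS' yS; elim=> [|u v Su _ IH]; first exact: serre_sum0r.
rewrite serre_sumDr IH addr0.
suff H n : forall y', (forall i : 'I_m, (i < n)%N -> add_closure S (y' i)) ->
    (forall i : 'I_m, (n <= i)%N -> S (y' i)) -> serre_sum y' u = 0.
  by apply: (H m) => // i; have := ltn_ord i; lia.
elim: n => [|n IHn] y' yc yS'; first by apply: SS' => // i; apply: yS'.
case: (ltnP n m) => [nm|mn]; last first.
  apply: IHn => i; first by move=> ?; apply: yc; lia.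
  by have := ltn_ord i; lia.
pose i0 := Ordinal nm; rewrite -(updE y' i0).
have := yc i0 (ltnSn n); elim=> [|w w' Sw _ IHw]; first exact: serre_sum0l.
rewrite serre_sumDl IHw addr0; apply: IHn => i ni; rewrite /upd.
  by rewrite ifF; [apply: yc; lia | apply/eqP => iE; move: ni; rewrite iE /=; lia].
by case: eqP => // /eqP; rewrite -val_eqE /= => ni'; apply: yS'; lia.
Qed.

End SerreSum.

Lemma serre_nest_poly (A : nzRingType) m (p : {perm 'I_m}) (x : 'I_m -> A)
    (n : 'I_m -> nat) (z : A) (q : nat) l :
  serre_nest p (fun i => (x i)%:P * 'X^(n i)) (z%:P * 'X^q) l =
  (serre_nest p x z l)%:P * 'X^(q + \sum_(k <- l) n (p k)).
Proof.
elim: l => [|k l IH] /=; first by rewrite big_nil addn0.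
rewrite big_cons IH /rcomm polyCB !polyCM mulrBl; congr (_ - _).
  rewrite -!mulrA; congr (_ * _); rewrite !mulrA -commr_polyXn -mulrA -exprD.
  by congr (_ * 'X^_); lia.
rewrite -!mulrA; congr (_ * _); rewrite !mulrA -commr_polyXn -mulrA -exprD.
by congr (_ * 'X^_); lia.
Qed.

Lemma shiftp_closure (A : nzRingType) (y : nat -> A) r :
  add_closure (fun p : {poly A} => exists k n, p = (y k)%:P * 'X^n) (shiftp y r).
Proof.
rewrite /shiftp; elim/big_rec: _ => [|k p _ IH]; first exact: add_closure0.
elim: 'C(r, k) => [|c IHc]; first by rewrite mulr0n scale0r add0r.
rewrite mulrS scalerDl -addrA; apply: add_closureD IHc.
by exists k, (r - k)%N; rewrite mul_polyC.
Qed.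

Section ShiftRel.
Context (F : fieldType) (I : finType).
Variables (hbar : F) (d : I -> F) (a : I -> I -> F).
Context (A : algType F) (x : bool -> I -> nat -> A) (xi : I -> nat -> A).
Hypothesis H : yangian_rel hbar d a x xi.

Lemma polyalgZE (c : F) (p : polyalg A) : c *: p = (c%:A)%:P * p.
Proof. by []. Qed.

Lemma shift_rel : yangian_rel hbar d a
  (fun e i r => shiftp (x e i) r : polyalg A) (fun i r => shiftp (xi i) r).
Proof.
split=> [i j r s|e i j s|e i j r s|e i j r s|i j r s|e i j m r s ij mE].
- rewrite rcomm_shiftp (@eq_bishift _ _ (fun _ _ => 0)) ?bishift0 // => k l.
  exact: (yrel_xixi H).
- rewrite rcomm_shiftp polyalgZE -shiftpMl (_ : 0%N = 0%N + 0)%N // .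
  rewrite /bishift -[in RHS](add0n s) -bishift_add; apply: eq_bigr => l _.
  congr (_ * _); rewrite !shiftp_0 (yrel_xi0x H).
  by rewrite -scalerAl mul1r.
- rewrite shiftp_cross mul_shiftp mul_shiftpC -bishiftD polyalgZE -bishiftMl.
  by apply: eq_bishift => k l; rewrite (yrel_xix H) -scalerAl mul1r.
- rewrite shiftp_cross mul_shiftp mul_shiftpC -bishiftD polyalgZE -bishiftMl.
  by apply: eq_bishift => k l; rewrite (yrel_xx H) -scalerAl mul1r.
- rewrite rcomm_shiftp; case: (boolP (i == j)) => ij.
    rewrite -bishift_add; apply: eq_bishift => k l.
    by rewrite (yrel_xpxm H) ij.
  rewrite (@eq_bishift _ _ (fun _ _ => 0)) ?bishift0 // => k l.
  by rewrite (yrel_xpxm H) (negbTE ij).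
apply: (@serre_sum_closure {poly A} m _ _ (fun k => shiftp (x e i) (r k))
  (shiftp (x e j) s) _ (fun k => shiftp_closure (x e i) (r k))
  (shiftp_closure (x e j) s)).
move=> y z yE [t [q ->]].
have /choice[k kE] : forall l, exists k : nat * nat, y l = (x e i k.1)%:P * 'X^(k.2).
  by move=> l; have [u [v ->]] := yE l; exists (u, v).
have -> : y = fun l => (x e i (k l).1)%:P * 'X^((k l).2) by apply/funext.
rewrite /serre_sum (eq_bigr (fun p : {perm 'I_m} =>
  (serre_nest p (fun l => x e i (k l).1) (x e j t) (enum 'I_m))%:P *
  'X^(q + \sum_(l < m) (k l).2))) => [|p _].
  by rewrite -mulr_suml -rmorph_sum (yrel_serre H e (fun l => (k l).1) t ij mE) mul0r.
rewrite (serre_nest_poly p (fun l => x e i (k l).1) (fun l => (k l).2)).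
rewrite big_enum; congr (_ * 'X^(q + _)); apply/esym.
exact: (reindex_inj (@perm_inj _ p)).
Qed.

End ShiftRel.

Section YangianMaps.
Context (F : fieldType) (I : finType).
Variables (hbar : F) (d : I -> F) (a : I -> I -> F).
Local Notation Y := (yangian hbar d a).

(* tau_a(y_r) = \sum_k 'C(r, k) a^(r - k) y_k *)
Definition ytau : Y -> polyalg Y :=
  ylift (shift_rel (yangian_relP hbar d a)).
HB.instance Definition _ := GRing.LRMorphism.on ytau.

Lemma ytauX e i r : ytau (yX hbar d a e i r) = shiftp (yX hbar d a e i) r.
Proof. exact: yliftX. Qed.
Lemma ytauXi i r : ytau (yXi hbar d a i r) = shiftp (yXi hbar d a i) r.
Proof. exact: yliftXi. Qed.

(* hbar \sum_r t_(i,r) u^(-r-1) = log (1 + hbar \sum_r xi_(i,r) u^(-r-1)),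
   with 'X standing for u^-1; only xi_(i,0), ..., xi_(i,r) and the first r + 1
   powers in the logarithm contribute to t_(i,r). *)
Definition xi_poly (i : I) (r : nat) : {poly Y} :=
  \sum_(k < r.+1) (hbar *: yXi hbar d a i k) *: 'X^(k.+1).
Definition yt (i : I) (r : nat) : Y :=
  hbar^-1 *: \sum_(1 <= n < r.+2)
    ((-1) ^+ n.-1 / n%:R) *: (xi_poly i r ^+ n)`_(r.+1).

(* The algebra filtration with deg x_(i,r) = deg xi_(i,r) = r. *)
Inductive yfilt : nat -> Y -> Prop :=
  | yfiltX e i r : yfilt r (yX hbar d a e i r)
  | yfiltXi i r : yfilt r (yXi hbar d a i r)
  | yfilt1 : yfilt 0 1
  | yfiltM m n y z : yfilt m y -> yfilt n z -> yfilt (m + n) (y * z)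
  | yfilt_lin n c y z : yfilt n y -> yfilt n z -> yfilt n (c *: y + z)
  | yfilt_le m n y : (m <= n)%N -> yfilt m y -> yfilt n y.

Definition yangian2 : Type := tensor Y Y.
HB.instance Definition _ := GRing.PzRing.on yangian2.
HB.instance Definition _ := GRing.Lmodule.on yangian2.

Inductive tfilt (n : nat) : yangian2 -> Prop :=
  | tfilt0 : tfilt n 0
  | tfilt_tens p q y z : (p + q <= n)%N -> yfilt p y -> yfilt q z ->
      tfilt n (tens y z)
  | tfilt_lin c t u : tfilt n t -> tfilt n u -> tfilt n (c *: t + u).

(* s^k \prod_(n >= 0) F_n(Y (x) Y) s^(-n) *)
Definition lfilt (k : nat) (f : laurent yangian2) : Prop :=
  lbounded f k%:Z /\ forall n : nat, tfilt n (f (k%:Z - n%:Z)).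

(* epsilon (x) 1 and 1 (x) epsilon, with values in C (x) Y = Y (x) C = Y. *)
Definition counit_l_fun (y z : Y) : Y := (ycounit y : F) *: z.
Definition counit_r_fun (y z : Y) : Y := (ycounit z : F) *: y.

Lemma counit_l_bilinear : bilinear_map counit_l_fun.
Proof.
split=> [z c x y|x c y z]; rewrite /counit_l_fun.
  by rewrite linearP scalerDl scalerA.
by rewrite scalerDr !scalerA mulrC.
Qed.
Lemma counit_r_bilinear : bilinear_map counit_r_fun.
Proof.
split=> [z c x y|x c y z]; rewrite /counit_r_fun.
  by rewrite scalerDr !scalerA mulrC.
by rewrite linearP scalerDl scalerA.
Qed.

Definition counit_l : yangian2 -> Y := tlift counit_l_bilinear.
HB.instance Definition _ := GRing.Linear.on counit_l.
Definition counit_r : yangian2 -> Y := tlift counit_r_bilinear.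
HB.instance Definition _ := GRing.Linear.on counit_r.

Lemma counit_l_tens y z : counit_l (tens y z) = (ycounit y : F) *: z.
Proof. exact: tlift_tens. Qed.
Lemma counit_r_tens y z : counit_r (tens y z) = (ycounit z : F) *: y.
Proof. exact: tlift_tens. Qed.

Lemma yangian2_one_neq0 : (1 : yangian2) != 0.
Proof.
apply/eqP => /(congr1 counit_l)/eqP; rewrite linear0 /counit_l tlift_tens.
by rewrite /counit_l_fun rmorph1 scale1r oner_eq0.
Qed.
HB.instance Definition _ :=
  GRing.PzSemiRing_isNonZero.Build yangian2 yangian2_one_neq0.
HB.instance Definition _ :=
  GRing.Lmodule_isLalgebra.Build F yangian2 (@tscaleAl F Y Y).
HB.instance Definition _ :=
  GRing.Lalgebra_isAlgebra.Build F yangian2 (@tscaleAr F Y Y).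

Definition tensl (y : Y) : yangian2 := tens y 1.
Definition tensr (y : Y) : yangian2 := tens 1 y.

Lemma tensl_linear : linear tensl.
Proof. exact: (bilinearPl (@tens_bilinear F Y Y) 1). Qed.
HB.instance Definition _ := GRing.isLinear.Build F Y yangian2 *:%R tensl tensl_linear.
Lemma tensl_monoid_morphism : monoid_morphism tensl.
Proof. by split=> // y z; rewrite /tensl [RHS]tensM mulr1. Qed.
HB.instance Definition _ :=
  GRing.isMonoidMorphism.Build Y yangian2 tensl tensl_monoid_morphism.

Lemma tensr_linear : linear tensr.
Proof. exact: (bilinearPr (@tens_bilinear F Y Y) 1). Qed.
HB.instance Definition _ := GRing.isLinear.Build F Y yangian2 *:%R tensr tensr_linear.
Lemma tensr_monoid_morphism : monoid_morphism tensr.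
Proof. by split=> // y z; rewrite /tensr [RHS]tensM mulr1. Qed.
HB.instance Definition _ :=
  GRing.isMonoidMorphism.Build Y yangian2 tensr tensr_monoid_morphism.

(* The tensor product over C[a] of p and q in Y[a], as an element of
   (Y (x) Y)[a]. *)
Definition tens_poly (p q : {poly Y}) : polyalg yangian2 :=
  map_poly tensl p * map_poly tensr q.

Lemma map_tensl_linear (c : F) (p q : polyalg Y) :
  map_poly tensl (c *: p + q) = c *: (map_poly tensl p : polyalg yangian2) +
    map_poly tensl q.
Proof.
by rewrite rmorphD rmorphM /= map_polyC /= linearZ rmorph1.
Qed.
Lemma map_tensr_linear (c : F) (p q : polyalg Y) :
  map_poly tensr (c *: p + q) = c *: (map_poly tensr p : polyalg yangian2) +
    map_poly tensr q.
Proof.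
by rewrite rmorphD rmorphM /= map_polyC /= linearZ rmorph1.
Qed.

Lemma tens_poly_linearl c (p p' : polyalg Y) q :
  tens_poly (c *: p + p') q = c *: tens_poly p q + tens_poly p' q.
Proof.
rewrite /tens_poly map_tensl_linear mulrDl; congr (_ + _).
by apply/esym; apply: polyalg_scaleAl.
Qed.
Lemma tens_poly_linearr c p (q q' : polyalg Y) :
  tens_poly p (c *: q + q') = c *: tens_poly p q + tens_poly p q'.
Proof.
rewrite /tens_poly map_tensr_linear mulrDr; congr (_ + _).
by apply/esym; apply: polyalg_scaleAr.
Qed.

Definition tau_tau_fun (y z : Y) : polyalg yangian2 :=
  tens_poly (ytau y) (ytau z).
Definition tau_one_fun (y z : Y) : polyalg yangian2 := tens_poly (ytau y) z%:P.

Lemma tau_tau_bilinear : bilinear_map tau_tau_fun.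
Proof.
split=> [z c x y|x c y z]; rewrite /tau_tau_fun linearP.
  exact: tens_poly_linearl.
exact: tens_poly_linearr.
Qed.
Lemma tau_one_bilinear : bilinear_map tau_one_fun.
Proof.
split=> [z c x y|x c y z]; rewrite /tau_one_fun.
  by rewrite linearP; apply: tens_poly_linearl.
by rewrite polyCD polyalgCZ; apply: tens_poly_linearr.
Qed.

Definition tau_tau : yangian2 -> {poly yangian2} := tlift tau_tau_bilinear.
HB.instance Definition _ := GRing.isZmodMorphism.Build yangian2 {poly yangian2}
  tau_tau (raddfB (tlift tau_tau_bilinear)).
Definition tau_one : yangian2 -> {poly yangian2} := tlift tau_one_bilinear.
HB.instance Definition _ := GRing.isZmodMorphism.Build yangian2 {poly yangian2}
  tau_one (raddfB (tlift tau_one_bilinear)).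

Lemma tau_tau_tens y z :
  tau_tau (tens y z) = map_poly tensl (ytau y) * map_poly tensr (ytau z).
Proof. by rewrite /tau_tau tlift_tens. Qed.
Lemma tau_one_tens y z :
  tau_one (tens y z) = map_poly tensl (ytau y) * (tensr z)%:P.
Proof.
by rewrite /tau_one tlift_tens /tau_one_fun /tens_poly map_polyC.
Qed.

(* tau_s(y) (x) 1 + 1 (x) y *)
Definition primitive (y : Y) : laurent yangian2 :=
  lpoly (map_poly tensl (ytau y)) + lconst (tensr y).

(* The second terms for x^+ and x^- are the residue expansions at s = oo of
     \oint_C2 (u - v)^-1 xi(v - s) (x) x^+(v) dv  and
     \oint_C1 (u - v)^-1 x^-(v - s) (x) xi(v) dv,
   divided by hbar and read off at u^(-r-1).  In the first one, v stays near the
   poles of x^+(v) and only xi(v - s) is expanded in s^-1.  In the second one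
   v = w + s with w near the poles of x^-(w), so that u^(-r-1) comes with
   v^r xi(v) = (w + s)^r + hbar \sum_m xi_m (w + s)^r (w + s)^(-m-1), where
   (w + s)^r is a polynomial in s, which is the sum over k, and
   (w + s)^(-m-1) = \sum_n (-1)^n 'C(m + n, n) w^n s^(-m-n-1).
   Note that \sum_N (\sum_n (-1)^(n+1) 'C(N, n) x^-_(r+n) (x) xi_(N-n)) s^(-N-1)
   is not this residue: with it, even the images of x^+_(i,0) and x^-_(i,0) do
   not have the commutator xi_(i,0) (x) 1 + 1 (x) xi_(i,0). *)
Record deformed_drinfeld (D : Y -> laurent yangian2) : Prop := {
  ddrinfeld_t : forall i r, D (yt i r) = primitive (yt i r);
  ddrinfeld_xp : forall i r,
    D (yX hbar d a true i r) = primitive (yX hbar d a true i r) +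
      hbar *: lseries (-1) (fun N => \sum_(n < N.+1)
        ((-1) ^+ n.+1 * 'C(N, n)%:R) *:
          tens (yXi hbar d a i n) (yX hbar d a true i (r + N - n)%N));
  ddrinfeld_xm : forall i r,
    D (yX hbar d a false i r) = primitive (yX hbar d a false i r) +
      hbar *: \sum_(k < r.+1)
        lseries (r%:Z - k%:Z - 1) (fun N => \sum_(n < N.+1)
          ((-1) ^+ n * ('C(N, n) * 'C(r, k))%N%:R) *:
            tens (yX hbar d a false i (n + k)%N) (yXi hbar d a i (N - n)%N)) }.

End YangianMaps.

Section LieAlgebra.
Context (F : fieldType) (g : vectType F) (br : g -> g -> g).

Record lie_bracket : Prop := {
  lie_linearl : forall y, linear (br^~ y);
  lie_linearr : forall x, linear (br x);
  lie_alt : forall x, br x x = 0;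
  lie_jacobi : forall x y z,
    br x (br y z) + br y (br z x) + br z (br x y) = 0 }.

Definition lie_prod (U V : {vspace g}) : {vspace g} :=
  <<[seq br x y | x <- vbasis U, y <- vbasis V]>>%VS.

Definition lie_solvable (U : {vspace g}) : Prop :=
  exists n, iter n (fun W => lie_prod W W) U = 0%VS.
Definition lie_nilpotent (U : {vspace g}) : Prop :=
  exists n, iter n (lie_prod U) U = 0%VS.

Definition lie_semisimple : Prop :=
  forall U : {vspace g}, (lie_prod fullv U <= U)%VS -> lie_solvable U ->
  U = 0%VS.

Record invariant_form (form : g -> g -> F) : Prop := {
  form_linear : forall y, scalar (form^~ y);
  form_sym : forall x y, form x y = form y x;
  form_inv : forall x y z, form (br x y) z = form x (br y z);
  form_nondeg : forall x, (forall y, form x y = 0) -> x = 0 }.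

Record cartan_subalgebra (h : {vspace g}) : Prop := {
  cartan_closed : (lie_prod h h <= h)%VS;
  cartan_nilpotent : lie_nilpotent h;
  cartan_self_normalizing : forall x,
    (forall y, y \in h -> br x y \in h) -> x \in h }.

Variable h : {vspace g}.

Definition hdual : Type := 'Hom(subvs_of h, F^o).
HB.instance Definition _ := Vector.on hdual.

Definition lie_root (alpha : hdual) : Prop :=
  alpha != 0 /\ exists2 x, x != 0 &
    forall y : subvs_of h, br (vsval y) x = (alpha y : F) *: x.

Record simple_roots (I : finType) (alpha : I -> hdual) : Prop := {
  simple_root : forall i, lie_root (alpha i);
  simple_free : free [seq alpha i | i <- enum I];
  simple_span : forall beta, lie_root beta -> exists n : I -> nat,
    beta = \sum_i alpha i *+ n i \/ beta = - \sum_i alpha i *+ n i }.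

Variable form : g -> g -> F.

(* The isomorphism h -> h^* given by the form, and the form it induces on h^*;
   the inverse makes sense because the form is nondegenerate on h. *)
Definition form_iso : 'Hom(subvs_of h, hdual) :=
  linfun (fun x : subvs_of h =>
    linfun (fun y : subvs_of h => form (vsval x) (vsval y) : F^o) : hdual).
Definition dual_form (alpha beta : hdual) : F :=
  form (vsval ((form_iso^-1)%VF alpha)) (vsval ((form_iso^-1)%VF beta)).

(* Two roots in the same irreducible component of the root system. *)
Inductive root_linked : hdual -> hdual -> Prop :=
  | root_linked_refl alpha : lie_root alpha -> root_linked alpha alpha
  | root_linked_step alpha beta gamma : root_linked alpha beta ->
      lie_root gamma -> dual_form beta gamma != 0 -> root_linked alpha gamma.

Definition cartan_matrix (I : finType) (alpha : I -> hdual) (i j : I) : F :=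
  2%:R * dual_form (alpha i) (alpha j) / dual_form (alpha i) (alpha i).
Definition half_square (I : finType) (alpha : I -> hdual) (i : I) : F :=
  dual_form (alpha i) (alpha i) / 2%:R.

End LieAlgebra.

(* In each irreducible component the minimal square length of a root is 2. *)
Definition short_roots_normalized (F : numFieldType) (g : vectType F)
    (br : g -> g -> g) (h : {vspace g}) (form : g -> g -> F) : Prop :=
  forall alpha : hdual h, lie_root br alpha ->
    2%:R <= dual_form form alpha alpha /\
    exists2 beta, root_linked br form alpha beta & dual_form form beta beta = 2%:R.

(* Main.v *)
Require Import Defs.
From HB Require Import structures.
From mathcomp Require Import all_boot all_order all_algebra.
From mathcomp Require Import boolp reals perm complex zify ring.

(** The image of each generator is a residue of a product of two series, one
    from each tensor factor, against the kernel 1 / (w + s - v) expanded in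
    1 / s.  So the proof takes two commuting families (x1, xi1) and (x2, xi2) in
    an algebra A, each satisfying the Yangian relations, and shows that the
    combinations cox and coxi of them in A((s^-1)) satisfy these relations
    (cox_rel).  The two tensor factors of the Yangian are such families, and its
    presentation then gives the coproduct.

    The kernel K is only used through the identity
      s K(g) = K(v g) - K(w g) + g_00
    (lker_rec), which determines it: a family of series of uniformly bounded
    degree such that multiplication by s does not raise its degree bounds is
    zero (contraction).  Hence a relation holds for K applied to a family of
    elements as soon as it holds for the elements and the boundary terms cancel.

    For the quadratic relations, with a(u) and b(v) generating series, one
    writes (u - v - c) a b = (u - v + c) b a, a form stable under sums, under
    multipliers commuting with the other series, under translation and under K.
    The summands tau_s(x) (x) 1 and 1 (x) x do not satisfy these relations with
    one another, but the boundary term of K in the other summand compensates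
    exactly (exd_x2_coc, exd_x1_cob).  The image of xi(u) is the product
    xi(u - s) (x) xi(u), of whose factors one commutes with whatever sits in the
    other tensor factor (coxi_exd).

    In the commutator of x^+ and x^- the cross terms x1 with x1 xi2 and xi1 x2
    with x2 give the residues of xi(v - s) (x) xi(v) around the poles of either
    factor, which add up to a residue at infinity (trans_kxi).  The commutator
    of the two remaining integrals is annihilated by w + s - v + c and hence
    zero (cob_coc).

    For the Serre relations, the zero modes X^+_(i,0), X^-_(i,0), xi_(i,0) span
    an sl2 for which X_(j,t) is a lowest weight vector, of weight -k say, so
    that ad(X_(i,0))^(k+1) X_(j,t) is a lowest weight vector of positive weight.
    The leading coefficient in s of the latter is locally nilpotent for the
    zero mode of x1 + x2, because the Serre relations hold in both factors, and
    a locally nilpotent lowest weight vector of positive weight is zero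
    (laurent_lowest_weight_eq0).  The other Serre relations follow by commuting
    with Cartan elements (serre_reduction): the coefficients of the logarithmic
    derivative of xi(u) shift the modes of x by (X + c)^(n+1) - (X - c)^(n+1),
    X being the shift by one (slog_shift).

    As xi(u) goes to a product of two commuting series, its logarithm goes to
    their sum, which is the formula for t (ddelta_yt).

    The Yangian is generated by the x_(i,r) alone, since xi_(i,r) is a commutator
    of two of them.  So the formulae determine the coproduct, and each further
    property has only to be seen on the x_(i,r).  The counits kill one of the two
    families, hence all the terms with K.  Translating both tensor factors by a
    does not affect w + s - v, whereas translating the first one only replaces s
    by s + a in it (kshift_atrans2, kshift_atrans1); that s -> s + a is a ring
    morphism is the Vandermonde identity (binz_vandermonde).  Finally K lowers
    the degree, if s has degree 1, as 1 / (w + s - v) is homogeneous. *)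

Set Implicit Arguments.
Unset Strict Implicit.
Unset Printing Implicit Defensive.

Import Order.TTheory GRing.Theory Num.Theory.
Local Open Scope ring_scope.

(** * Deciding identities between noncommutative polynomials *)

(** NCen stands for a distinguished central element and NSc n for scaling by
    the n-th scalar atom. *)
Inductive ncexpr :=
  | NVar of nat | NCen | NSc of nat & ncexpr | NZero | NOne
  | NAdd of ncexpr & ncexpr | NOpp of ncexpr | NMul of ncexpr & ncexpr.

(** A monomial: its central atoms in increasing order, the distinguished
   central element being 0 and the n-th scalar n + 1, and its other atoms. *)
Definition ncmono : Type := (seq nat * seq nat)%type.

Fixpoint ncins (k : nat) (l : seq nat) : seq nat :=
  if l is j :: l' then if (k <= j)%N then k :: l else j :: ncins k l' else [:: k].

Definition ncmono_mul (m n : ncmono) : ncmono :=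
  (foldr ncins n.1 m.1, m.2 ++ n.2).

Fixpoint ncnorm (e : ncexpr) : seq (bool * ncmono) :=
  match e with
  | NVar n => [:: (true, ([::], [:: n]))]
  | NCen => [:: (true, ([:: 0%N], [::]))]
  | NSc n e => [seq (t.1, (ncins n.+1 t.2.1, t.2.2)) | t <- ncnorm e]
  | NZero => [::]
  | NOne => [:: (true, ([::], [::]))]
  | NAdd e f => ncnorm e ++ ncnorm f
  | NOpp e => [seq (~~ t.1, t.2) | t <- ncnorm e]
  | NMul e f => [seq (t.1 == u.1, ncmono_mul t.2 u.2) | t <- ncnorm e, u <- ncnorm f]
  end.

(* Monomials are never reordered beyond their central atoms, so that opposite
   terms can be found by a syntactic comparison. *)
Definition nccancel1 (t : bool * ncmono) (l : seq (bool * ncmono)) :=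
  if (~~ t.1, t.2) \in l then rem (~~ t.1, t.2) l else t :: l.
Definition nccancel (l : seq (bool * ncmono)) := foldr nccancel1 [::] l.

Section NcInterp.
Context (F : fieldType) (R : algType F) (u : R) (uC : forall x : R, GRing.comm u x).
Variables (cs : seq F) (vs : seq R).

Fixpoint nceval (e : ncexpr) : R :=
  match e with
  | NVar n => nth 0 vs n
  | NCen => u
  | NSc n e => nth 0 cs n *: nceval e
  | NZero => 0
  | NOne => 1
  | NAdd e f => nceval e + nceval f
  | NOpp e => - nceval e
  | NMul e f => nceval e * nceval f
  end.

Definition nccen (k : nat) : R := if k is n.+1 then (nth 0 cs n)%:A else u.

Lemma nccenC k x : GRing.comm (nccen k) x.
Proof. by case: k => [|n] //=; rewrite /GRing.comm mulr_algl mulr_algr. Qed.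

Definition ncmon (m : ncmono) : R :=
  \prod_(k <- m.1) nccen k * \prod_(n <- m.2) nth 0 vs n.
Definition ncterm (t : bool * ncmono) : R :=
  if t.1 then ncmon t.2 else - ncmon t.2.
Definition ncsum (l : seq (bool * ncmono)) : R := \sum_(t <- l) ncterm t.

Lemma prod_ncins k l : \prod_(j <- ncins k l) nccen j = nccen k * \prod_(j <- l) nccen j.
Proof.
elim: l => [|j l IH] /=; first by rewrite big_seq1 big_nil mulr1.
case: ifP => _; first by rewrite big_cons.
by rewrite !big_cons IH !mulrA (nccenC j).
Qed.

Lemma prod_ncenC l x : GRing.comm (\prod_(j <- l) nccen j) x.
Proof.
elim: l => [|j l IH]; first by rewrite big_nil; apply/commr_sym/commr1.
by rewrite big_cons; apply/commr_sym/commrM/commr_sym/IH/commr_sym/nccenC.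
Qed.

Lemma ncmonM m n : ncmon (ncmono_mul m n) = ncmon m * ncmon n.
Proof.
case: m n => [c v] [c' v']; rewrite /ncmon /ncmono_mul /=.
have -> : \prod_(k <- foldr ncins c' c) nccen k =
    \prod_(k <- c) nccen k * \prod_(k <- c') nccen k.
  elim: c => [|k c IH] /=; first by rewrite big_nil mul1r.
  by rewrite prod_ncins IH big_cons mulrA.
by rewrite big_cat /= !mulrA -!(mulrA (\prod_(k <- c) _)) (prod_ncenC c').
Qed.

Lemma ncnormP e : ncsum (ncnorm e) = nceval e.
Proof.
rewrite /ncsum; elim: e => [n||n e IH|||e IHe f IHf|e IH|e IHe f IHf] /=.
- by rewrite big_seq1 /ncterm /ncmon /= big_nil big_seq1 mul1r.
- by rewrite big_seq1 /ncterm /ncmon /= big_nil big_seq1 mulr1.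
- rewrite -IH big_map scaler_sumr; apply: eq_bigr => -[b [c m]] _.
  have E : ncmon (ncins n.+1 c, m) = nth 0 cs n *: ncmon (c, m).
    by rewrite /ncmon prod_ncins /= -mulrA mulr_algl.
  by case: b; rewrite /ncterm /= E ?scalerN.
- by rewrite big_nil.
- by rewrite big_seq1 /ncterm /ncmon /= !big_nil mul1r.
- by rewrite big_cat /= IHe IHf.
- rewrite -IH big_map -sumrN; apply: eq_bigr => -[[] t] _;
  by rewrite /ncterm /= ?opprK.
rewrite -IHe -IHf big_allpairs_dep mulr_suml; apply: eq_bigr => -[b m] _.
rewrite mulr_sumr; apply: eq_bigr => -[b' m'] _.
by case: b b' => [] []; rewrite /ncterm /= ncmonM ?mulrNN ?mulrN ?mulNr.
Qed.

Lemma nccancelP l : ncsum (nccancel l) = ncsum l.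
Proof.
elim: l => //= t l IH; rewrite [RHS]/ncsum big_cons -/(ncsum l) -IH /nccancel1.
case: ifP => [tl|_]; last by rewrite /ncsum big_cons.
rewrite [in RHS]/ncsum (perm_big _ (perm_to_rem tl)) /= big_cons addrA.
rewrite [X in X + _](_ : _ = 0) ?add0r //.
by case: t {tl IH} => [[] m]; rewrite /ncterm /= (addNr, subrr).
Qed.

Lemma ncringP e f : nilp (nccancel (ncnorm (NAdd e (NOpp f)))) ->
  nceval e = nceval f.
Proof.
move=> /nilP ef; apply/subr0_eq; rewrite -[LHS]/(nceval (NAdd e (NOpp f))).
by rewrite -ncnormP -nccancelP ef /ncsum big_nil.
Qed.

End NcInterp.

Ltac nc_index x l :=
  match l with
  | x :: _ => constr:(0%N)
  | _ :: ?l' => let n := nc_index x l' in constr:(S n)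
  end.
Ltac nc_add x l :=
  match l with
  | context [x :: _] => l
  | _ => constr:(x :: l)
  end.

Ltac nc_scalars t l :=
  match t with
  | (?a + ?b)%R => let l' := nc_scalars a l in nc_scalars b l'
  | (?a * ?b)%R => let l' := nc_scalars a l in nc_scalars b l'
  | (- ?a)%R => nc_scalars a l
  | (?c *: ?a)%R => let l' := nc_add c l in nc_scalars a l'
  | _ => l
  end.
Ltac nc_vars u t l :=
  match t with
  | 0%R => l
  | 1%R => l
  | u => l
  | (?a + ?b)%R => let l' := nc_vars u a l in nc_vars u b l'
  | (?a * ?b)%R => let l' := nc_vars u a l in nc_vars u b l'
  | (- ?a)%R => nc_vars u a l
  | (?c *: ?a)%R => nc_vars u a l
  | _ => nc_add t l
  end.
Ltac nc_reify u cs vs t :=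
  match t with
  | 0%R => constr:(NZero)
  | 1%R => constr:(NOne)
  | u => constr:(NCen)
  | (?a + ?b)%R =>
    let a' := nc_reify u cs vs a in let b' := nc_reify u cs vs b in
    constr:(NAdd a' b')
  | (?a * ?b)%R =>
    let a' := nc_reify u cs vs a in let b' := nc_reify u cs vs b in
    constr:(NMul a' b')
  | (- ?a)%R => let a' := nc_reify u cs vs a in constr:(NOpp a')
  | (?c *: ?a)%R =>
    let n := nc_index c cs in let a' := nc_reify u cs vs a in
    constr:(NSc n a')
  | _ => let n := nc_index t vs in constr:(NVar n)
  end.

(* Proves the identities in the F-algebra R that follow from its axioms and the
   centrality uC of u. *)
Ltac ncring_with R u uC :=
  lazymatch type of R with
  | GRing.Algebra.type ?F =>
    lazymatch goal with
    | |- ?l = ?r =>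
      let cs := nc_scalars l (@nil (GRing.Field.sort F)) in
      let cs := nc_scalars r cs in
      let vs := nc_vars u l (@nil (GRing.Algebra.sort R)) in
      let vs := nc_vars u r vs in
      let l' := nc_reify u cs vs l in
      let r' := nc_reify u cs vs r in
      refine (@ncringP F R u uC cs vs l' r' _); vm_compute; reflexivity
    end
  end.
Ltac ncring R := ncring_with R (1 : R) (fun x : R => commr_sym (commr1 x)).

(** * Laurent series in the inverse of s *)

Section LaurentVariable.
Context (A : nzRingType).
Implicit Types (f g : laurent A) (x : A).

Lemma lvar_bounded : lbounded (fun k : int => if k == 1 then 1 else 0 : A) 1.
Proof. by move=> k k1; rewrite ifN //; apply/eqP; lia. Qed.
Definition lvar : laurent A := mkLaurent lvar_bounded.

Lemma lbounded_const x : lbounded (lconst x) 0.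
Proof. exact: lconst_bounded. Qed.
Lemma lbounded_var : lbounded lvar 1.
Proof. exact: lvar_bounded. Qed.

Lemma lcoef_constl x f k : (lconst x * f) k = x * f k.
Proof.
have [M fM] := lbound_ex f; case: (ltP M k) => kM.
  by rewrite fM // mulr0 /= (lmul_coef0 (lbounded_const x) fM) ?add0r.
rewrite /= (lmul_coefE (lbounded_const x) fM (_ : k = 0 + M - `|M - k|%N%:Z));
  last by lia.
rewrite big_ord_recl big1 => [|j _]; last by rewrite /= mul0r.
by rewrite /= addr0; congr (_ * f _); lia.
Qed.

Lemma lcoef_constr x f k : (f * lconst x) k = f k * x.
Proof.
have [M fM] := lbound_ex f; case: (ltP M k) => kM.
  by rewrite fM // mul0r /= (lmul_coef0 fM (lbounded_const x)) ?addr0.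
rewrite /= (lmul_coefE fM (lbounded_const x) (_ : k = M + 0 - `|M - k|%N%:Z));
  last by lia.
rewrite big_ord_recr big1 => [|j _] /=; last first.
  by rewrite ifF ?mulr0 //; apply/eqP; have := ltn_ord j; lia.
by rewrite subnn /= add0r; congr (f _ * _); lia.
Qed.

Lemma lcoef_varl f k : (lvar * f) k = f (k - 1).
Proof.
have [M fM] := lbound_ex f; case: (ltP (1 + M) k) => kM.
  by rewrite fM ?(lmul_bounded lbounded_var fM) //; lia.
rewrite /= (lmul_coefE lbounded_var fM (_ : k = 1 + M - `|(1 + M - k)%R|%N%:Z));
  last by lia.
rewrite big_ord_recl big1 => [|j _]; last first.
  by rewrite /= /bump ifF ?mul0r //; apply/eqP; lia.
by rewrite addr0 /= mul1r; congr (f _); lia.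
Qed.

Lemma lcoef_varr f k : (f * lvar) k = f (k - 1).
Proof.
have [M fM] := lbound_ex f; case: (ltP (M + 1) k) => kM.
  by rewrite fM ?(lmul_bounded fM lbounded_var) //; lia.
rewrite /= (lmul_coefE fM lbounded_var (_ : k = M + 1 - `|(M + 1 - k)%R|%N%:Z));
  last by lia.
rewrite big_ord_recr big1 => [|j _] /=; last first.
  by rewrite ifF ?mulr0 //; apply/eqP; have := ltn_ord j; lia.
by rewrite subnn subr0 eqxx mulr1 add0r; congr (f _); lia.
Qed.

Lemma lvarC f : GRing.comm lvar f.
Proof. by apply: laurentP => k; rewrite lcoef_varl lcoef_varr. Qed.

Lemma lconst_is_zmod_morphism : zmod_morphism (@lconst A).
Proof. by move=> x y; apply: laurentP => k; rewrite lcoefB /=; case: ifP; rewrite ?subr0. Qed.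
HB.instance Definition _ :=
  GRing.isZmodMorphism.Build A (laurent A) (@lconst A) lconst_is_zmod_morphism.

Lemma lconst_is_monoid_morphism : monoid_morphism (@lconst A).
Proof.
split=> // x y; apply: laurentP => k; rewrite lcoef_constl /=.
by case: ifP; rewrite ?mulr0.
Qed.
HB.instance Definition _ :=
  GRing.isMonoidMorphism.Build A (laurent A) (@lconst A) lconst_is_monoid_morphism.

Lemma lboundedD f g M : lbounded f M -> lbounded g M -> lbounded (f + g) M.
Proof. by move=> fM gM k kM; rewrite lcoefD fM ?gM ?addr0. Qed.
Lemma lboundedN f M : lbounded f M -> lbounded (- f) M.
Proof. by move=> fM k kM; rewrite lcoefN fM ?oppr0. Qed.
Lemma lboundedB f g M : lbounded f M -> lbounded g M -> lbounded (f - g) M.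
Proof. by move=> fM gM; apply/lboundedD/lboundedN. Qed.
Lemma lboundedM f g M N : lbounded f M -> lbounded g N -> lbounded (f * g) (M + N).
Proof. exact: lmul_bounded. Qed.
Lemma lbounded_le f M N : M <= N -> lbounded f M -> lbounded f N.
Proof. by move=> MN fM k /(le_lt_trans MN)/fM. Qed.

Lemma lcoef_series (M : int) (c : nat -> A) (n : nat) :
  lseries M c (M - n%:Z) = c n.
Proof.
have E : M - (M - n%:Z) = n by lia.
by rewrite /lseries [LHS]/= E.
Qed.

(** If multiplication by s does not raise the degree of a family, then the
    degrees of its members are bounded by every integer: each member is obtained
    from s times itself by dividing by s.  All identities between infinite sums
    below are instances of this uniqueness principle. *)
Lemma contraction (J : Type) (z : J -> laurent A) (M : int) :
    (forall j, lbounded (z j) M) ->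
    (forall N, (forall j, lbounded (z j) N) -> forall j, lbounded (lvar * z j) N) ->
  forall j, z j = 0.
Proof.
move=> zM zs.
have zn n : forall j, lbounded (z j) (M - n%:Z).
  elim: n => [|n IH] j; first by rewrite subr0.
  move=> k kM; have := zs _ IH j (k + 1); rewrite lcoef_varl addrK; apply.
  by lia.
move=> j; apply: laurentP => k; rewrite lcoef0.
by apply: (zn `|M - k|.+1%N); lia.
Qed.

Lemma contraction2 (z : nat -> nat -> laurent A) (M : int) :
    (forall q p, lbounded (z q p) M) ->
    (forall q p, lvar * z q p = z q p.+1 - z q.+1 p) ->
  forall q p, z q p = 0.
Proof.
move=> zM zs q p.
apply: (contraction (z := fun w : nat * nat => z w.1 w.2) (M := M) _ _ (q, p)).
  by move=> [? ?]; apply: zM.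
by move=> N zN [i j]; rewrite zs; apply: lboundedB; [apply: (zN (i, j.+1)) | apply: (zN (i.+1, j))].
Qed.

End LaurentVariable.
Arguments lvar {A}.

Section LaurentConstLinear.
Context (F : fieldType) (A : algType F).

Lemma lconstZ (c : F) (x : A) : lconst (c *: x) = c *: lconst x.
Proof. by apply: laurentP => k; rewrite lcoefZ /=; case: ifP; rewrite ?scaler0. Qed.
HB.instance Definition _ :=
  GRing.isScalable.Build F A (laurent A) *:%R (@lconst A) lconstZ.

Lemma lconstM (x y : A) : lconst (x * y) = lconst x * lconst y.
Proof. exact: (rmorphM (@lconst A)). Qed.
Lemma lconst0 : lconst (0 : A) = 0.
Proof. by []. Qed.
Lemma lconst_rcomm (x y : A) : rcomm (lconst x) (lconst y) = lconst (rcomm x y).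
Proof. by rewrite (rmorph_rcomm (@lconst A)). Qed.

Lemma lboundedR (f g : laurent A) M N :
  lbounded f M -> lbounded g N -> lbounded (rcomm f g) (M + N).
Proof.
move=> fM gN; apply: lboundedB; first exact: lboundedM.
by rewrite addrC; apply: lboundedM.
Qed.

Lemma lboundedZ (c : F) (f : laurent A) M : lbounded f M -> lbounded (c *: f) M.
Proof. by move=> fM k kM; rewrite lcoefZ fM ?scaler0. Qed.

End LaurentConstLinear.

Section LaurentMorphisms.
Context (A B : nzRingType) (h : {rmorphism A -> B}).

Lemma lmap_bounded (f : laurent A) M : lbounded f M -> lbounded (lmap h f) M.
Proof. by move=> fM k kM; rewrite /= fM ?rmorph0. Qed.

Lemma lmap_is_zmod_morphism : zmod_morphism (lmap h).
Proof. by move=> f g; apply: laurentP => k; rewrite /= rmorphB. Qed.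
HB.instance Definition _ := GRing.isZmodMorphism.Build (laurent A) (laurent B)
  (lmap h) lmap_is_zmod_morphism.

Lemma lmap_const x : lmap h (lconst x) = lconst (h x).
Proof. by apply: laurentP => k /=; case: ifP; rewrite ?rmorph0. Qed.

Lemma lmap_is_monoid_morphism : monoid_morphism (lmap h).
Proof.
split=> [|f g]; first by rewrite lmap_const rmorph1.
have [M fM] := lbound_ex f; have [N gN] := lbound_ex g.
have hfM := lmap_bounded fM; have hgN := lmap_bounded gN.
apply: laurentP => k; case: (ltP (M + N) k) => kB.
  by rewrite (lboundedM hfM hgN) // (lmap_bounded (lboundedM fM gN)).
have kE : k = M + N - `|(M + N - k)%R|%N%:Z by lia.
rewrite /= (lmul_coefE fM gN kE) (lmul_coefE hfM hgN kE) rmorph_sum.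
by apply: eq_bigr => j _; rewrite rmorphM.
Qed.
HB.instance Definition _ := GRing.isMonoidMorphism.Build (laurent A) (laurent B)
  (lmap h) lmap_is_monoid_morphism.

Lemma lmap_var : lmap h lvar = lvar.
Proof. by apply: laurentP => k /=; case: ifP; rewrite ?rmorph0 ?rmorph1. Qed.

End LaurentMorphisms.

Section LaurentPolynomials.
Context (A : nzRingType).

Lemma lvarC_rmorph : commr_rmorph (@lconst A) (@lvar A).
Proof. by move=> x; apply: lvarC. Qed.

Lemma lpolyE (p : {poly A}) : lpoly p = horner_morph lvarC_rmorph p.
Proof.
elim/poly_ind: p => [|p c IH].
  by rewrite rmorph0; apply: laurentP => -[n|n] /=; rewrite ?coef0 ?if_same.
rewrite rmorphD rmorphM /= horner_morphX horner_morphC -IH.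
apply: laurentP => k; rewrite lcoefD lcoef_varr.
case: k => [[|n]|n]; last by rewrite /= addr0.
  by rewrite /= coefD coefMX coefC.
rewrite (_ : n.+1%:Z - 1 = n%:Z); last by lia.
by rewrite /= coefD coefMX coefC.
Qed.

Lemma lpoly_is_zmod_morphism : zmod_morphism (@lpoly A).
Proof. by move=> p q; rewrite !lpolyE rmorphB. Qed.
HB.instance Definition _ := GRing.isZmodMorphism.Build {poly A} (laurent A)
  (@lpoly A) lpoly_is_zmod_morphism.
Lemma lpoly_is_monoid_morphism : monoid_morphism (@lpoly A).
Proof. by split=> [|p q]; rewrite !lpolyE ?rmorph1 ?rmorphM. Qed.
HB.instance Definition _ := GRing.isMonoidMorphism.Build {poly A} (laurent A)
  (@lpoly A) lpoly_is_monoid_morphism.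
Lemma lpolyX : lpoly 'X = @lvar A.
Proof. by rewrite lpolyE horner_morphX. Qed.
Lemma lpolyC x : lpoly x%:P = lconst x :> laurent A.
Proof. by rewrite lpolyE horner_morphC. Qed.

End LaurentPolynomials.

(** * The kernel 1 / (w + s - v) *)

Section Kernel.
Context (F : fieldType) (A : algType F).
Implicit Types (g : nat -> nat -> A).

(** With g q p standing for w^q v^p this is the expansion of 1 / (w + s - v)
    at s = oo, hence the double residue of the product of this kernel with two
    series in w and v. *)
Definition lker g : laurent A := lseries (-1) (fun N =>
  \sum_(n < N.+1) ((-1) ^+ n * 'C(N, n)%:R) *: g n (N - n)%N).

Lemma lker_bounded g : lbounded (lker g) (-1).
Proof. exact: lseries_bounded. Qed.

Lemma lcoef_ker g N : lker g (Negz N) =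
  \sum_(n < N.+1) ((-1) ^+ n * 'C(N, n)%:R) *: g n (N - n)%N.
Proof. by rewrite (_ : Negz N = -1 - N%:Z) ?lcoef_series //; lia. Qed.

Lemma eq_lker g g' : (forall q p, g q p = g' q p) -> lker g = lker g'.
Proof.
by move=> gg; congr lseries; apply/funext => N; apply: eq_bigr => n _; rewrite gg.
Qed.

Lemma lkerB g g' : lker (fun q p => g q p - g' q p) = lker g - lker g'.
Proof.
apply: laurentP => k /=; case: (-1 - k) => [N|N]; last by rewrite subr0.
by rewrite -sumrB; apply: eq_bigr => n _; rewrite scalerBr.
Qed.

Lemma lkerMl x g : lker (fun q p => x * g q p) = lconst x * lker g.
Proof.
apply: laurentP => k; rewrite lcoef_constl /=; case: (-1 - k) => [N|N].
  by rewrite mulr_sumr; apply: eq_bigr => n _; rewrite scalerAr.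
by rewrite mulr0.
Qed.

Lemma lkerMr x g : lker (fun q p => g q p * x) = lker g * lconst x.
Proof.
apply: laurentP => k; rewrite lcoef_constr /=; case: (-1 - k) => [N|N].
  by rewrite mulr_suml; apply: eq_bigr => n _; rewrite scalerAl.
by rewrite mul0r.
Qed.

(** The identity (w + s - v) / (w + s - v) = 1, that is Pascal's rule. *)
Lemma lker_rec g : lvar * lker g =
  lker (fun q p => g q p.+1) - lker (fun q p => g q.+1 p) + lconst (g 0%N 0%N).
Proof.
rewrite -lkerB; apply: laurentP => k; rewrite lcoef_varl lcoefD.
case: k => [[|n]|N].
- by rewrite (lcoef_ker g 0) big_ord1 expr0 bin0 mul1r scale1r /= add0r.
- by rewrite !lker_bounded ?addr0 //; lia.
rewrite (_ : Negz N - 1 = Negz N.+1); last by lia.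
rewrite !lcoef_ker /= addr0 big_ord_recl /= /bump /=.
rewrite (eq_bigr (fun n : 'I_N.+1 => ((-1) ^+ n.+1 * 'C(N, n.+1)%:R) *:
  g n.+1 (N.+1 - n.+1)%N + ((-1) ^+ n.+1 * 'C(N, n)%:R) *:
  g n.+1 (N.+1 - n.+1)%N)); last first.
  by move=> n _; rewrite add1n binS natrD mulrDr scalerDl.
rewrite big_split /= addrA big_ord_recr /= (@bin_small N N.+1) // mulr0 scale0r addr0.
have -> : \sum_(n < N.+1) ((-1) ^+ n.+1 * 'C(N, n)%:R) *: g n.+1 (N.+1 - n.+1)%N =
    - \sum_(n < N.+1) ((-1) ^+ n * 'C(N, n)%:R) *: g n.+1 (N - n)%N.
  rewrite -sumrN; apply: eq_bigr => n _.
  by rewrite exprS mulN1r mulNr scaleNr subSS.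
rewrite [in RHS](eq_bigr (fun n : 'I_N.+1 =>
  ((-1) ^+ n * 'C(N, n)%:R) *: g n (N.+1 - n)%N -
  ((-1) ^+ n * 'C(N, n)%:R) *: g n.+1 (N - n)%N)); last first.
  by move=> n _; rewrite scalerBr subSn // -ltnS.
rewrite sumrB; congr (_ - _); rewrite [RHS]big_ord_recl /= !bin0.
congr (_ + _); apply: eq_bigr => n _; rewrite /bump add1n.
Qed.

(** The kernel applied to w^q v^p g. *)
Definition kshift g (q p : nat) : laurent A :=
  lker (fun i j => g (i + q)%N (j + p)%N).

Lemma kshift_bounded g q p : lbounded (kshift g q p) (-1).
Proof. exact: lker_bounded. Qed.

Lemma kshift_rec g q p : lvar * kshift g q p =
  kshift g q p.+1 - kshift g q.+1 p + lconst (g q p).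
Proof.
rewrite lker_rec; congr (_ - _ + _); apply: eq_lker => i j.
  by rewrite addnS.
by rewrite addnS.
Qed.

Lemma eq_kshift g g' q p : (forall i j, g i j = g' i j) ->
  kshift g q p = kshift g' q p.
Proof. by move=> gg; apply: eq_lker. Qed.

End Kernel.

Lemma lker_morph (F : fieldType) (A B : algType F) (h : {additive A -> B})
    (g : nat -> nat -> A) (g' : nat -> nat -> B) :
    (forall c q p, h (c *: g q p) = c *: g' q p) -> lmap h (lker g) = lker g'.
Proof.
move=> hg; apply: laurentP => k /=; case: (-1 - k) => [N|N]; last exact: raddf0.
by rewrite raddf_sum; apply: eq_bigr => n _; rewrite hg.
Qed.

Ltac lring A := ncring_with (laurent A : algType _) (@lvar A) (@lvarC A).

Section KernelUnique.
Context (F : fieldType) (A : algType F).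

(** The difference of two solutions of the recursion satisfies the homogeneous
    one, to which the contraction principle applies. *)
Lemma kshift_unique (g : nat -> nat -> A) (z : nat -> nat -> laurent A) M :
    (forall q p, lbounded (z q p) M) ->
    (forall q p, lvar * z q p = z q p.+1 - z q.+1 p + lconst (g q p)) ->
  forall q p, z q p = kshift g q p.
Proof.
move=> zM zs q p; apply/subr0_eq.
apply: (contraction2 (z := fun q p => z q p - kshift g q p) (M := Num.max M (-1))).
  move=> i j; apply: lboundedB.
    by apply: lbounded_le (zM i j); rewrite le_max lexx.
  by apply: lbounded_le (@kshift_bounded _ _ g i j); rewrite le_max lexx orbT.
by move=> i j; rewrite mulrBr zs kshift_rec; lring A.
Qed.

End KernelUnique.

(** * Translation of sequences *)

Section Translation.
Context (R : nzRingType) (u : R) (uC : forall x, GRing.comm u x).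
Implicit Types (y z : nat -> R) (r : nat).

(** The value at 0 of (sigma + u)^r y, where sigma shifts the sequence y: for
    y_k = w^k this is (w + u)^r. *)
Fixpoint trans (y : nat -> R) (r : nat) : R :=
  if r is r'.+1 then trans (fun k => y k.+1) r' + u * trans y r' else y 0%N.

Lemma transS y r : trans y r.+1 = trans (fun k => y k.+1) r + u * trans y r.
Proof. by []. Qed.

Lemma eq_trans y z r : y =1 z -> trans y r = trans z r.
Proof.
elim: r y z => [|r IH] y z yz /=; first exact: yz.
by congr (_ + _ * _); apply: IH => // k; apply: yz.
Qed.
Lemma transD y z r : trans (fun k => y k + z k) r = trans y r + trans z r.
Proof. by elim: r y z => [|r IH] y z //=; rewrite !IH mulrDr addrACA. Qed.
Lemma transN y r : trans (fun k => - y k) r = - trans y r.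
Proof. by elim: r y => [|r IH] y //=; rewrite !IH mulrN opprD. Qed.
Lemma transB y z r : trans (fun k => y k - z k) r = trans y r - trans z r.
Proof. by rewrite transD transN. Qed.
Lemma trans0 r : trans (fun=> 0) r = 0.
Proof. by elim: r => //= r ->; rewrite mulr0 addr0. Qed.
Lemma transMl x y r : trans (fun k => x * y k) r = x * trans y r.
Proof. by elim: r y => [|r IH] y //=; rewrite !IH mulrDr !mulrA uC. Qed.
Lemma transMr x y r : trans (fun k => y k * x) r = trans y r * x.
Proof. by elim: r y => [|r IH] y //=; rewrite !IH mulrDl mulrA. Qed.

Lemma transSr y r : trans y r.+1 = trans (fun k => y k.+1 + u * y k) r.
Proof. by rewrite transD transMl transS. Qed.

Lemma trans_comm y x r : (forall k, GRing.comm (y k) x) -> GRing.comm (trans y r) x.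
Proof.
elim: r y => [|r IH] y yx /=; first exact: yx.
apply/commr_sym/commrD; apply/commr_sym; first exact: IH.
by apply/commr_sym/commrM/commr_sym; [apply/commr_sym/uC | apply: IH].
Qed.

Lemma rcomm_centl (x z : R) : rcomm (u * x) z = u * rcomm x z.
Proof. by rewrite /rcomm mulrBr !mulrA -(uC z). Qed.
Lemma rcomm_centr (x z : R) : rcomm x (u * z) = u * rcomm x z.
Proof. by rewrite /rcomm mulrBr !mulrA -(uC x). Qed.

Lemma rcomm_trans y z G r t :
  (forall k l, rcomm (y k) (z l) = G (k + l)%N) ->
  rcomm (trans y r) (trans z t) = trans G (r + t).
Proof.
elim: r y G => [|r IH] y G yG.
  elim: t z G yG => [|t IHt] z G yG; first exact: yG.
  rewrite !transS rcommDr rcomm_centr (IHt z G) //.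
  rewrite (IHt (fun k => z k.+1) (fun k => G k.+1)) // => k l.
  by rewrite yG addnS.
rewrite addSn !transS rcommDl rcomm_centl (IH y G) //.
by rewrite (IH (fun k => y k.+1) (fun k => G k.+1)) // => k l; rewrite yG.
Qed.

(** The binomial expansion of (w + u)^r. *)
Lemma transE y r :
  trans y r = \sum_(k < r.+1) u ^+ (r - k) * y k *+ 'C(r, k).
Proof.
elim: r y => [|r IH] y /=; first by rewrite big_ord1 mul1r.
rewrite !IH [RHS]big_ord_recl /= subn0 bin0 mulr1n.
rewrite [in RHS](eq_bigr (fun k : 'I_r.+1 => u ^+ (r - k) * y k.+1 *+ 'C(r, k.+1) +
   u ^+ (r - k) * y k.+1 *+ 'C(r, k))); last first.
  by move=> k _; rewrite /= /bump /= add1n subSS binS mulrnDr.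
rewrite big_split /= addrA addrC; congr (_ + _).
rewrite [in RHS]big_ord_recr /= (@bin_small r r.+1) // mulr0n addr0.
rewrite mulr_sumr big_ord_recl /= subn0 bin0 mulr1n mulrA -exprS.
congr (_ + _); apply: eq_bigr => k _; rewrite -mulrnAr mulrA -exprS mulrnAr.
by congr (_ ^+ _ * _ *+ _); rewrite /bump /=; have := ltn_ord k; lia.
Qed.

Lemma trans_shiftp (S : nzRingType) (f : {rmorphism {poly S} -> R}) (y : nat -> S) r :
  f 'X = u -> f (shiftp y r) = trans (fun k => f (y k)%:P) r.
Proof.
move=> fX; elim: r y => [|r IH] y; first by rewrite shiftp_0.
by rewrite shiftpS rmorphD rmorphM /= !IH fX -uC.
Qed.

End Translation.

Lemma rmorph_trans (R S : nzRingType) (h : {rmorphism R -> S}) u y r :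
  h (trans u y r) = trans (h u) (fun k => h (y k)) r.
Proof. by elim: r y => [|r IH] y //=; rewrite rmorphD rmorphM /= !IH. Qed.

(** (w + u + v)^r is ((w + v) + u)^r. *)
Lemma trans_trans (R : nzRingType) (u v : R) (y : nat -> R) r :
    (forall x, GRing.comm u x) -> (forall x, GRing.comm v x) ->
  trans u (trans v y) r = trans (u + v) y r.
Proof.
move=> uC vC; have uvC x : GRing.comm (u + v) x.
  by apply/commr_sym/commrD; apply/commr_sym.
elim: r y => [|r IH] y //; rewrite transSr // [RHS]transSr // -IH.
apply: eq_trans => k /=; rewrite transD transMl //.
by rewrite mulrDl addrA [RHS]addrAC.
Qed.

Lemma transZ (F : fieldType) (R : algType F) (u : R) (c : F) y r :
  trans u (fun k => c *: y k) r = c *: trans u y r.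
Proof. by elim: r y => [|r IH] y //=; rewrite !IH scalerDr scalerAr. Qed.

(** * Exchange relations *)

(** If a and b are coefficients of series in u and in v, and a' and b' are those
    obtained by multiplying these series by u and by v, the vanishing of this
    element says that (u - v - c) a b = (u - v + c) b a.  The relations between
    two x of the same sign and between xi and x have this form, in which they are
    stable under the operations of this section. *)
Definition exd (F : fieldType) (R : algType F) (c : F) (a a' b b' : R) : R :=
  rcomm a' b - rcomm a b' - c *: (a * b + b * a).

Section Exchange.
Context (F : fieldType) (R : algType F).
Implicit Types (c : F) (a b u x z : R).

Lemma exd_sym c a a' b b' : exd c a a' b b' = exd c b b' a a'.
Proof. by rewrite /exd /rcomm; ncring R. Qed.

Lemma exdDl c a1 a1' a2 a2' b b' :
  exd c (a1 + a2) (a1' + a2') b b' = exd c a1 a1' b b' + exd c a2 a2' b b'.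
Proof. by rewrite /exd /rcomm; ncring R. Qed.
Lemma exdBl c a1 a1' a2 a2' b b' :
  exd c (a1 - a2) (a1' - a2') b b' = exd c a1 a1' b b' - exd c a2 a2' b b'.
Proof. by rewrite /exd /rcomm; ncring R. Qed.
Lemma exdDr c a a' b1 b1' b2 b2' :
  exd c a a' (b1 + b2) (b1' + b2') = exd c a a' b1 b1' + exd c a a' b2 b2'.
Proof. by rewrite /exd /rcomm; ncring R. Qed.
Lemma exdDD c a1 a1' a2 a2' b1 b1' b2 b2' :
    exd c a1 a1' b1 b1' = 0 -> exd c a1 a1' b2 b2' = 0 ->
    exd c a2 a2' b1 b1' = 0 -> exd c a2 a2' b2 b2' = 0 ->
  exd c (a1 + a2) (a1' + a2') (b1 + b2) (b1' + b2') = 0.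
Proof. by move=> e1 e2 e3 e4; rewrite exdDl !exdDr e1 e2 e3 e4 !addr0. Qed.
Lemma exd0l c z b b' : exd c 0 z b b' = rcomm z b.
Proof. by rewrite /exd /rcomm; ncring R. Qed.
Lemma exd00 c b b' : exd c 0 0 b b' = 0.
Proof. by rewrite exd0l rcomm0l. Qed.
Lemma exd_suml c n (f f' : 'I_n -> R) b b' :
    (forall k, exd c (f k) (f' k) b b' = 0) ->
  exd c (\sum_k f k) (\sum_k f' k) b b' = 0.
Proof.
move=> fb; elim: n f f' fb => [|n IH] f f' fb; first by rewrite !big_ord0 exd00.
by rewrite !big_ord_recl exdDl fb IH ?addr0.
Qed.
Lemma exdZl c e a a' b b' : exd c (e *: a) (e *: a') b b' = e *: exd c a a' b b'.
Proof. by rewrite /exd /rcomm; ncring R. Qed.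

Lemma exdMl c z a a' b b' : GRing.comm z b -> GRing.comm z b' ->
  exd c (z * a) (z * a') b b' = z * exd c a a' b b'.
Proof.
move=> zb zb'; rewrite /exd /rcomm.
transitivity (z * a' * b - (b * z) * a' - (z * a * b' - (b' * z) * a) -
    c *: (z * a * b + (b * z) * a)); first by ncring R.
by rewrite -zb -zb'; ncring R.
Qed.
Lemma exdMr c z a a' b b' : GRing.comm z b -> GRing.comm z b' ->
  exd c (a * z) (a' * z) b b' = exd c a a' b b' * z.
Proof.
move=> zb zb'; rewrite /exd /rcomm.
transitivity (a' * (z * b) - b * a' * z - (a * (z * b') - b' * a * z) -
    c *: (a * (z * b) + b * a * z)); first by ncring R.
by rewrite zb zb'; ncring R.
Qed.

Lemma exd_shift c u a a' b b' : (forall x, GRing.comm u x) ->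
  exd c a (a' + u * a) b (b' + u * b) = exd c a a' b b'.
Proof. by move=> uC; rewrite /exd /rcomm; ncring_with R u uC. Qed.

Lemma exd_trans c u (y : nat -> R) r b b' : (forall x, GRing.comm u x) ->
    (forall k, exd c (y k) (y k.+1 + u * y k) b b' = 0) ->
  exd c (trans u y r) (trans u y r.+1) b b' = 0.
Proof.
move=> uC; elim: r y => [|r IH] y yb; first exact: yb.
rewrite (transS u y r.+1) {1}transS exdDl IH // exdMl; try exact: uC.
by rewrite IH // mulr0 addr0.
Qed.

Lemma exd_trans2 c u (y z : nat -> R) r t : (forall x, GRing.comm u x) ->
    (forall k l, exd c (y k) (y k.+1) (z l) (z l.+1) = 0) ->
  exd c (trans u y r) (trans u y r.+1) (trans u z t) (trans u z t.+1) = 0.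
Proof.
move=> uC yz; apply: exd_trans => // k; rewrite exd_sym; apply: exd_trans => // l.
by rewrite exd_shift // exd_sym.
Qed.

End Exchange.

Section ExchangeKernel.
Context (F : fieldType) (A : algType F).

Lemma exd_bounded c (a a' b b' : laurent A) M N :
    lbounded a M -> lbounded a' M -> lbounded b N -> lbounded b' N ->
  lbounded (exd c a a' b b') (M + N).
Proof.
move=> aM aM' bN bN'; rewrite /exd /rcomm.
do ?[apply: lboundedB | apply: lboundedZ | apply: lboundedD];
  by [exact: lboundedM | rewrite addrC; exact: lboundedM].
Qed.

(** By the recursion of the kernel, multiplying this element by s only shifts
    the indices, the boundary terms vanishing by hypothesis. *)
Lemma exd_kshift c (g g' : nat -> nat -> A) (b b' : laurent A) :
    (forall q p, exd c (lconst (g q p)) (lconst (g' q p)) b b' = 0) ->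
  forall q p, exd c (kshift g q p) (kshift g' q p) b b' = 0.
Proof.
move=> gb; have [N [bN bN']] := lbound2 b b'.
apply: (contraction2 (M := -1 + N)) => q p.
  by apply: exd_bounded => //; apply: kshift_bounded.
rewrite -exdMl; try exact: lvarC.
by rewrite !kshift_rec exdDl exdBl gb addr0.
Qed.

Lemma kshiftSl (g : nat -> nat -> A) q p :
  kshift g q.+1 p = kshift (fun i j => g i.+1 j) q p.
Proof. by apply: eq_lker => i j; rewrite addnS. Qed.
Lemma kshiftSr (g : nat -> nat -> A) q p :
  kshift g q p.+1 = kshift (fun i j => g i j.+1) q p.
Proof. by apply: eq_lker => i j; rewrite addnS. Qed.

Lemma exd_kshiftl c (g : nat -> nat -> A) (b b' : laurent A) q p :
    (forall q p, exd c (lconst (g q p)) (lconst (g q.+1 p)) b b' = 0) ->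
  exd c (kshift g q p) (kshift g q.+1 p) b b' = 0.
Proof. by move=> gb; rewrite kshiftSl exd_kshift. Qed.
Lemma exd_kshiftr c (g : nat -> nat -> A) (b b' : laurent A) q p :
    (forall q p, exd c (lconst (g q p)) (lconst (g q p.+1)) b b' = 0) ->
  exd c (kshift g q p) (kshift g q p.+1) b b' = 0.
Proof. by move=> gb; rewrite kshiftSr exd_kshift. Qed.

Lemma kshift0 q p : kshift (fun _ _ => 0 : A) q p = 0.
Proof.
apply/esym/(@kshift_unique _ _ _ (fun _ _ => 0) 0) => i j.
  by move=> k _; apply: lcoef0.
by rewrite mulr0 subrr lconst0 addr0.
Qed.

Lemma kshift_comm (g : nat -> nat -> A) (b : laurent A) :
    (forall q p, GRing.comm (lconst (g q p)) b) ->
  forall q p, GRing.comm (kshift g q p) b.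
Proof.
move=> gb q p; apply/subr0_eq; rewrite -[LHS]/(rcomm _ _).
have := @exd_kshift 0 (fun _ _ => 0) g b b _ q p.
rewrite kshift0 exd0l; apply=> i j.
by rewrite (raddf0 (@lconst A)) exd0l /rcomm gb subrr.
Qed.

End ExchangeKernel.

(** * Logarithmic derivatives of truncated power series *)

Section LogDerivative.
Context (A : nzRingType).
Implicit Types (p q f g w : {poly A}) (N : nat).

Definition eqmodX N p q := forall k, (k < N)%N -> p`_k = q`_k.

Lemma eqmodX_refl N p : eqmodX N p p. Proof. by []. Qed.
Lemma eqmodX_sym N p q : eqmodX N p q -> eqmodX N q p.
Proof. by move=> pq k kN; rewrite pq. Qed.
Lemma eqmodX_trans N p q w : eqmodX N p q -> eqmodX N q w -> eqmodX N p w.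
Proof. by move=> pq qw k kN; rewrite pq ?qw. Qed.
Lemma eqmodX_le M N p q : (M <= N)%N -> eqmodX N p q -> eqmodX M p q.
Proof. by move=> MN pq k kM; apply/pq/(leq_trans kM). Qed.
Lemma eqmodXD N p p' q q' : eqmodX N p p' -> eqmodX N q q' -> eqmodX N (p + q) (p' + q').
Proof. by move=> pp qq k kN; rewrite !coefD pp ?qq. Qed.
Lemma eqmodXB N p p' q q' : eqmodX N p p' -> eqmodX N q q' -> eqmodX N (p - q) (p' - q').
Proof. by move=> pp qq k kN; rewrite !coefB pp ?qq. Qed.
Lemma eqmodXM N p p' q q' : eqmodX N p p' -> eqmodX N q q' -> eqmodX N (p * q) (p' * q').
Proof.
move=> pp qq k kN; rewrite !coefM; apply: eq_bigr => j _.
by rewrite pp ?qq //; have := ltn_ord j; lia.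
Qed.
Lemma eqmodX_deriv N p q : eqmodX N.+1 p q -> eqmodX N p^`() q^`().
Proof. by move=> pq k kN; rewrite !coef_deriv pq. Qed.

(* w is invertible as a power series. *)
Lemma eqmodX_cancel N f g w : w`_0 = 1 -> eqmodX N (f * w) (g * w) -> eqmodX N f g.
Proof.
move=> w0 fg; suff H k : (k < N)%N -> (f - g)`_k = 0.
  by move=> k /H /eqP; rewrite coefB subr_eq0 => /eqP.
elim/ltn_ind: k => k IH kN; have := fg k kN; move/eqP.
rewrite -subr_eq0 -coefB -mulrBl coefM big_ord_recr /= subnn w0 mulr1.
rewrite big1 ?add0r => [/eqP //|j _].
by rewrite IH ?mul0r // (ltn_trans _ kN).
Qed.

Lemma coef_exp0 p n k : p`_0 = 0 -> (k < n)%N -> (p ^+ n)`_k = 0.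
Proof.
move=> p0; elim: n k => // n IH k kn; rewrite exprS coefM big1 // => j _.
case: (posnP j) => [->|j0]; first by rewrite p0 mul0r.
by rewrite IH ?mulr0 //; have := ltn_ord j; lia.
Qed.

(** Up to order N this is the derivative of log (1 + p), if p has no constant
    term and commutes with its derivative. *)
Definition dlog N p : {poly A} := (\sum_(j < N) (- p) ^+ j) * p^`().

Lemma dlogP N p : p`_0 = 0 -> GRing.comm p p^`() ->
  eqmodX N (dlog N p * (1 + p)) p^`() /\ eqmodX N ((1 + p) * dlog N p) p^`().
Proof.
move=> p0 pC.
have pS : (1 + p) * \sum_(j < N) (- p) ^+ j = 1 - (- p) ^+ N.
  by apply: oppr_inj; rewrite opprB subrX1 -mulNr opprD addrC.
have tr : eqmodX N ((1 - (- p) ^+ N) * p^`()) p^`().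
  rewrite -[X in eqmodX _ _ X]mul1r -[1 in X in eqmodX _ _ X]subr0.
  apply: eqmodXM => //; apply: eqmodXB => // k kN.
  by rewrite coef0 coef_exp0 // coefN p0 oppr0.
split; rewrite /dlog; last by rewrite mulrA pS.
have SC : GRing.comm (\sum_(j < N) (- p) ^+ j) (1 + p).
  apply/commr_sym/commr_sum => j _; apply/commrX/commrN/commr_sym/commrD => //.
  exact: commr1.
rewrite -mulrA; have -> : p^`() * (1 + p) = (1 + p) * p^`().
  by rewrite mulrDl mulrDr mul1r mulr1 pC.
by rewrite mulrA SC pS.
Qed.

Lemma deriv_exp_comm p n : GRing.comm p p^`() ->
  (p ^+ n)^`() = p ^+ n.-1 * p^`() *+ n.
Proof.
move=> pC; elim: n => [|n IH]; first by rewrite expr0 derivC.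
rewrite exprS derivM IH -pred_Sn; case: n IH => [|n] IH.
  by rewrite expr0 mulr1 mul1r mulr0 addr0.
rewrite mulrnAr mulrA -exprS -pred_Sn [RHS]mulrS; congr (_ + _).
exact/commr_sym/commr_sym/commrX/commr_sym.
Qed.

(** The Leibniz rule, divided by (1 + p) (1 + q): the logarithm of a product of
    commuting series is the sum of their logarithms. *)
Lemma dlog_mul N p q w :
    p`_0 = 0 -> q`_0 = 0 -> GRing.comm p q -> GRing.comm p p^`() ->
    GRing.comm q q^`() -> GRing.comm w w^`() -> GRing.comm p q^`() ->
    w`_0 = 0 -> eqmodX N.+1 (1 + w) ((1 + p) * (1 + q)) ->
  eqmodX N (dlog N w) (dlog N p + dlog N q).
Proof.
move=> p0 q0 pqC pC qC wC pq'C w0 ww.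
have [wl _] := dlogP N w0 wC.
have [pl _] := dlogP N p0 pC; have [ql _] := dlogP N q0 qC.
apply: (@eqmodX_cancel _ _ _ (1 + w)); first by rewrite coefD coef1 w0 addr0.
apply: eqmodX_trans wl _; apply/eqmodX_sym.
have ww' := eqmodX_le (leqnSn N) ww.
apply: eqmodX_trans (eqmodXM (@eqmodX_refl N _) ww') _.
have pq1 : GRing.comm (1 + p) (1 + q).
  apply: commrD; first exact: commr1.
  by apply/commr_sym/commrD; [apply: commr1 | apply: commr_sym].
have -> : (dlog N p + dlog N q) * ((1 + p) * (1 + q)) =
    dlog N p * (1 + p) * (1 + q) + dlog N q * (1 + q) * (1 + p).
  by rewrite mulrDl -!mulrA pq1.
apply: eqmodX_trans (eqmodXD (eqmodXM pl (@eqmodX_refl N _)) (eqmodXM ql (@eqmodX_refl N _))) _.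
apply: eqmodX_trans (_ : eqmodX N (((1 + p) * (1 + q))^`()) _); last first.
  apply: eqmodX_trans (eqmodX_sym (eqmodX_deriv ww)) _.
  by rewrite derivD derivC add0r.
rewrite derivM !derivD !derivC !add0r => k kN; rewrite !coefD; congr (_ + _).
by rewrite mulrDr mulrDl mulr1 mul1r -pq'C.
Qed.

Lemma comm_poly_coef p q :
  (forall i j, GRing.comm p`_i q`_j) -> GRing.comm p q.
Proof.
move=> pq; apply/polyP => k; rewrite coefM coefMr.
by apply: eq_bigr => j _; rewrite pq.
Qed.

Lemma mul_linpoly (x y : A) p :
  (x%:P - y%:P * 'X) * p = x%:P * p - y%:P * p * 'X.
Proof. by rewrite mulrBl -!mulrA (commr_polyX p). Qed.

End LogDerivative.

(** * Cartan elements acting as shifts *)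

Section ShiftAction.
Context (F : fieldType) (A : algType F).
Implicit Types (g f : {poly F}) (x : nat -> A) (c : F).

(** g(X) x at s, X being the shift of sequences. *)
Definition shact g x (s : nat) : A := \sum_(p < size g) g`_p *: x (s + p)%N.

Lemma shactE n g x s : (size g <= n)%N ->
  shact g x s = \sum_(p < n) g`_p *: x (s + p)%N.
Proof.
move=> gn; rewrite /shact (big_ord_widen _ (fun p => g`_p *: x (s + p)%N) gn).
rewrite big_mkcond; apply: eq_bigr => p _; case: ltnP => // gp.
by rewrite nth_default ?scale0r.
Qed.

Lemma shactD f g x s : shact (f + g) x s = shact f x s + shact g x s.
Proof.
rewrite (@shactE (maxn (size f) (size g))); last exact: size_polyD.
rewrite (@shactE (maxn (size f) (size g)) f) ?leq_maxl //.
rewrite (@shactE (maxn (size f) (size g)) g) ?leq_maxr // -big_split.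
by apply: eq_bigr => p _; rewrite coefD scalerDl.
Qed.
Lemma shactZ c g x s : shact (c *: g) x s = c *: shact g x s.
Proof.
rewrite (@shactE (size g)) ?size_scale_leq // scaler_sumr.
by apply: eq_bigr => p _; rewrite coefZ scalerA.
Qed.
Lemma shactX g x s : shact ('X * g) x s = shact g x s.+1.
Proof.
rewrite (@shactE (size g).+1) ?big_ord_recl.
  rewrite coefXM eqxx scale0r add0r; apply: eq_bigr => p _.
  by rewrite coefXM /= addnS.
by rewrite (leq_trans (size_polyMleq _ _)) // size_polyX.
Qed.
Lemma shact_lin c g x s :
  shact g (fun k => x k.+1 + c *: x k) s = shact (('X + c%:P) * g) x s.
Proof.
rewrite mulrDl shactD shactX mul_polyC shactZ /shact scaler_sumr -big_split.
by apply: eq_bigr => p _; rewrite /= scalerDr addSn !scalerA mulrC.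
Qed.
Lemma shact1 x s : shact 1 x s = x s.
Proof. by rewrite (@shactE 1) ?size_poly1 // big_ord1 coef1 scale1r addn0. Qed.

Section ShiftElement.
Variables (alpha : nat -> A) (N : nat).
Hypothesis alpha0 : alpha 0%N = 1.
Hypothesis alphaC : forall r t, GRing.comm (alpha r) (alpha t).

(** alpha(u) truncated, with 'X for 1 / u, and its logarithmic derivative. *)
Definition strunc : {poly A} := \poly_(k < N.+1) alpha k.
Definition slog : {poly A} := dlog N (strunc - 1).

Lemma strunc_coef k : (k <= N)%N -> strunc`_k = alpha k.
Proof. by move=> kN; rewrite coef_poly ltnS kN. Qed.
Lemma strunc_coefC k y : (forall r, GRing.comm (alpha r) y) -> GRing.comm strunc`_k y.
Proof.
by move=> ay; rewrite coef_poly; case: ifP => // _; apply/commr_sym/commr0.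
Qed.

Lemma slogP : eqmodX N (slog * strunc) strunc^`() /\ eqmodX N (strunc * slog) strunc^`().
Proof.
have p0 : (strunc - 1)`_0 = 0 by rewrite coefB strunc_coef // coef1 alpha0 subrr.
have aC : GRing.comm strunc strunc^`().
  apply: comm_poly_coef => i j; rewrite coef_deriv; apply: commrMn.
  apply: strunc_coefC => r; apply/commr_sym/strunc_coefC => t; exact: alphaC.
have dE : (strunc - 1)^`() = strunc^`() by rewrite derivB derivC subr0.
have pC : GRing.comm (strunc - 1) (strunc - 1)^`().
  rewrite dE; apply/commr_sym/commrB; first exact: commr_sym.
  exact: commr1.
by have := dlogP N p0 pC; rewrite dE [1 + _]addrC subrK.
Qed.

(** (X + c) x. *)
Definition shplus (c : F) x (t : nat) : A := x t.+1 + c *: x t.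
(** (u - X - c) alpha(u) x = (u - X + c) x alpha(u), X acting on x. *)
Definition shexch (c : F) x := forall r s,
  exd c (alpha r) (alpha r.+1) (x s) (x s.+1) = 0.
(** The coefficient of u^(-n) in (u - X + c) / (u - X - c). *)
Definition shcoef (c : F) (n : nat) : {poly F} :=
  if n is k.+1 then (c + c) *: ('X + c%:P) ^+ k else 1.

Lemma shexch_plus c x : shexch c x -> shexch c (shplus c x).
Proof.
move=> ax r s; rewrite /shplus exd_sym exdDl exd_sym ax exdZl exd_sym ax.
by rewrite scaler0 addr0.
Qed.

Lemma shexchE c x r s : shexch c x ->
  alpha r.+1 * x s - alpha r * shplus c x s =
  x s * alpha r.+1 - (x s.+1 - c *: x s) * alpha r.
Proof.
by move=> ax; apply/subr0_eq; rewrite -[RHS](ax r s) /exd /rcomm /shplus; ncring A.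
Qed.

Lemma shact_plusS c k x s :
  shact (shcoef c k.+1) (shplus c x) s = shact (shcoef c k.+2) x s.
Proof. by rewrite shact_lin /= -scalerAr -exprS. Qed.
Lemma shact_plus0 c x s : shact (shcoef c 0) (shplus c x) s =
  shact (shcoef c 1) x s + (x s.+1 - c *: x s).
Proof.
by rewrite shact1 /= expr0 shactZ shact1 scalerDl /shplus; ncring A.
Qed.

(** alpha(u) x alpha(u)^-1 = (u - X + c) / (u - X - c) x. *)
Lemma alpha_exch c x k s : shexch c x ->
  alpha k * x s = \sum_(p < k.+1) shact (shcoef c p) x s * alpha (k - p)%N.
Proof.
elim: k x s => [|k IH] x s ax.
  by rewrite big_ord1 subnn shact1 alpha0 mul1r mulr1.
have E := shexchE k s ax; rewrite -[LHS](subrK (alpha k * shplus c x s)) E.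
pose T := \sum_(p < k) shact (shcoef c p.+2) x s * alpha (k - p.+1)%N.
have -> : \sum_(p < k.+2) shact (shcoef c p) x s * alpha (k.+1 - p)%N =
    x s * alpha k.+1 + (shact (shcoef c 1) x s * alpha k + T).
  by rewrite 2!big_ord_recl shact1 subn0 subSS subn0.
have -> : alpha k * shplus c x s =
    (shact (shcoef c 1) x s + (x s.+1 - c *: x s)) * alpha k + T.
  rewrite (IH _ _ (shexch_plus ax)) big_ord_recl subn0 shact_plus0; congr (_ + _).
  by apply: eq_bigr => p _; rewrite shact_plusS.
by ncring A.
Qed.

(** In terms of z = 1 / u conjugation by alpha multiplies x by
    (1 - (X - c) z) / (1 - (X + c) z), so that the logarithmic derivative of
    alpha acts on x by that of this quotient, whose coefficient of z^n is
    (X + c)^(n+1) - (X - c)^(n+1). *)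
Lemma slog_shift (c : F) x : shexch c x ->
  forall n, (n < N)%N -> exists g : {poly F},
    [/\ (size g <= n.+1)%N, g`_n = (c + c) *+ n.+1 &
        forall s, rcomm slog`_n (x s) = shact g x s].
Proof.
move=> ax; pose a := strunc; pose eta := slog.
have a_coef k : (k <= N)%N -> a`_k = alpha k by apply: strunc_coef.
pose xm s : A := x s.+1 - c *: x s.
pose yp s : {poly A} := (x s)%:P - (shplus c x s)%:P * 'X.
pose ym s : {poly A} := (x s)%:P - (xm s)%:P * 'X.
(* yp s and ym s are (1 - (X + c) z) x and (1 - (X - c) z) x at s. *)
have ay s : eqmodX N.+1 (a * yp s) (ym s * a).
  have yE : ym s * a = (x s)%:P * a - (xm s)%:P * a * 'X.
    exact: mul_linpoly.
  move=> k kN; rewrite yE /yp mulrBr mulrA !coefB !coefMX coefMC coefCM.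
  case: k kN => [|k] kN /=.
    by rewrite !subr0 a_coef // alpha0 mul1r mulr1.
  have kN' : (k <= N)%N by lia.
  by rewrite coefMC coefCM !a_coef // shexchE.
pose H s : {poly A} := \poly_(k < N) shact (shcoef c k) (shplus c x) s.
have aH s : eqmodX N (a * (shplus c x s)%:P) (H s * a).
  move=> k kN; rewrite coefMC a_coef ?(ltnW kN) // coefM.
  rewrite (alpha_exch _ _ (shexch_plus ax)).
  apply: eq_bigr => p _; rewrite coef_poly a_coef ?ifT //.
    by have := ltn_ord p; lia.
  by have := ltn_ord p; lia.
(* The derivative of a yp = ym a, divided by a from the right. *)
have key s : eqmodX N (eta * ym s - ym s * eta) (H s - (xm s)%:P).
  have [el er] := slogP.
  apply: (@eqmodX_cancel _ _ _ _ a); first by rewrite a_coef.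
  rewrite (mulrBl _ (eta * ym s)) (mulrBl _ (H s)) -(mulrA eta) -(mulrA (ym s)).
  have d1 : eqmodX N (a^`() * yp s - a * (shplus c x s)%:P)
      (ym s * a^`() - (xm s)%:P * a).
    have := eqmodX_deriv (ay s).
    rewrite !derivM !derivB !derivM !derivC derivX !mul0r !mulr1 !sub0r !add0r.
    by rewrite !mulrN mulNr [X in eqmodX _ _ X]addrC.
  have e1 : eqmodX N (eta * (ym s * a)) (a^`() * yp s).
    apply: eqmodX_trans (eqmodXM (@eqmodX_refl _ N eta) (eqmodX_sym (eqmodX_le (leqnSn N) (ay s)))) _.
    by rewrite mulrA; apply: eqmodXM => //; apply: el.
  have e2 : eqmodX N (ym s * (eta * a)) (ym s * a^`()) by apply: eqmodXM => //; apply: el.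
  move=> k kN; rewrite !coefB e1 // e2 // -aH //.
  have := d1 k kN; rewrite !coefB => /eqP; rewrite subr_eq => /eqP E.
  by apply/eqP; rewrite subr_eq E -addrA addrC [- _ + _]addrC.
(* The coefficients of [eta, ym] are those of [eta, x] up to a recursion in n. *)
have etam s n : (eta * ym s - ym s * eta)`_n =
    rcomm eta`_n (x s) - (if n is k.+1 then rcomm eta`_k (xm s) else 0).
  have -> : ym s * eta = (x s)%:P * eta - (xm s)%:P * eta * 'X.
    exact: mul_linpoly.
  rewrite /ym mulrBr mulrA !coefB !coefMX !coefMC !coefCM /rcomm.
  by rewrite opprD addrACA -opprD; case: n => [|n] /=; rewrite ?coefMC ?coefCM ?subr0.
elim=> [|n IH] nN.
  exists ((c + c) *: 1); split.
  - by rewrite (leq_trans (size_scale_leq _ _)) // size_poly1.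
  - by rewrite coefZ coef1 mulr1 mulr1n.
  move=> s; have := key s 0%N nN; rewrite etam subr0 => ->.
  by rewrite coefB coefC coef_poly nN shact_plus0 addrK /= expr0.
have [g [gn gl gx]] := IH (ltnW nN).
have XcE : 'X + c%:P = 'X - (- c)%:P by rewrite polyCN opprK.
exists (('X - c%:P) * g + shcoef c n.+2); split.
- rewrite (leq_trans (size_polyD _ _)) // geq_max; apply/andP; split.
    by rewrite (leq_trans (size_polyMleq _ _)) // size_XsubC.
  by rewrite (leq_trans (size_scale_leq _ _)) // XcE size_exp_XsubC.
- rewrite coefD mulrBl coefB coefXM /= coefCM [g`_n.+1]nth_default // mulr0 subr0.
  have := monicP (monic_exp n.+1 (monicXsubC (- c))); rewrite -XcE lead_coefE.
  rewrite XcE size_exp_XsubC -XcE gl coefZ => -> /=.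
  by rewrite mulr1 [RHS]mulrSr.
move=> s; have := key s _ nN; rewrite etam coefB coefC /= coef_poly nN subr0.
rewrite shact_plusS shactD => <-.
rewrite mulrBl -mulNr -polyCN.
have -> : rcomm eta`_n (xm s) = rcomm eta`_n (x s.+1) - c *: rcomm eta`_n (x s).
  by rewrite /xm /rcomm; ncring A.
by rewrite /eta !gx shactD shactX mul_polyC shactZ scaleNr; ncring A.
Qed.
End ShiftElement.
End ShiftAction.

(** * Reduction of the Serre relations to those between modes 0 *)

Section SerreSumTheory.
Context (F : fieldType) (A : algType F) (m : nat).
Implicit Types (y : 'I_m -> A) (z u v T : A) (i : 'I_m) (l : seq 'I_m).
Implicit Types p : {perm 'I_m}.

Lemma upd_id y i u : upd y i u i = u.
Proof. by rewrite /upd eqxx. Qed.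

Lemma serre_nestZr c p y z l :
  serre_nest p y (c *: z) l = c *: serre_nest p y z l.
Proof. by elim: l => //= k l ->; rewrite /rcomm; ncring A. Qed.

Lemma serre_nestZl c p y z i u l :
    uniq [seq p k | k <- l] -> i \in [seq p k | k <- l] ->
  serre_nest p (upd y i (c *: u)) z l = c *: serre_nest p (upd y i u) z l.
Proof.
elim: l => //= k l IH /andP[kl ul]; rewrite in_cons; case: eqP => [-> _|ik /= il].
  rewrite !upd_id (serre_nest_upd y z (c *: u) u kl).
  by rewrite /rcomm; ncring A.
have pki w : upd y i w (p k) = y (p k) by rewrite /upd; case: eqP => // /esym.
by rewrite IH // !pki /rcomm; ncring A.
Qed.

Lemma serre_sumZr c y z : serre_sum y (c *: z) = c *: serre_sum y z.
Proof. by rewrite scaler_sumr; apply: eq_bigr => p _; apply: serre_nestZr. Qed.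
Lemma serre_sumZl c y z i u :
  serre_sum (upd y i (c *: u)) z = c *: serre_sum (upd y i u) z.
Proof.
rewrite scaler_sumr; apply: eq_bigr => p _.
by apply: serre_nestZl; rewrite ?uniq_perm_enum ?mem_perm_enum.
Qed.

Lemma serre_sum_perm (s : {perm 'I_m}) y z :
  serre_sum (fun k => y (s k)) z = serre_sum y z.
Proof.
rewrite [RHS](reindex_inj (mulIg s)) /=; apply: eq_bigr => p _.
rewrite /serre_nest; elim: (enum _) => //= k l ->.
by rewrite permM.
Qed.

Lemma serre_sum_shactr (g : {poly F}) (x : nat -> A) s y :
  serre_sum y (shact g x s) = \sum_(p < size g) g`_p *: serre_sum y (x (s + p)%N).
Proof.
rewrite /shact; elim: (size g) => [|n IH]; first by rewrite !big_ord0 serre_sum0r.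
by rewrite !big_ord_recr serre_sumDr serre_sumZr IH.
Qed.
Lemma serre_sum_shactl n (g : {poly F}) (x : nat -> A) s y z i :
    (size g <= n)%N ->
  serre_sum (upd y i (shact g x s)) z =
  \sum_(p < n) g`_p *: serre_sum (upd y i (x (s + p)%N)) z.
Proof.
move=> /shactE->; elim: n => [|n IH]; first by rewrite !big_ord0 serre_sum0l.
by rewrite !big_ord_recr serre_sumDl serre_sumZl IH.
Qed.

Lemma rcomm_jacobi T u v : rcomm T (rcomm u v) = rcomm (rcomm T u) v + rcomm u (rcomm T v).
Proof. by rewrite /rcomm; ncring A. Qed.

Lemma rcomm_sumr (J : Type) (r : seq J) (f : J -> A) u :
  rcomm u (\sum_(j <- r) f j) = \sum_(j <- r) rcomm u (f j).
Proof.
by elim/big_rec2: _ => [|j a b _ <-]; rewrite ?rcomm0r // rcommDr.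
Qed.

Lemma rcomm_serre_nest T p y z l : uniq [seq p k | k <- l] ->
  rcomm T (serre_nest p y z l) = serre_nest p y (rcomm T z) l +
    \sum_(k <- l) serre_nest p (upd y (p k) (rcomm T (y (p k)))) z l.
Proof.
elim: l => /= [_|k l IH /andP[kl ul]]; first by rewrite big_nil addr0.
rewrite rcomm_jacobi IH // rcommDr rcomm_sumr big_cons /= upd_id.
rewrite addrCA; congr (_ + (_ + _)).
  by rewrite (serre_nest_upd y z _ (y (p k)) kl) updE.
rewrite big_seq [RHS]big_seq; apply: eq_bigr => j jl; congr (rcomm _ _).
rewrite /upd ifN //; apply: contraNneq kl => ->.
by apply/mapP; exists j.
Qed.

Lemma rcomm_serre_sum T y z : rcomm T (serre_sum y z) =
  serre_sum y (rcomm T z) + \sum_i serre_sum (upd y i (rcomm T (y i))) z.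
Proof.
rewrite rcomm_sumr exchange_big -big_split; apply: eq_bigr => p _ /=.
rewrite rcomm_serre_nest ?uniq_perm_enum //; congr (_ + _).
by rewrite big_enum [RHS](reindex_inj (@perm_inj _ p)).
Qed.

End SerreSumTheory.

Section SerreReduction.
Context (F : fieldType) (A : algType F).
Hypothesis F0 : forall n, n.+1%:R != 0 :> F.
Variables (alpha x z : nat -> A) (c e : F) (m : nat).
Hypothesis alpha0 : alpha 0%N = 1.
Hypothesis alphaC : forall r t, GRing.comm (alpha r) (alpha t).
Hypothesis ax : shexch alpha c x.
Hypothesis az : shexch alpha e z.
Hypothesis c_neq0 : c != 0.
Hypothesis S0 : forall s, serre_sum (fun _ : 'I_m => x 0%N) (z s) = 0.

Let S (r : 'I_m -> nat) s := serre_sum (fun k => x (r k)) (z s).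
Let setr (r : 'I_m -> nat) i k : 'I_m -> nat := fun j => if j == i then k else r j.
Let nz (r : 'I_m -> nat) := #|[pred i | r i != 0%N]|.

Let SsetE r i k s : serre_sum (upd (fun k => x (r k)) i (x k)) (z s) = S (setr r i k) s.
Proof. by congr serre_sum; apply/funext => j; rewrite /upd /setr; case: eqP. Qed.

Let nz_set r i k : (nz (setr r i k) <= (r i == 0%N) + nz r)%N.
Proof.
rewrite /nz; case: (posnP (r i)) => ri0 /=.
  rewrite ?ri0 ?eqxx add1n; apply: leq_trans (_ : #|[predU1 i & [pred i | r i != 0%N]]| <= _)%N.
    apply/subset_leq_card/subsetP => j; rewrite !inE /setr.
    by case: (eqVneq j i).
  by rewrite cardU1 inE ri0.
rewrite ?eqn0Ngt ?ri0 add0n.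
apply/subset_leq_card/subsetP => j; rewrite !inE /setr.
by case: (eqVneq j i) => // -> _; rewrite -lt0n ri0.
Qed.

(** Induction on the number of nonzero indices, and then on the value k that an
    index equal to 0 takes.  Some T acts on both sequences x and z as a nonzero
    multiple of the shift by k, up to smaller shifts.  The commutator of T with a
    relation known to hold is a sum over the places where T acts: at z or at
    an index other than 0 there is no new nonzero index; at an index equal to 0
    it creates relations with a new index less than k and the relation wanted,
    the latter being the same for all these places, as the Serre sum is
    symmetric.  So a positive multiple of the wanted relation is zero. *)
Lemma serre_reduction r s : S r s = 0.
Proof.
suff H n : forall r s, (nz r <= n)%N -> S r s = 0 by apply: (H _ r s (leqnn _)).
elim: n => [|n IH] {}r {}s rn.
  rewrite /S (_ : (fun k => x (r k)) = fun _ => x 0%N) //.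
  apply/funext => k; congr x; apply/eqP; apply: contraTT rn => rk.
  by rewrite -ltnNge; apply/card_gt0P; exists k.
have step k : forall r0 q s, (nz r0 <= n)%N -> r0 q = 0%N -> S (setr r0 q k) s = 0.
  elim/ltn_ind: k => k IHk r0 q t r0n r0q.
  have [gx [gxk gx_lead xE]] := slog_shift alpha0 alphaC ax (ltnSn k).
  have [gz [_ _ zE]] := slog_shift alpha0 alphaC az (ltnSn k).
  pose T := (slog alpha k.+1)`_k.
  have : rcomm T (S r0 t) = 0 by rewrite IH // rcomm0r.
  rewrite /S rcomm_serre_sum zE serre_sum_shactr big1 ?add0r => [|p _]; last first.
    by rewrite -/(S r0 _) IH ?scaler0.
  rewrite (eq_bigr (fun i => (r0 i == 0%N)%:R *: (gx`_k *: S (setr r0 q k) t))).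
    rewrite -scaler_suml => /eqP; rewrite !scaler_eq0 => /or3P[|gk0|/eqP //].
      rewrite -natr_sum; case E: (\sum_i _)%N => [|j].
        by move: E; rewrite (bigD1 q) //= r0q eqxx.
      by rewrite (negbTE (F0 j)).
    move: gk0; rewrite gx_lead -mulr2n -mulrnA -mulr_natr natrM !mulf_eq0.
    by rewrite (negbTE c_neq0) (negbTE (F0 1)) (negbTE (F0 k)).
  move=> i _; rewrite xE (serre_sum_shactl _ _ _ _ _ gxk).
  have E p : serre_sum (upd (fun k => x (r0 k)) i (x (r0 i + p)%N)) (z t) =
      S (setr r0 i (r0 i + p)%N) t by apply: SsetE.
  case: (posnP (r0 i)) => r0i; last first.
    rewrite scale0r big1 // => p _; rewrite E IH ?scaler0 //.
    by apply: leq_trans (nz_set _ _ _) _; rewrite eqn0Ngt r0i.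
  rewrite scale1r big_ord_recr big1 /= ?add0r => [|p _].
    rewrite E r0i add0n; congr (_ *: _).
    rewrite /S -(serre_sum_perm (tperm i q)); congr serre_sum.
    apply/funext => j; congr x; rewrite /setr.
    case: tpermP => [->|->|/eqP ji /eqP jq].
    - by case: (eqVneq q i) => // _; rewrite r0q r0i.
    - by rewrite !eqxx.
    by rewrite (negbTE ji) (negbTE jq).
  by rewrite E r0i add0n IHk ?scaler0.
case: (leqP (nz r) n) => [/IH //|nr].
have /card_gt0P[q] : (0 < nz r)%N by apply: leq_ltn_trans nr.
rewrite inE => rq.
have -> : r = setr (setr r q 0%N) q (r q).
  by apply/funext => j; rewrite /setr; case: eqP => // ->.
apply: step; last by rewrite /setr eqxx.
have : (nz (setr r q 0%N) < nz r)%N; last by move=> h; rewrite -ltnS (leq_trans h).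
rewrite /nz; apply/proper_card/properP; split.
  by apply/subsetP => j; rewrite !inE /setr; case: (eqVneq j q).
by exists q; rewrite !inE /setr ?eqxx.
Qed.

End SerreReduction.

(** * Locally nilpotent derivations and sl2 *)

Lemma rcommZl (F : fieldType) (R : algType F) (c : F) (u v : R) :
  rcomm (c *: u) v = c *: rcomm u v.
Proof. by rewrite /rcomm; ncring R. Qed.
Lemma rcommZr (F : fieldType) (R : algType F) (c : F) (u v : R) :
  rcomm u (c *: v) = c *: rcomm u v.
Proof. by rewrite /rcomm; ncring R. Qed.

Section SlTwo.
Context (F : fieldType) (R : algType F).
Variables (e f h v : R) (delta lambda : F).
Hypothesis ef : rcomm e f = h.
Hypothesis he : rcomm h e = (delta + delta) *: e.
Hypothesis hv : rcomm h v = lambda *: v.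
Hypothesis fv : rcomm f v = 0.

Definition adn (n : nat) : R := iter n (rcomm e) v.

Lemma adn_weight n : rcomm h (adn n) = (lambda + n%:R * (delta + delta)) *: adn n.
Proof.
elim: n => [|n IH]; first by rewrite mul0r addr0.
rewrite /= rcomm_jacobi he IH rcommZl rcommZr -scalerDl -[n.+1%:R]natr1.
by congr (_ *: _); ring.
Qed.

Lemma adn_lower n : rcomm f (adn n.+1) =
  - (n.+1%:R * (lambda + n%:R * delta)) *: adn n.
Proof.
have fe : rcomm f e = - h by rewrite -ef /rcomm opprB.
have hN u : rcomm (- h) u = - rcomm h u by rewrite /rcomm; ncring R.
have S k : adn k.+1 = rcomm e (adn k) by [].
elim: n => [|n IH]; rewrite S rcomm_jacobi fe hN.
  by rewrite /= hv fv rcomm0r addr0 mul1r mul0r addr0 scaleNr.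
rewrite IH rcommZr -S adn_weight -scaleNr -scalerDl.
by congr (_ *: _); rewrite -!natr1; ring.
Qed.

End SlTwo.

Section AdNilpotent.
Context (F : fieldType) (R : algType F) (e : R).
Implicit Types (y z u : R) (c : F).

Definition adnilp y := exists n, iter n (rcomm e) y = 0.

Lemma iter_rcomm0 n : iter n (rcomm e) 0 = 0.
Proof. by elim: n => //= n ->; rewrite rcomm0r. Qed.
Lemma iter_rcommD n y z :
  iter n (rcomm e) (y + z) = iter n (rcomm e) y + iter n (rcomm e) z.
Proof. by elim: n => //= n ->; rewrite rcommDr. Qed.
Lemma iter_rcommZ n c y : iter n (rcomm e) (c *: y) = c *: iter n (rcomm e) y.
Proof. by elim: n => //= n ->; rewrite /rcomm; ncring R. Qed.
Lemma iter_rcomm_le m n y : (m <= n)%N ->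
  iter m (rcomm e) y = 0 -> iter n (rcomm e) y = 0.
Proof. by move=> /subnK <- y0; rewrite iterD y0 iter_rcomm0. Qed.

Lemma adnilp0 : adnilp 0. Proof. by exists 0%N. Qed.
Lemma adnilpD y z : adnilp y -> adnilp z -> adnilp (y + z).
Proof.
move=> [m ym] [n zn]; exists (maxn m n).
by rewrite iter_rcommD !(iter_rcomm_le _ ym, iter_rcomm_le _ zn) ?addr0 ?leq_maxl ?leq_maxr.
Qed.
Lemma adnilpZ c y : adnilp y -> adnilp (c *: y).
Proof. by move=> [n yn]; exists n; rewrite iter_rcommZ yn scaler0. Qed.
Lemma adnilpB y z : adnilp y -> adnilp z -> adnilp (y - z).
Proof. by move=> ny nz; rewrite -scaleN1r; apply/adnilpD/adnilpZ. Qed.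
Lemma adnilp_rcomm y : adnilp (rcomm e y) -> adnilp y.
Proof. by move=> [n yn]; exists n.+1; rewrite iterSr. Qed.
Lemma adnilpM y z : adnilp y -> adnilp z -> adnilp (y * z).
Proof.
move=> [m ym] [n zn]; move: {2}(m + n)%N (erefl (m + n)%N) => k.
elim: k m n y z ym zn => [|k IH] [|m] [|n] y z ym zn //= mn;
  try by [rewrite (ym : y = 0) mul0r; apply: adnilp0 |
          rewrite (zn : z = 0) mulr0; apply: adnilp0].
apply: adnilp_rcomm; have -> : rcomm e (y * z) = rcomm e y * z + y * rcomm e z.
  by rewrite /rcomm; ncring R.
apply: adnilpD.
  by apply: (IH m n.+1) => //; [rewrite -iterSr | lia].
by apply: (IH m.+1 n) => //; [rewrite -iterSr | lia].
Qed.
Lemma adnilpR y z : adnilp y -> adnilp z -> adnilp (rcomm y z).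
Proof. by move=> ny nz; apply: adnilpB; apply: adnilpM. Qed.
Lemma adnilp_sum (J : Type) (r : seq J) (P : pred J) (G : J -> R) :
  (forall j, P j -> adnilp (G j)) -> adnilp (\sum_(j <- r | P j) G j).
Proof.
by move=> nG; elim/big_ind: _ => //; [apply: adnilp0 | apply: adnilpD].
Qed.

End AdNilpotent.

Lemma adnilp_add (F : fieldType) (R : algType F) (e u y : R) :
  GRing.comm u e -> GRing.comm u y -> adnilp e y -> adnilp (e + u) y.
Proof.
move=> ue uy [n yn]; exists n; rewrite -[RHS]yn.
have uC k : GRing.comm u (iter k (rcomm e) y).
  by elim: k => //= k IH; apply: commrB; apply: commrM.
elim: n {yn} => //= n ->; rewrite rcommDl.
by rewrite [rcomm u _]/rcomm uC subrr addr0.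
Qed.

(** Applying f to ad(e)^(n+1) w = 0 gives a multiple of ad(e)^n w = 0, which is
    nonzero when the weight is positive. *)
Lemma lowest_weight_eq0 (F : fieldType) (R : algType F) (e f h w : R)
    (delta : F) (m : nat) :
    (forall n, n.+1%:R != 0 :> F) -> delta != 0 ->
    rcomm e f = h -> rcomm h e = (delta + delta) *: e ->
    rcomm h w = (m.+1%:R * delta) *: w -> rcomm f w = 0 -> adnilp e w ->
  w = 0.
Proof.
move=> F0 d0 ef he hw fw [n]; elim: n => // n IH wn; apply: IH.
have /eqP := adn_lower ef he hw fw n; rewrite /adn wn rcomm0r eq_sym.
rewrite -mulrDl -natrD addSn scaler_eq0 oppr_eq0 !mulf_eq0 (negbTE d0).
by rewrite !(negbTE (F0 _)) => /eqP.
Qed.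

Section AdNilpotentLaurent.
Context (F : fieldType) (A : algType F) (e : A).
Implicit Types (y z : laurent A).

Definition adnilps y := forall k, adnilp e (y k).

Lemma adnilpsD y z : adnilps y -> adnilps z -> adnilps (y + z).
Proof. by move=> ny nz k; rewrite lcoefD; apply: adnilpD. Qed.
Lemma adnilpsB y z : adnilps y -> adnilps z -> adnilps (y - z).
Proof. by move=> ny nz k; rewrite lcoefB; apply: adnilpB. Qed.
Lemma adnilpsZ c y : adnilps y -> adnilps (c *: y).
Proof. by move=> ny k; rewrite lcoefZ; apply: adnilpZ. Qed.
Lemma adnilpsM y z : adnilps y -> adnilps z -> adnilps (y * z).
Proof.
move=> ny nz k; have [M yM] := lbound_ex y; have [N zN] := lbound_ex z.
case: (ltP (M + N) k) => kB; first by rewrite (lboundedM yM zN) //; apply: adnilp0.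
rewrite /= (lmul_coefE yM zN (_ : k = M + N - `|(M + N - k)%R|%N%:Z)); last by lia.
by apply: adnilp_sum => j _; apply: adnilpM.
Qed.
Lemma adnilpsR y z : adnilps y -> adnilps z -> adnilps (rcomm y z).
Proof. by move=> ny nz; apply: adnilpsB; apply: adnilpsM. Qed.
Lemma adnilps_const (x : A) : adnilp e x -> adnilps (lconst x).
Proof. by move=> nx k /=; case: ifP => // _; apply: adnilp0. Qed.
Lemma adnilps_kshift (g : nat -> nat -> A) q p :
  (forall i j, adnilp e (g i j)) -> adnilps (kshift g q p).
Proof.
move=> ng k /=; case: (-1 - k) => [N|N]; last exact: adnilp0.
by apply: adnilp_sum => j _; apply: adnilpZ.
Qed.
Lemma adnilps_trans (y : nat -> laurent A) r :
  (forall k, adnilps (y k)) -> adnilps (trans lvar y r).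
Proof.
elim: r y => [|r IH] y ny; first exact: ny.
apply: adnilpsD; first exact: IH.
by move=> k; rewrite lcoef_varl; apply: IH.
Qed.

(** The leading coefficient of w is a locally nilpotent lowest weight vector of
    positive weight for e, f0 and h0, f0 being the leading coefficient of f. *)
Lemma laurent_lowest_weight_eq0 (f0 h0 : A) (f w : laurent A) (delta : F) (m : nat) :
    (forall n, n.+1%:R != 0 :> F) -> delta != 0 ->
    rcomm e f0 = h0 -> rcomm h0 e = (delta + delta) *: e ->
    lbounded f 0 -> f 0 = f0 ->
    rcomm (lconst h0) w = (m.+1%:R * delta) *: w -> rcomm f w = 0 ->
    adnilps w ->
  w = 0.
Proof.
move=> F0 d0 ef he fb f0E hw fw nw; have [M wM] := lbound_ex w.
have wn n : lbounded w (M - n%:Z).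
  elim: n => [|n IH]; first by rewrite subr0.
  move=> k kM; case: (ltP (M - n%:Z) k) => [/IH //|kM'].
  have kE : k = M - n%:Z by lia.
  have wb : lbounded w k by rewrite kE.
  have fwk : (f * w) k = f0 * w k.
    rewrite /= (lmul_coefE fb wb (_ : k = 0 + k - 0%N%:Z)); last by lia.
    by rewrite big_ord1 !subr0 f0E.
  have wfk : (w * f) k = w k * f0.
    rewrite /= (lmul_coefE wb fb (_ : k = k + 0 - 0%N%:Z)); last by lia.
    by rewrite big_ord1 !subr0 f0E.
  apply: (lowest_weight_eq0 (m := m) F0 d0 ef he _ _ (nw k)) => //.
    have := congr1 (fun g : laurent A => g k) hw.
    by rewrite /rcomm lcoefB lcoef_constl lcoef_constr lcoefZ.
  have := congr1 (fun g : laurent A => g k) fw.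
  by rewrite /rcomm lcoefB fwk wfk lcoef0.
by apply: laurentP => k; rewrite lcoef0; apply: (wn `|M - k|.+1%N); lia.
Qed.

End AdNilpotentLaurent.

Section YangianNilpotent.
Context (F : fieldType) (I : finType) (R : algType F).
Variables (hbar : F) (d : I -> F) (a : I -> I -> F).
Variables (x : bool -> I -> nat -> R) (xi : I -> nat -> R).
Hypothesis F0 : forall n, n.+1%:R != 0 :> F.
Hypothesis H : yangian_rel hbar d a x xi.
Variables (e : bool) (i : I).
Let nilp := adnilp (x e i 0%N).

(** The relations express [x_0, x_(r+1)] in terms of x_0, x_1 and x_r. *)
Lemma adnilp_x r : nilp (x e i r).
Proof.
have n0 : nilp (x e i 0%N) by exists 1%N; rewrite /= /rcomm subrr.
have n1 : nilp (x e i 1%N).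
  apply: adnilp_rcomm.
  have E : rcomm (x e i 0%N) (x e i 1%N) =
      - (ysign F e * (hbar * (d i * a i i / 2%:R))) *: (x e i 0%N * x e i 0%N).
    apply: (scalerI (F0 1)); have := yrel_xx H e i i 0 0.
    rewrite -[2%:R]/(1 + 1 : F) !scalerDl !scale1r scaleNr -opprD -scalerDr => <-.
    by rewrite /rcomm; ncring R.
  by rewrite E; apply/adnilpZ/adnilpM.
elim: r => // r IH; apply: adnilp_rcomm.
have -> : rcomm (x e i 0%N) (x e i r.+1) = - rcomm (x e i r.+1) (x e i 0%N).
  by rewrite /rcomm opprB.
have := yrel_xx H e i i r 0; move/(canRL (subrK _)) => ->.
rewrite -scaleN1r; apply: adnilpZ; apply: adnilpD; last exact: adnilpR.
by apply/adnilpZ/adnilpD; apply: adnilpM.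
Qed.

Lemma adnilp_xi j r : nilp (xi j r).
Proof.
have sw y z : rcomm y z = - rcomm z y :> R by rewrite /rcomm opprB.
elim: r => [|r IH]; apply: adnilp_rcomm; rewrite sw -scaleN1r; apply: adnilpZ.
  by rewrite (yrel_xi0x H); apply/adnilpZ/adnilp_x.
have := yrel_xix H e j i r 0; move/(canRL (subrK _)) => ->.
apply: adnilpD; last exact: adnilpR IH (adnilp_x 1).
apply/adnilpZ/adnilpD; first exact: adnilpM IH (adnilp_x 0).
exact: adnilpM (adnilp_x 0) IH.
Qed.

Lemma serre_const (m : nat) (y z : R) :
  \sum_(p : {perm 'I_m}) foldr (fun k w => rcomm y w) z (enum 'I_m) =
  m`!%:R *: iter m (rcomm y) z.
Proof.
have E (l : seq 'I_m) : foldr (fun _ w => rcomm y w) z l = iter (size l) (rcomm y) z.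
  by elim: l => //= k l ->.
by rewrite sumr_const E size_enum_ord scaler_nat -[in RHS]card_Sn.
Qed.

Lemma fact_neq0 m : m`!%:R != 0 :> F.
Proof. by rewrite -(prednK (fact_gt0 m)) F0. Qed.

(** This is a Serre relation, all indices i having mode 0. *)
Lemma adnilp_xj j m r : i != j -> m%:R = 1 - a i j -> nilp (x e j r).
Proof.
move=> ij mE; exists m; apply: (scalerI (fact_neq0 m)).
by rewrite -serre_const scaler0 (yrel_serre H e (fun=> 0%N) r ij mE).
Qed.

End YangianNilpotent.

Section Normalized.
Context (F : fieldType) (I : finType).
Variables (hbar : F) (d : I -> F) (a : I -> I -> F).
Hypothesis two_neq0 : 2%:R != 0 :> F.

Definition xcoef (e : bool) (i j : I) : F := ysign F e * (hbar * (d i * a i j / 2%:R)).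

Lemma xcoefN e i j : xcoef (~~ e) i j = - xcoef e i j.
Proof. by rewrite /xcoef /ysign; case: e; rewrite /= ?mulN1r ?mul1r ?opprK. Qed.

Lemma xcoef2 e i j : xcoef e i j + xcoef e i j = hbar * (ysign F e * (d i * a i j)).
Proof. by rewrite /xcoef; field. Qed.

(** The coefficients of xi(u), the first of which is 1: with them the relation of
    xi_(i,0) with x becomes a case of the exchange relation. *)
Definition xiser (R : algType F) (xi : nat -> R) (r : nat) : R :=
  if r is r'.+1 then hbar *: xi r' else 1.

Section Rel.
Context (R : algType F) (x : bool -> I -> nat -> R) (xi : I -> nat -> R).

Lemma yrel_exdx (H : yangian_rel hbar d a x xi) e i j r s :
  exd (xcoef e i j) (x e i r) (x e i r.+1) (x e j s) (x e j s.+1) = 0.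
Proof. by rewrite /exd (yrel_xx H) subrr. Qed.

Lemma yrel_exdxi (H : yangian_rel hbar d a x xi) e i j r s :
  exd (xcoef e i j) (xi i r) (xi i r.+1) (x e j s) (x e j s.+1) = 0.
Proof. by rewrite /exd (yrel_xix H) subrr. Qed.

Lemma yrel_xi0 (H : yangian_rel hbar d a x xi) e i j s :
  hbar *: rcomm (xi i 0%N) (x e j s) = (xcoef e i j + xcoef e i j) *: x e j s.
Proof. by rewrite (yrel_xi0x H) scalerA xcoef2. Qed.

Lemma yrel_exdser (H : yangian_rel hbar d a x xi) e i j r s :
  exd (xcoef e i j) (xiser (xi i) r) (xiser (xi i) r.+1) (x e j s) (x e j s.+1) = 0.
Proof.
case: r => [|r] /=; last by rewrite exdZl yrel_exdxi // scaler0.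
transitivity (hbar *: rcomm (xi i 0%N) (x e j s) - (xcoef e i j + xcoef e i j) *: x e j s).
  by rewrite scalerDl /exd /rcomm; ncring R.
by rewrite yrel_xi0 // subrr.
Qed.

Hypothesis hbar_neq0 : hbar != 0.

Lemma exdser_xi0 e i j s :
    exd (xcoef e i j) (xiser (xi i) 0) (xiser (xi i) 1) (x e j s) (x e j s.+1) = 0 ->
  rcomm (xi i 0%N) (x e j s) = (ysign F e * (d i * a i j)) *: x e j s.
Proof.
move=> H; apply: (scalerI hbar_neq0); rewrite scalerA -xcoef2.
apply/subr0_eq; rewrite -[RHS]H scalerDl /exd /rcomm /=; ncring R.
Qed.

Lemma exdser_xi e i j r s :
    exd (xcoef e i j) (xiser (xi i) r.+1) (xiser (xi i) r.+2) (x e j s) (x e j s.+1) = 0 ->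
  rcomm (xi i r.+1) (x e j s) - rcomm (xi i r) (x e j s.+1) =
    xcoef e i j *: (xi i r * x e j s + x e j s * xi i r).
Proof.
by rewrite /= exdZl => /eqP; rewrite scaler_eq0 (negbTE hbar_neq0) => /eqP/subr0_eq.
Qed.

End Rel.
End Normalized.

(** * The coproduct on two commuting copies of the Yangian *)

Section Coproduct.
Context (F : fieldType) (I : finType).
Variables (hbar : F) (d : I -> F) (a : I -> I -> F).
Hypothesis two_neq0 : 2%:R != 0 :> F.
Hypothesis hbar_neq0 : hbar != 0.
Hypothesis da_sym : forall i j, d i * a i j = d j * a j i.

Context (A : algType F).
Variables (x1 x2 : bool -> I -> nat -> A) (xi1 xi2 : I -> nat -> A).
Hypothesis H1 : yangian_rel hbar d a x1 xi1.
Hypothesis H2 : yangian_rel hbar d a x2 xi2.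
Hypothesis x1x2 : forall e i r e' j s, GRing.comm (x1 e i r) (x2 e' j s).
Hypothesis x1xi2 : forall e i r j s, GRing.comm (x1 e i r) (xi2 j s).
Hypothesis xi1x2 : forall i r e j s, GRing.comm (xi1 i r) (x2 e j s).
Hypothesis xi1xi2 : forall i r j s, GRing.comm (xi1 i r) (xi2 j s).

Local Notation L := (laurent A : algType F).
Local Notation s := (@lvar A).
Local Notation "x %:L" := (lconst x) (at level 2, format "x %:L").
Local Notation xch := (xcoef hbar d a).

Definition kxx i e q p := kshift (fun q p => xi1 i q * x2 e i p) q p.
Definition kxy i e q p := kshift (fun q p => x1 e i q * xi2 i p) q p.

Lemma kxx_rec i e q p :
  s * kxx i e q p = kxx i e q p.+1 - kxx i e q.+1 p + (xi1 i q * x2 e i p)%:L.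
Proof. exact: kshift_rec. Qed.
Lemma kxy_rec i e q p :
  s * kxy i e q p = kxy i e q p.+1 - kxy i e q.+1 p + (x1 e i q * xi2 i p)%:L.
Proof. exact: kshift_rec. Qed.

(** The integrals of xi(v - s) (x) x^+(v) / (u - v) around the poles of x^+(v),
    and of x^-(v - s) (x) xi(v) / (u - v) around those of x^-(v - s).  The
    latter is written in the variable w = v - s, hence to be translated. *)
Definition cob e i r : L := (x2 e i r)%:L - hbar *: kxx i e 0 r.
Definition coc e i k : L := (x1 e i k)%:L + hbar *: kxy i e k 0.

Definition cox (e : bool) i r : L :=
  if e then trans s (fun k => (x1 e i k)%:L) r + cob e i r
  else trans s (coc e i) r + (x2 e i r)%:L.
(** xi(u - s) (x) 1 and the product xi(u - s) (x) xi(u). *)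
Definition coxi1 i r : L := trans s (fun k => (xi1 i k)%:L) r.
Definition coxi i r : L := coxi1 i r + (xi2 i r)%:L +
  hbar *: \sum_(k < r) coxi1 i k * (xi2 i (r - k.+1))%:L.

Lemma xch_sym e i j : xch e i j = xch e j i.
Proof. by rewrite /xcoef da_sym. Qed.

Lemma lconst_comm (y z : A) : GRing.comm y z -> GRing.comm y%:L z%:L.
Proof. by move=> yz; rewrite /GRing.comm -!rmorphM yz. Qed.

Lemma exd_const c (y y' z z' : A) :
  exd c y%:L y'%:L z%:L z'%:L = (exd c y y' z z')%:L.
Proof. by rewrite /exd /rcomm !rmorphB /= lconstZ rmorphD /= !rmorphM. Qed.

Lemma rcomm_comm (R : pzRingType) (y z : R) : GRing.comm y z -> rcomm y z = 0.
Proof. by move=> yz; rewrite /rcomm yz subrr. Qed.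

Lemma xi1C i j r t : GRing.comm (xi1 i r) (xi1 j t).
Proof. exact/subr0_eq/(yrel_xixi H1). Qed.
Lemma xi2C i j r t : GRing.comm (xi2 i r) (xi2 j t).
Proof. exact/subr0_eq/(yrel_xixi H2). Qed.

Lemma xi1_cob i r e j t : GRing.comm (xi1 i r)%:L (cob e j t).
Proof.
apply: commrB; first exact/lconst_comm/xi1x2.
rewrite /GRing.comm -scalerAl -scalerAr; congr (_ *: _); apply/commr_sym.
apply: kshift_comm => q p; apply/lconst_comm/commr_sym.
by apply: commrM; [apply: xi1C | apply: xi1x2].
Qed.

Lemma xi2_coc i r e j k : GRing.comm (xi2 i r)%:L (coc e j k).
Proof.
apply: commrD; first exact/lconst_comm/commr_sym/x1xi2.
rewrite /GRing.comm -scalerAl -scalerAr; congr (_ *: _); apply/commr_sym.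
apply: kshift_comm => q p; apply/lconst_comm/commr_sym.
by apply: commrM; [apply/commr_sym/x1xi2 | apply: xi2C].
Qed.

Lemma exd_commuting c (y y' z z' : L) :
    GRing.comm y z -> GRing.comm y' z -> GRing.comm y z' ->
  exd c y y' z z' = - (c + c) *: (z * y).
Proof.
move=> yz y'z yz'; rewrite /exd !rcomm_comm // subrr add0r yz scaleNr scalerDl; lring A.
Qed.

Lemma commDvar (x y z : L) : GRing.comm x y -> GRing.comm x z -> GRing.comm x (y + s * z).
Proof. by move=> xy xz; apply/commrD => //; apply/commrM => //; apply/commr_sym/lvarC. Qed.

(** The pairs x2, x1 and x2, x1 xi2 do not separately satisfy the relation.  The
    first one, being commuting, leaves - 2 c x1 x2; the second one leaves the
    boundary term of the kernel, which is [xi2_0, x2] x1 up to a factor. *)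
Lemma exd_x2_coc e e' i j r k :
  exd (xch e i j) (x2 e i r)%:L (x2 e i r.+1)%:L
    (coc e' j k) (coc e' j k.+1 + s * coc e' j k) = 0.
Proof.
have -> : coc e' j k.+1 + s * coc e' j k =
    ((x1 e' j k.+1)%:L + s * (x1 e' j k)%:L) +
    (hbar *: kxy j e' k 1 + hbar *: (x1 e' j k * xi2 j 0)%:L).
  rewrite /coc mulrDr -scalerAr kxy_rec.
  by lring A.
rewrite exdDr exd_commuting; last first.
- by apply: commDvar; apply/lconst_comm/commr_sym/x1x2.
- exact/lconst_comm/commr_sym/x1x2.
- exact/lconst_comm/commr_sym/x1x2.
rewrite -[hbar *: kxy j e' k 0]addr0 [X in _ + X = _]exdDr.
rewrite [X in _ + (X + _)]exd_sym exdZl exd_kshiftr => [|q' p]; last first.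
  rewrite exd_const exdMl; try exact: x1x2.
  by rewrite xch_sym (yrel_exdxi H2) // mulr0 lconst0.
rewrite scaler0 add0r [X in _ + X]exd_sym exd0l.
have -> : rcomm (hbar *: (x1 e' j k * xi2 j 0)%:L) (x2 e i r)%:L =
    (x1 e' j k)%:L * (hbar *: rcomm (xi2 j 0%N) (x2 e i r))%:L.
  rewrite lconstZ -lconst_rcomm lconstM /rcomm.
  have := lconst_comm (x1x2 e' j k e i r); rewrite /GRing.comm => yx.
  transitivity (hbar *: ((x1 e' j k)%:L * (xi2 j 0)%:L * (x2 e i r)%:L) -
    hbar *: ((x2 e i r)%:L * (x1 e' j k)%:L * (xi2 j 0)%:L)); first by lring A.
  by rewrite -yx; lring A.
rewrite (yrel_xi0 two_neq0 H2) // lconstZ -scalerAr xch_sym.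
by rewrite scaleNr addNr.
Qed.

Lemma exd_x1_cob e e' i j k r :
  exd (xch e i j) (x1 e i k)%:L ((x1 e i k.+1)%:L + s * (x1 e i k)%:L)
    (cob e' j r) (cob e' j r.+1) = 0.
Proof.
have -> : cob e' j r.+1 = (x2 e' j r.+1)%:L -
    ((hbar *: kxx j e' 1 r + s * (hbar *: kxx j e' 0 r)) -
      hbar *: (xi1 j 0 * x2 e' j r)%:L).
  rewrite /cob -scalerAr kxx_rec.
  by lring A.
rewrite exd_sym {1}/cob exdBl exd_sym exd_commuting; last first.
- exact/lconst_comm/x1x2.
- by apply/commr_sym/commDvar; apply/lconst_comm/commr_sym/x1x2.
- exact/lconst_comm/x1x2.
rewrite -[X in exd _ X]subr0 exdBl exd_shift; last exact: lvarC.
rewrite exdZl exd_kshiftl => [|q p]; last first.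
  rewrite exd_const exdMr; try exact/commr_sym/x1x2.
  by rewrite xch_sym (yrel_exdxi H1) // mul0r lconst0.
rewrite scaler0 sub0r opprK exd0l.
have -> : rcomm (hbar *: (xi1 j 0 * x2 e' j r)%:L) (x1 e i k)%:L =
    (hbar *: rcomm (xi1 j 0%N) (x1 e i k))%:L * (x2 e' j r)%:L.
  rewrite lconstZ -lconst_rcomm lconstM /rcomm.
  have := lconst_comm (x1x2 e i k e' j r); rewrite /GRing.comm => yx.
  transitivity (hbar *: ((xi1 j 0)%:L * ((x2 e' j r)%:L * (x1 e i k)%:L)) -
    hbar *: ((x1 e i k)%:L * (xi1 j 0)%:L * (x2 e' j r)%:L)); first by lring A.
  by rewrite -yx; lring A.
rewrite (yrel_xi0 two_neq0 H1) // lconstZ -scalerAl xch_sym.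
by rewrite scaleNr (lconst_comm (x1x2 _ _ _ _ _ _)) addNr.
Qed.

Lemma exd_cob e i j r t :
  exd (xch e i j) (cob e i r) (cob e i r.+1) (cob e j t) (cob e j t.+1) = 0.
Proof.
have xb i' j' p t' : exd (xch e i' j') (x2 e i' p)%:L (x2 e i' p.+1)%:L
    (cob e j' t') (cob e j' t'.+1) = 0.
  rewrite exd_sym /cob exdBl exd_const xch_sym (yrel_exdx H2) lconst0 sub0r.
  rewrite exdZl exd_kshiftr ?scaler0 ?oppr0 // => q l.
  rewrite exd_const exdMl; try exact: xi1x2.
  by rewrite (yrel_exdx H2) mulr0 lconst0.
rewrite {1 2}/cob exdBl xb sub0r exdZl exd_kshiftr ?scaler0 ?oppr0 // => q p.
by rewrite !lconstM exdMl ?xb ?mulr0 //; apply: xi1_cob.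
Qed.

Lemma exd_coc e i j r t :
  exd (xch e i j) (coc e i r) (coc e i r.+1) (coc e j t) (coc e j t.+1) = 0.
Proof.
have xb i' j' p t' : exd (xch e i' j') (x1 e i' p)%:L (x1 e i' p.+1)%:L
    (coc e j' t') (coc e j' t'.+1) = 0.
  rewrite exd_sym /coc exdDl exd_const xch_sym (yrel_exdx H1) lconst0 add0r.
  rewrite exdZl exd_kshiftl ?scaler0 // => q l.
  rewrite exd_const exdMr; try exact/commr_sym/x1xi2.
  by rewrite (yrel_exdx H1) mul0r lconst0.
rewrite {1 2}/coc exdDl xb add0r exdZl exd_kshiftl ?scaler0 // => q p.
by rewrite !lconstM exdMr ?xb ?mul0r //; apply: xi2_coc.
Qed.

Lemma cox_exd e i j r t :
  exd (xch e i j) (cox e i r) (cox e i r.+1) (cox e j t) (cox e j t.+1) = 0.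
Proof.
have sC := @lvarC A.
case: e; apply: exdDD.
- by apply: exd_trans2 => // k l; rewrite exd_const (yrel_exdx H1) lconst0.
- by apply: exd_trans => // k; apply: exd_x1_cob.
- by rewrite exd_sym; apply: exd_trans => // k; rewrite xch_sym; apply: exd_x1_cob.
- exact: exd_cob.
- by apply: exd_trans2 => // k l; apply: exd_coc.
- by apply: exd_trans => // k; rewrite exd_sym xch_sym; apply: exd_x2_coc.
- by rewrite exd_sym; apply: exd_trans => // k; rewrite exd_sym; apply: exd_x2_coc.
by rewrite exd_const (yrel_exdx H2) lconst0.
Qed.

(** * Images of xi, and their relations *)

Lemma coxi1_comm i r y : (forall k, GRing.comm (xi1 i k)%:L y) ->
  GRing.comm (coxi1 i r) y.
Proof. by move=> xy; apply: trans_comm => //; apply: lvarC. Qed.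

Lemma coxi_comm y i r : (forall k, GRing.comm y (xi1 i k)%:L) ->
  (forall k, GRing.comm y (xi2 i k)%:L) -> GRing.comm y (coxi i r).
Proof.
move=> y1 y2; have y1' k : GRing.comm y (coxi1 i k).
  by apply/commr_sym/coxi1_comm => ?; apply/commr_sym.
apply: commrD; first exact: commrD.
rewrite /GRing.comm -scalerAl -scalerAr; congr (_ *: _).
by rewrite mulr_sumr mulr_suml; apply: eq_bigr => k _; apply: commrM.
Qed.

Lemma coxi_coxi i j r t : rcomm (coxi i r) (coxi j t) = 0.
Proof.
apply: rcomm_comm; apply: coxi_comm => k; apply/commr_sym; apply: coxi_comm => l.
- exact/lconst_comm/xi1C.
- exact/lconst_comm/xi1xi2.
- exact/lconst_comm/commr_sym/xi1xi2.
exact/lconst_comm/xi2C.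
Qed.

Lemma xiser_coxi i r : xiser hbar (coxi i) r =
  \sum_(k < r.+1) xiser hbar (coxi1 i) k * (xiser hbar (xi2 i) (r - k)%N)%:L.
Proof.
case: r => [|r]; first by rewrite big_ord1 mul1r.
rewrite big_ord_recl big_ord_recr /= mul1r !add0n [X in (r.+1 - X)%N]add1n subnn.
rewrite mulr1 lconstZ /coxi !scalerDr -addrA [LHS]addrCA; congr (_ + _).
rewrite [LHS]addrC; congr (_ + _); rewrite scalerA scaler_sumr; apply: eq_bigr => k _.
have -> : (r.+1 - bump 0 k = (r - k.+1).+1)%N by have := ltn_ord k; rewrite /bump; lia.
by rewrite /= !add0n lconstZ -scalerAl -scalerAr scalerA.
Qed.

Lemma exd1 c (z x y y' : L) : exd c 1 z x y = exd c 1 z x y'.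
Proof. by rewrite /exd /rcomm; lring A. Qed.

Lemma exd_xiser1 e i j r k :
  exd (xch e i j) (xiser hbar (coxi1 i) r) (xiser hbar (coxi1 i) r.+1)
    (x1 e j k)%:L ((x1 e j k.+1)%:L + s * (x1 e j k)%:L) = 0.
Proof.
case: r => [|r] /=.
  rewrite (exd1 _ _ _ _ (x1 e j k.+1)%:L) -lconstZ -[1]/(1%:L) exd_const.
  by rewrite (yrel_exdser two_neq0 H1 e i j 0) lconst0.
rewrite exdZl exd_trans ?scaler0 // => [|l]; first exact: lvarC.
rewrite exd_shift; last exact: lvarC.
by rewrite exd_const (yrel_exdxi H1) lconst0.
Qed.

Lemma xiser_comm (z : nat -> A) k (y : L) : (forall k, GRing.comm (z k)%:L y) ->
  GRing.comm (xiser hbar z k)%:L y.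
Proof.
case: k => [|k] cy /=; first exact/commr_sym/commr1.
by rewrite lconstZ /GRing.comm -scalerAl -scalerAr cy.
Qed.
Lemma xiser_coxi1_comm i k (y : L) : (forall k, GRing.comm (xi1 i k)%:L y) ->
  GRing.comm (xiser hbar (coxi1 i) k) y.
Proof.
case: k => [|k] cy /=; first exact/commr_sym/commr1.
by rewrite /GRing.comm -scalerAl -scalerAr (coxi1_comm _ cy).
Qed.

(** The image of xi(u) is a product of two series, one of which commutes with b
    and b'. *)
Lemma exd_coxi_fst c i r (b b' : L) :
    (forall k, exd c (xiser hbar (coxi1 i) k) (xiser hbar (coxi1 i) k.+1) b b' = 0) ->
    (forall k, GRing.comm (xi2 i k)%:L b) -> (forall k, GRing.comm (xi2 i k)%:L b') ->
  exd c (xiser hbar (coxi i) r) (xiser hbar (coxi i) r.+1) b b' = 0.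
Proof.
move=> e1 c2 c2'; rewrite !xiser_coxi [X in exd _ _ X]big_ord_recl.
rewrite -[X in exd _ X]add0r exdDl mul1r exd0l rcomm_comm ?add0r.
  by apply: exd_suml => k; rewrite exdMr ?e1 ?mul0r //; apply: xiser_comm.
exact: xiser_comm.
Qed.

Lemma exd_coxi_snd c i r (b b' : L) :
    (forall k, exd c (xiser hbar (xi2 i) k)%:L (xiser hbar (xi2 i) k.+1)%:L b b' = 0) ->
    (forall k, GRing.comm (xi1 i k)%:L b) -> (forall k, GRing.comm (xi1 i k)%:L b') ->
  exd c (xiser hbar (coxi i) r) (xiser hbar (coxi i) r.+1) b b' = 0.
Proof.
move=> e2 c1 c1'; rewrite !xiser_coxi [X in exd _ _ X]big_ord_recr.
rewrite -[X in exd _ X]addr0 exdDl /= subnn mulr1 exd0l rcomm_comm ?addr0.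
  apply: exd_suml => k; rewrite exdMl ?subSn ?e2 ?mulr0 //; try exact: xiser_coxi1_comm.
  by rewrite -ltnS.
exact: (xiser_coxi1_comm r.+1).
Qed.

Lemma coxi_exd e i j r t :
  exd (xch e i j) (xiser hbar (coxi i) r) (xiser hbar (coxi i) r.+1)
    (cox e j t) (cox e j t.+1) = 0.
Proof.
have sC := @lvarC A.
have xA k l : exd (xch e i j) (xiser hbar (coxi i) k) (xiser hbar (coxi i) k.+1)
    (x1 e j l)%:L ((x1 e j l.+1)%:L + s * (x1 e j l)%:L) = 0.
  have x2C m l' : GRing.comm (xi2 i m)%:L (x1 e j l')%:L.
    exact/lconst_comm/commr_sym/x1xi2.
  by apply: exd_coxi_fst => [m|m|m]; [exact: exd_xiser1 | | apply: commDvar].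
have xB k l : exd (xch e i j) (xiser hbar (coxi i) k) (xiser hbar (coxi i) k.+1)
    (x2 e j l)%:L (x2 e j l.+1)%:L = 0.
  apply: exd_coxi_snd => m; try exact/lconst_comm/xi1x2.
  by rewrite exd_const (yrel_exdser two_neq0 H2) lconst0.
rewrite exd_sym; case: e xA xB => xA xB; rewrite exdDl.
  rewrite exd_trans // ?add0r => [|k]; last by rewrite exd_sym.
  rewrite exdBl exd_sym xB sub0r exdZl exd_kshiftr ?scaler0 ?oppr0 // => q p.
  have xi1C' k : GRing.comm (xi1 j q)%:L (xiser hbar (coxi i) k).
    case: k => [|k]; first exact: commr1.
    rewrite /GRing.comm /= -scalerAl -scalerAr coxi_comm // => l.
      exact/lconst_comm/xi1C.
    exact/lconst_comm/xi1xi2.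
  by rewrite !lconstM exdMl // exd_sym xB mulr0.
rewrite [X in _ + X]exd_sym xB addr0 exd_trans // => k; rewrite /coc mulrDr addrACA.
rewrite exdDl exd_sym xA add0r -scalerAr -scalerDr exdZl.
set b := xiser hbar (coxi i) r; set b' := xiser hbar (coxi i) r.+1.
rewrite -(subrK (s * b) b') exd_shift // exd_kshiftl ?scaler0 // => q p.
have xi2C' l : GRing.comm (xi2 j p)%:L (xiser hbar (coxi i) l).
  case: l => [|l]; first exact: commr1.
  rewrite /GRing.comm /= -scalerAl -scalerAr coxi_comm // => m.
    exact/lconst_comm/commr_sym/xi1xi2.
  exact/lconst_comm/xi2C.
have zb : GRing.comm (xi2 j p)%:L b by apply: xi2C'.
have zb' : GRing.comm (xi2 j p)%:L (b' - s * b).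
  by apply: commrB; [apply: xi2C' | apply: commrM; [apply/commr_sym/sC | ]].
rewrite !lconstM exdMr //.
by rewrite -(@exd_shift F L _ s _ _ _ _ sC) subrK exd_sym xA mul0r.
Qed.

(** * The relation between x^+ and x^- *)

(** By exchanging x^- with the two factors of x^+ in turn one finds that
    (w + s - v + c) annihilates this commutator. *)
Lemma cob_coc e i j r k : rcomm (cob e i r) (coc (~~ e) j k) = 0.
Proof.
pose c := xch e i j; pose C k := coc (~~ e) j k; pose X r := (x2 e i r)%:L.
pose Xi q := (xi1 i q)%:L; pose K q r := kxx i e q r.
have xC r' k' : exd c (X r') (X r'.+1) (C k') (C k'.+1 + s * C k') = 0.
  exact: exd_x2_coc.
have serC q k' : exd (- c) (xiser hbar (xi1 i) q)%:L (xiser hbar (xi1 i) q.+1)%:L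
    (C k') (C k'.+1) = 0.
  rewrite -xcoefN exd_sym exdDl exd_sym exd_const (yrel_exdser two_neq0 H1).
  rewrite lconst0 add0r exdZl exd_kshiftl ?scaler0 // => p p'.
  have sC q' : GRing.comm (xi2 j p') (xiser hbar (xi1 i) q').
    case: q' => [|q']; first exact: commr1.
    by rewrite /GRing.comm /= -scalerAl -scalerAr xi1xi2.
  rewrite exd_const exdMr //.
  by rewrite exd_sym (yrel_exdser two_neq0 H1) mul0r lconst0.
have xiC q k' : rcomm (Xi q.+1) (C k') - rcomm (Xi q) (C k'.+1) +
    c *: (Xi q * C k' + C k' * Xi q) = 0.
  have /eqP := serC q.+1 k'; rewrite /= !lconstZ exdZl scaler_eq0 (negbTE hbar_neq0).
  by rewrite /exd scaleNr opprK => /eqP.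
have xi0C k' : hbar *: rcomm (Xi 0%N) (C k') = - c *: C k' - c *: C k'.
  apply/subr0_eq; rewrite -[RHS](serC 0%N k') /exd !scaleNr /rcomm /Xi /= lconstZ.
  by rewrite -[1%:L]/(1 : L); lring A.
(* (u - v - c) [K(xi1 x2), C] = - [xi1, C] x2, with u and v the variables of x2
   and C: by the exchange relations of C with x2 and with xi1, whose constants
   are opposite, multiplying the difference of the sides by s only shifts q, p. *)
have KV k' q p : rcomm (K q p.+1) (C k') - rcomm (K q p) (C k'.+1 + s * C k') -
    c *: rcomm (K q p) (C k') + rcomm (Xi q) (C k') * X p = 0.
  have [N [CN C'N]] := lbound2 (C k') (C k'.+1 + s * C k').
  have XN (y : A) : lbounded y%:L 0 by apply: lbounded_const.
  move: q p; apply: (contraction2 (M := N)) => q p.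
    have KN q' p' : lbounded (K q' p') 0.
      by apply: lbounded_le (@kshift_bounded _ _ _ q' p').
    have rN (y z : L) : lbounded y 0 -> lbounded z N -> lbounded (rcomm y z) N.
      by move=> y0 zN; have := lboundedR y0 zN; rewrite add0r.
    apply: lboundedD.
      apply: lboundedB; last by apply: lboundedZ; apply: (rN (K q p) (C k')).
      apply: lboundedB; first exact: (rN (K q p.+1) (C k')).
      exact: (rN (K q p) _).
    have XM := lboundedM (rN (Xi q) (C k') (XN _) CN) (XN (x2 e i p)).
    by rewrite addr0 in XM.
  have sK q' p' : s * K q' p' = K q' p'.+1 - K q'.+1 p' + Xi q' * X p'.
    by rewrite /K kxx_rec lconstM.
  transitivity (rcomm (s * K q p.+1) (C k') - rcomm (s * K q p) (C k'.+1 + s * C k') -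
      c *: rcomm (s * K q p) (C k') + s * rcomm (Xi q) (C k') * X p).
    by rewrite /rcomm; lring A.
  rewrite !sK; apply/subr0_eq.
  transitivity (Xi q * exd c (X p) (X p.+1) (C k') (C k'.+1 + s * C k') +
    (rcomm (Xi q.+1) (C k') - rcomm (Xi q) (C k'.+1) +
    c *: (Xi q * C k' + C k' * Xi q)) * X p).
    by rewrite /exd /rcomm; lring A.
  by rewrite xC xiC mulr0 mul0r addr0.
(* In (u - v - c) [cob, C] the exchange relation of x2 with C leaves 2 c C x2,
   which is cancelled by the term with [hbar xi1_0, C] = - 2 c C. *)
have BC p k' : rcomm (cob e i p.+1) (C k') - rcomm (cob e i p) (C k'.+1 + s * C k') -
    c *: rcomm (cob e i p) (C k') = 0.
  transitivity (exd c (X p) (X p.+1) (C k') (C k'.+1 + s * C k') +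
      (c *: C k' + c *: C k') * X p + (hbar *: rcomm (Xi 0%N) (C k')) * X p -
      hbar *: (rcomm (K 0%N p.+1) (C k') - rcomm (K 0%N p) (C k'.+1 + s * C k') -
      c *: rcomm (K 0%N p) (C k') + rcomm (Xi 0%N) (C k') * X p)).
    by rewrite /cob -/(X _) -/(X _) -/(K _ _) -/(K _ _) /exd /rcomm; lring A.
  by rewrite xC KV xi0C !scaleNr; lring A.
have B0 p : lbounded (cob e i p) 0.
  apply: lboundedB; first exact: lbounded_const.
  by apply/lboundedZ/(lbounded_le _ (@kshift_bounded _ _ _ 0%N p)).
have C0 k' : lbounded (C k') 0.
  apply: lboundedD; first exact: lbounded_const.
  by apply/lboundedZ/(lbounded_le _ (@kshift_bounded _ _ _ k' 0%N)).
apply: (contraction (z := fun w : nat * nat => rcomm (cob e i w.1) (C w.2))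
  (M := 0) _ _ (r, k)).
  by move=> [p k']; apply: (lboundedR (B0 p) (C0 k')).
move=> N zN [p k'].
have E : rcomm (cob e i p.+1) (C k') - rcomm (cob e i p) (C k'.+1) -
    c *: rcomm (cob e i p) (C k') = s * rcomm (cob e i p) (C k').
  by apply/subr0_eq; rewrite -[RHS](BC p k') /rcomm; lring A.
suff : lbounded (s * rcomm (cob e i p) (C k') : L) N by [].
rewrite -E; apply: lboundedB; last by apply: lboundedZ; apply: (zN (p, k')).
by apply: lboundedB; [apply: (zN (p.+1, k')) | apply: (zN (p, k'.+1))].
Qed.

Definition kxi i q p := kshift (fun q p => xi1 i q * xi2 i p) q p.
Lemma kxi_rec i q p :
  s * kxi i q p = kxi i q p.+1 - kxi i q.+1 p + (xi1 i q)%:L * (xi2 i p)%:L.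
Proof. by rewrite /kxi kshift_rec lconstM. Qed.

(** The residues of v^r xi(v - s) (x) xi(v) at the poles of the two factors add
    up to the one at infinity, which is a finite sum. *)
Lemma trans_kxi i r p : trans s (fun k => kxi i k p) r - kxi i 0 (r + p) =
  \sum_(k < r) coxi1 i k * (xi2 i (r - k.+1 + p)%N)%:L.
Proof.
elim: r p => [|r IH] p; first by rewrite big_ord0 subrr.
rewrite transSr; last exact: lvarC.
rewrite (@eq_trans _ _ _ (fun k => kxi i k p.+1 + (xi1 i k)%:L * (xi2 i p)%:L));
  last by move=> k; rewrite kxi_rec; lring A.
rewrite transD transMr addrAC addSnnS IH big_ord_recr /= subnn add0n.
congr (_ + _); apply: eq_bigr => k _; congr (_ * (xi2 i _)%:L).
by have := ltn_ord k; lia.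
Qed.

Lemma rcomm_kshiftr y (g : nat -> nat -> A) q p :
  rcomm y%:L (kshift g q p) = kshift (fun q p => rcomm y (g q p)) q p.
Proof. by rewrite /kshift lkerB lkerMl lkerMr. Qed.
Lemma rcomm_kshiftl y (g : nat -> nat -> A) q p :
  rcomm (kshift g q p) y%:L = kshift (fun q p => rcomm (g q p) y) q p.
Proof. by rewrite /kshift lkerB lkerMl lkerMr. Qed.

Lemma rcomm_x1_coc i j k l : rcomm (x1 true i k)%:L (coc false j l) =
  if i == j then (xi1 i (k + l)%N)%:L + hbar *: kxi i (k + l) 0 else 0.
Proof.
rewrite /coc rcommDr lconst_rcomm (yrel_xpxm H1).
have -> : rcomm (x1 true i k)%:L (hbar *: kxy j false l 0) =
    hbar *: rcomm (x1 true i k)%:L (kxy j false l 0) by rewrite /rcomm; lring A.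
rewrite rcomm_kshiftr.
have E q p : rcomm (x1 true i k) (x1 false j q * xi2 j p) =
    (if i == j then xi1 i (k + q)%N else 0) * xi2 j p.
  rewrite -(yrel_xpxm H1) /rcomm mulrBl -!mulrA; congr (_ - _ * _).
  exact/esym/x1xi2.
rewrite (eq_kshift _ _ E); case: eqP => [<-|_].
  congr (_ + _ *: _); apply: eq_lker => q p.
  by congr (xi1 _ _ * _); lia.
rewrite (@eq_kshift _ _ _ (fun _ _ => 0)) => [|q p]; last exact: mul0r.
by rewrite kshift0 scaler0 addr0.
Qed.

Lemma rcomm_cob_x2 i j r t : rcomm (cob true i r) (x2 false j t)%:L =
  if i == j then (xi2 i (r + t)%N)%:L - hbar *: kxi i 0 (r + t) else 0.
Proof.
have -> : rcomm (cob true i r) (x2 false j t)%:L =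
    (rcomm (x2 true i r) (x2 false j t))%:L -
    hbar *: rcomm (kxx i true 0 r) (x2 false j t)%:L.
  by rewrite -lconst_rcomm /cob /rcomm; lring A.
rewrite (yrel_xpxm H2) rcomm_kshiftl.
have E q p : rcomm (xi1 i q * x2 true i p) (x2 false j t) =
    xi1 i q * (if i == j then xi2 i (p + t)%N else 0).
  rewrite -(yrel_xpxm H2) /rcomm mulrBr !mulrA; congr (_ - _ * _).
  exact/esym/xi1x2.
rewrite (eq_kshift _ _ E); case: eqP => _.
  congr (_ - _ *: _); apply: eq_lker => q p.
  by congr (_ * xi2 _ _); lia.
rewrite (@eq_kshift _ _ _ (fun _ _ => 0)) => [|q p]; last exact: mulr0.
by rewrite kshift0 scaler0 subr0.
Qed.

Lemma cox_xpxm i j r t :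
  rcomm (cox true i r) (cox false j t) = if i == j then coxi i (r + t)%N else 0.
Proof.
have sC := @lvarC A; rewrite /cox rcommDl !rcommDr.
rewrite (rcomm_trans sC (G := fun m => if i == j then (xi1 i m)%:L +
  hbar *: kxi i m 0 else 0)); last by move=> k l; rewrite rcomm_x1_coc.
rewrite [rcomm _ (x2 _ _ _)%:L]rcomm_comm ?add0r ?addr0; last first.
  by apply: trans_comm => // k; exact/lconst_comm/x1x2.
rewrite [rcomm (cob _ _ _) (trans _ _ _)]rcomm_comm ?add0r; last first.
  by apply/commr_sym/trans_comm => // k; apply/commr_sym/subr0_eq/cob_coc.
rewrite rcomm_cob_x2; case: eqP => _; last by rewrite trans0 addr0.
have := trans_kxi i (r + t) 0; rewrite addn0 => E.
rewrite transD -/(coxi1 i _) /coxi -!addrA; congr (_ + _).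
rewrite addrC -addrA; congr (_ + _).
rewrite (_ : trans s _ _ = hbar *: trans s (fun k => kxi i k 0) (r + t)).
  by rewrite addrC -scalerBr E; congr (_ *: _); apply: eq_bigr => k _; rewrite addn0.
rewrite -mulr_algl -transMl //; apply: eq_trans => k.
by rewrite mulr_algl.
Qed.

(** * The Serre relations *)

Hypothesis F0 : forall n, n.+1%:R != 0 :> F.
Hypothesis d_neq0 : forall i, d i != 0.
Hypothesis a_diag : forall i, a i i = 2%:R.

Lemma ysignK (e : bool) (c : F) : ysign F e * (ysign F e * c) = c.
Proof. by case: e; rewrite /= ?mul1r ?mulN1r ?opprK. Qed.

Lemma cox_bounded0 e i : lbounded (cox e i 0) 0.
Proof.
have K0 (f : L) : lbounded f (-1) -> lbounded f 0 by apply: lbounded_le.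
have C0 (y : A) : lbounded y%:L 0 by apply: lbounded_const.
case: e; rewrite /cox; apply: lboundedD.
- exact: C0.
- by apply: lboundedB => //; apply/lboundedZ/K0/kshift_bounded.
- by apply: lboundedD => //; apply/lboundedZ/K0/kshift_bounded.
exact: C0.
Qed.

Lemma cox_lead e i : cox e i 0 0 = x1 e i 0%N + x2 e i 0%N.
Proof.
have K0 g q p : kshift g q p (0 : int) = 0 :> A by apply: kshift_bounded.
case: e; rewrite /cox lcoefD; congr (_ + _).
  by rewrite /cob lcoefB lcoefZ K0 scaler0 subr0.
by rewrite [LHS]lcoefD lcoefZ K0 scaler0 addr0.
Qed.

Lemma coxi_0 i : coxi i 0 = (xi1 i 0%N + xi2 i 0%N)%:L.
Proof. by rewrite /coxi big_ord0 scaler0 addr0 raddfD. Qed.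

Lemma coxi0_cox e i j t :
  rcomm (coxi i 0) (cox e j t) = (ysign F e * (d i * a i j)) *: cox e j t.
Proof.
apply: (exdser_xi0 two_neq0 hbar_neq0 (x := cox)).
exact: (coxi_exd e i j 0 t).
Qed.

Lemma cox_opposite e i j r t : rcomm (cox e i r) (cox (~~ e) j t) =
  if i == j then ysign F e *: coxi i (r + t)%N else 0.
Proof.
case: e; first by rewrite cox_xpxm; case: eqP; rewrite ?scale1r.
have -> : rcomm (cox false i r) (cox true j t) = - rcomm (cox true j t) (cox false i r).
  by rewrite /rcomm opprB.
rewrite cox_xpxm eq_sym; case: eqP => [->|_]; last by rewrite oppr0.
by rewrite addnC scaleN1r.
Qed.

Lemma rcomm_sum_families (y1 y2 z1 z2 : A) :
    GRing.comm y1 z2 -> GRing.comm y2 z1 ->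
  rcomm (y1 + y2) (z1 + z2) = rcomm y1 z1 + rcomm y2 z2.
Proof.
move=> c12 c21; rewrite rcommDl !rcommDr (rcomm_comm c12) (rcomm_comm c21).
by rewrite addr0 add0r.
Qed.

Section Serre.
Variables (e : bool) (i j : I) (m : nat).
Hypothesis ij : i != j.
Hypothesis mE : m%:R = 1 - a i j.

Let e0 := x1 e i 0%N + x2 e i 0%N.

Let nilp1 y : adnilp (x1 e i 0%N) y -> GRing.comm (x2 e i 0%N) y -> adnilp e0 y.
Proof. by move=> ny yC; apply: adnilp_add => //; apply/commr_sym/x1x2. Qed.
Let nilp2 y : adnilp (x2 e i 0%N) y -> GRing.comm (x1 e i 0%N) y -> adnilp e0 y.
Proof. by move=> ny yC; rewrite /e0 addrC; apply: adnilp_add => //; apply/x1x2. Qed.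

Let adnilps_cox k t : (forall r, adnilp (x1 e i 0%N) (x1 e k r)) ->
  (forall r, adnilp (x2 e i 0%N) (x2 e k r)) -> adnilps e0 (cox e k t).
Proof.
move=> n1 n2.
have n1' r : adnilp e0 (x1 e k r) by apply: nilp1; rewrite // /GRing.comm x1x2.
have n2' r : adnilp e0 (x2 e k r) by apply: nilp2; rewrite // x1x2.
have nx1 r : adnilp e0 (xi1 k r).
  by apply: nilp1; [apply: (adnilp_xi F0 H1) | rewrite /GRing.comm xi1x2].
have nx2 r : adnilp e0 (xi2 k r).
  by apply: nilp2; [apply: (adnilp_xi F0 H2) | rewrite /GRing.comm x1xi2].
rewrite /cox; case: (e) n1' n2' => n1' n2'; apply: adnilpsD.
- by apply: adnilps_trans => q; apply: adnilps_const.
- apply: adnilpsB; first exact: adnilps_const.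
  by apply/adnilpsZ/adnilps_kshift => q p; apply: adnilpM.
- apply: adnilps_trans => q; apply: adnilpsD; first exact: adnilps_const.
  by apply/adnilpsZ/adnilps_kshift => q' p; apply: adnilpM.
exact: adnilps_const.
Qed.

(** X_j is a lowest weight vector of weight 1 - m for the copy of sl2 spanned by
    X_(i,0), X^-_(i,0) and xi_(i,0), so that ad(X_(i,0))^m X_j is again a lowest
    weight vector. *)
Lemma cox_serre0 t : iter m (rcomm (cox e i 0)) (cox e j t) = 0.
Proof.
pose E : L := cox e i 0; pose f : L := cox (~~ e) i 0.
pose h0 := ysign F e *: (xi1 i 0%N + xi2 i 0%N).
have hE : ysign F e *: coxi i 0 = h0%:L by rewrite coxi_0 -lconstZ.
have Ef : rcomm E f = h0%:L by rewrite cox_opposite eqxx addn0 hE.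
have dd : d i * a i i = d i + d i by rewrite a_diag mulr_natr mulr2n.
have hX k r : rcomm h0%:L (cox e k r) = (d i * a i k) *: cox e k r.
  by rewrite -hE rcommZl coxi0_cox scalerA ysignK.
have fv : rcomm f (cox e j t) = 0.
  by have := cox_opposite (~~ e) i j 0 t; rewrite negbK (negbTE ij).
have hv := hX j t; have hEE := hX i 0%N; rewrite dd in hEE.
apply: (@laurent_lowest_weight_eq0 _ _ e0 (x1 (~~ e) i 0%N + x2 (~~ e) i 0%N)
  h0 f _ (d i) m F0 (d_neq0 i)).
- rewrite rcomm_sum_families; try exact: x1x2; try exact/commr_sym/x1x2.
  rewrite /h0 scalerDr; case: (e) => /=; rewrite ?(yrel_xpxm H1) ?(yrel_xpxm H2) ?eqxx ?addn0 ?scale1r //.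
  have sw (y z : A) : rcomm y z = - rcomm z y by rewrite /rcomm opprB.
  by rewrite sw [rcomm (x2 _ _ _) _]sw (yrel_xpxm H1) (yrel_xpxm H2) eqxx !scaleN1r.
- rewrite /h0 rcommZl rcomm_sum_families; last 2 first.
  + exact: xi1x2.
  + exact/commr_sym/x1xi2.
  by rewrite (yrel_xi0x H1) (yrel_xi0x H2) -scalerDr scalerA ysignK dd.
- exact: cox_bounded0.
- exact: cox_lead.
- have := adn_weight hEE hv m; rewrite /adn => ->; congr (_ *: _).
  by rewrite -[m.+1%:R]natr1 mE; ring: (mE).
- case Em : m => [|n] //=.
  have := adn_lower Ef hEE hv fv n; rewrite /adn /= => ->.
  have -> : d i * a i j + n%:R * d i = 0; last by rewrite mulr0 oppr0 scale0r.
  have : n.+1%:R = 1 - a i j by rewrite -Em.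
  rewrite -natr1 => /(canRL (addrK _)) ->; ring.
elim: (m) => [|n IH] /=; last apply: adnilpsR => //; apply: adnilps_cox => r.
- apply: (adnilp_xj F0 H1 e _ ij mE).
- apply: (adnilp_xj F0 H2 e _ ij mE).
- exact: (adnilp_x F0 H1).
exact: (adnilp_x F0 H2).
Qed.

Lemma cox_serre (r : 'I_m -> nat) t : \sum_(p : {perm 'I_m})
  foldr (fun k y => rcomm (cox e i (r (p k))) y) (cox e j t) (enum 'I_m) = 0.
Proof.
have c0 : xch e i i != 0.
  rewrite /xcoef a_diag !mulf_neq0 ?invr_eq0 //.
  by case: (e); rewrite /= ?oppr_eq0 oner_eq0.
apply: (serre_reduction (A := L) F0 (alpha := xiser hbar (coxi i)) (x := cox e i)
  (z := cox e j) (c := xch e i i) (e := xch e i j)) => //.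
- case=> [|p] [|q] /=; rewrite /GRing.comm ?mul1r ?mulr1 //.
  rewrite -!scalerAl -!scalerAr; do 2!congr (_ *: _).
  exact/subr0_eq/coxi_coxi.
- by move=> p q; apply: coxi_exd.
- by move=> p q; apply: coxi_exd.
by move=> q; rewrite [LHS]serre_const cox_serre0 scaler0.
Qed.

End Serre.

Lemma cox_rel : yangian_rel hbar d a cox coxi.
Proof.
split=> [i j r t|e i j t|e i j r t|e i j r t|i j r t|e i j m r t ij mE].
- exact: coxi_coxi.
- exact: coxi0_cox.
- exact/(exdser_xi hbar_neq0 (x := cox))/(coxi_exd e i j r.+1 t).
- by have := cox_exd e i j r t; rewrite /exd => /subr0_eq.
- exact: cox_xpxm.
exact: cox_serre.
Qed.

End Coproduct.

(** * The substitution of s + a for s *)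

Lemma binz0 k : binz k 0 = 1.
Proof. by case: k => n; rewrite /binz ?bin0 // expr0 mul1r bin0. Qed.

Lemma binzS k j : binz (k + 1) j.+1 = binz k j.+1 + binz k j.
Proof.
case: k => [n|[|n]].
- by rewrite (_ : n%:Z + 1 = n.+1%:Z) /binz ?binS //; lia.
- by rewrite /= !add0n !binn exprS mulN1r !mulr1 addNr.
rewrite (_ : Negz n.+1 + 1 = Negz n) /binz; last by lia.
rewrite !addnS !addSn (binS (n + j).+1) PoszD exprS; ring.
Qed.

Lemma int_shift_const (T : Type) (f : int -> T) :
  (forall x, f (x + 1) = f x) -> forall x, f x = f 0.
Proof.
move=> fS [n|n].
  by elim: n => [|n <-] //; rewrite -(fS n); congr f; lia.
elim: n => [|n <-]; rewrite -fS; congr f; lia.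
Qed.

(** By induction on j the difference of the two sides is invariant under
    x -> x + 1, and it vanishes at x = 0. *)
Lemma binz_vandermonde x y j :
  \sum_(i < j.+1) binz x i * binz y (j - i)%N = binz (x + y) j.
Proof.
elim: j x => [|j IH] x; first by rewrite big_ord1 !binz0.
pose f x := \sum_(i < j.+2) binz x i * binz y (j.+1 - i)%N - binz (x + y) j.+1.
suff fS z : f (z + 1) = f z.
  apply/subr0_eq; rewrite -/(f x) (int_shift_const fS) /f add0r big_ord_recl.
  rewrite big1 ?addr0 => [|i _]; first by rewrite mul1r subn0 subrr.
  by rewrite /= mul0r.
have -> : f (z + 1) = f z + (\sum_(i < j.+1) binz z i * binz y (j - i)%N - binz (z + y) j).
  rewrite /f (_ : z + 1 + y = z + y + 1) ?binzS; last by ring.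
  rewrite big_ord_recl [in RHS]big_ord_recl !binz0.
  rewrite (eq_bigr (fun i : 'I_j.+1 => binz z i.+1 * binz y (j - i)%N +
    binz z i * binz y (j - i)%N)) => [|i _]; last by rewrite binzS mulrDl.
  by rewrite big_split /=; ring.
by rewrite IH subrr addr0.
Qed.

Section Translate.
Context (A : nzRingType).
Implicit Types f g : laurent A.

Lemma lhasse_subproof j f :
  `[< exists M, lbounded (fun m => f (m + j%:Z) *~ binz (m + j%:Z) j) M >].
Proof.
have [M fM] := lbound_ex f; apply/asboolP; exists M => k kM.
by rewrite fM ?mul0rz //; lia.
Qed.
(** The divided derivative of order j, which is the coefficient of a^j in
    f(s + a). *)
Definition lhasse j f : laurent A := Laurent (lhasse_subproof j f).

Lemma lhasse_bounded j f M : lbounded f M -> lbounded (lhasse j f) (M - j%:Z).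
Proof. by move=> fM k kM; rewrite /= fM ?mul0rz //; lia. Qed.

(** The Leibniz rule is the Vandermonde identity for each pair of monomials. *)
Lemma lhasseM j f g :
  lhasse j (f * g) = \sum_(i < j.+1) lhasse i f * lhasse (j - i)%N g.
Proof.
have [M fM] := lbound_ex f; have [N gN] := lbound_ex g.
apply: laurentP => m; rewrite lcoef_sum.
have bi (i : 'I_j.+1) : (i <= j)%N by rewrite -ltnS.
case: (ltP (M + N) (m + j%:Z)) => mB.
  rewrite (lhasse_bounded (lboundedM fM gN)); last by lia.
  rewrite big1 // => i _.
  apply: (lboundedM (lhasse_bounded fM) (lhasse_bounded gN)).
  by have := bi i; lia.
have kE : m + j%:Z = M + N - `|(M + N - (m + j%:Z))%R|%N%:Z by lia.
move: kE; set n := `|_|%N => kE.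
rewrite [LHS]/= (lmul_coefE fM gN kE) mulrz_suml.
rewrite (eq_bigr (fun i : 'I_j.+1 => \sum_(t < n.+1)
  lhasse i f (M - i%:Z - t%:Z) * lhasse (j - i)%N g (N - (j - i)%N%:Z - (n - t)%N%:Z))).
  rewrite exchange_big; apply: eq_bigr => t _ /=.
  have tn : (t <= n)%N by rewrite -ltnS.
  rewrite kE (_ : M + N - n%:Z = (M - t%:Z) + (N - (n - t)%N%:Z)); last by lia.
  rewrite -binz_vandermonde mulrz_sumr; apply: eq_bigr => i _.
  have -> : M - i%:Z - t%:Z + i%:Z = M - t%:Z by lia.
  have -> : N - (j - i)%N%:Z - (n - t)%N%:Z + (j - i)%N%:Z = N - (n - t)%N%:Z by lia.
  by rewrite mulrzAl mulrzAr mulrzA_C mulrzA.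
move=> i _; rewrite /= (@lmul_coefE _ _ _ (M - i%:Z) (N - (j - i)%N%:Z) _ n) //.
- exact: lhasse_bounded.
- exact: lhasse_bounded.
by have := bi i; lia.
Qed.

Lemma coef_ltranslate' f m j : (@ltranslate A f m)`_j = lhasse j f m.
Proof. exact: coef_ltranslate. Qed.

Lemma ltranslate_bounded' f M : lbounded f M -> lbounded (@ltranslate A f) M.
Proof.
move=> fM m mM; apply/polyP => j; rewrite coef_ltranslate coef0 fM ?mul0rz //.
by lia.
Qed.

Lemma ltranslate_is_zmod_morphism : zmod_morphism (@ltranslate A).
Proof.
move=> f g; apply: laurentP => m; rewrite lcoefB; apply/polyP => j.
by rewrite coefB !coef_ltranslate lcoefB mulrzBl.
Qed.
HB.instance Definition _ := GRing.isZmodMorphism.Build (laurent A)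
  (laurent {poly A}) (@ltranslate A) ltranslate_is_zmod_morphism.

Lemma ltranslate_const x : @ltranslate A (lconst x) = lconst x%:P.
Proof.
apply: laurentP => m; apply/polyP => j; rewrite coef_ltranslate /=.
case: (eqVneq m 0) => [->|m0].
  rewrite add0r coefC; case: j => [|j]; first by rewrite binz0.
  by rewrite mul0rz.
rewrite coef0; case: ifP => [/eqP mj|_]; last by rewrite mul0rz.
rewrite mj; case: j mj => [|j] mj; last by rewrite /= mulr0z.
by case/eqP: m0; rewrite -mj addr0.
Qed.

Lemma ltranslate_var : @ltranslate A lvar = lvar + lconst 'X :> laurent {poly A}.
Proof.
apply: laurentP => m; apply/polyP => j; rewrite coef_ltranslate lcoefD coefD /=.
case: (eqVneq (m + j%:Z) 1) => mj; last first.
  rewrite mul0rz; case: eqP => m1; case: eqP => m0; rewrite ?coef0 ?addr0 ?add0r //.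
  - by lia.
  - by rewrite coef1; case: eqP => // j0; case/eqP: mj; rewrite m1 j0.
  by rewrite coefX; case: eqP => // j0; case/eqP: mj; rewrite m0 j0.
rewrite mj; case: j mj => [|[|j]] mj.
- by rewrite (_ : m = 1) ?eqxx ?coef1 ?coef0 ?addr0 //; lia.
- by rewrite (_ : m = 0) ?coef0 ?coefX ?add0r //; lia.
rewrite /= mulr0z; case: eqP => m1; first by lia.
by case: eqP => m0; first lia; rewrite !coef0 addr0.
Qed.

Lemma ltranslate_is_monoid_morphism : monoid_morphism (@ltranslate A).
Proof.
split=> [|f g]; first exact: ltranslate_const.
have [M fM] := lbound_ex f; have [N gN] := lbound_ex g.
have fM' := ltranslate_bounded' fM; have gN' := ltranslate_bounded' gN.
apply: laurentP => m; apply/polyP => j; rewrite coef_ltranslate' lhasseM lcoef_sum.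
case: (ltP (M + N) m) => mB.
  rewrite (lboundedM fM' gN') // coef0 big1 // => i _.
  by rewrite (lboundedM (lhasse_bounded fM) (lhasse_bounded gN)) //; lia.
have kE : m = M + N - `|(M + N - m)%R|%N%:Z by lia.
move: kE; set n := `|_|%N => kE.
rewrite [in RHS]/= (lmul_coefE fM' gN' kE) coef_sum.
have hb i (h : laurent A) P : lbounded h P -> lbounded (lhasse i h) P.
  by move=> hP; apply: lbounded_le (lhasse_bounded hP); lia.
rewrite (eq_bigr (fun i : 'I_j.+1 => \sum_(t < n.+1)
  lhasse i f (M - t%:Z) * lhasse (j - i)%N g (N - (n - t)%N%:Z))); last first.
  by move=> i _; rewrite /= (lmul_coefE (hb _ _ _ fM) (hb _ _ _ gN) kE).
rewrite exchange_big; apply: eq_bigr => t _; rewrite coefM; apply: eq_bigr => i _.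
by rewrite !coef_ltranslate.
Qed.
HB.instance Definition _ := GRing.isMonoidMorphism.Build (laurent A)
  (laurent {poly A}) (@ltranslate A) ltranslate_is_monoid_morphism.

End Translate.

Section Extend.
Context (A B : nzRingType) (D : {rmorphism B -> laurent A}).

Lemma lconstXC (f : laurent {poly A}) : GRing.comm (lconst 'X) f.
Proof.
apply: laurentP => k; rewrite lcoef_constl lcoef_constr.
exact/esym/commr_polyX.
Qed.

Lemma lextend_comm : commr_rmorph (lmap (@polyC A) \o D) (lconst 'X).
Proof. by move=> x; apply: lconstXC. Qed.

Lemma lextendE p : lextend D p = horner_morph lextend_comm p.
Proof.
rewrite /horner_morph (horner_coef_wide _ (size_poly _ _)) /lextend.
apply: eq_bigr => j _; rewrite coef_map /= -rmorphXn; apply: laurentP => k.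
by rewrite lcoef_constr /= mul_polyC.
Qed.

Lemma lextend_is_zmod_morphism : zmod_morphism (lextend D).
Proof. by move=> p q; rewrite !lextendE rmorphB. Qed.
HB.instance Definition _ := GRing.isZmodMorphism.Build {poly B} (laurent {poly A})
  (lextend D) lextend_is_zmod_morphism.
Lemma lextend_is_monoid_morphism : monoid_morphism (lextend D).
Proof. by split=> [|p q]; rewrite !lextendE ?rmorph1 ?rmorphM. Qed.
HB.instance Definition _ := GRing.isMonoidMorphism.Build {poly B}
  (laurent {poly A}) (lextend D) lextend_is_monoid_morphism.
Lemma lextendX : lextend D 'X = lconst 'X.
Proof. by rewrite lextendE horner_morphX. Qed.
Lemma lextendC x : lextend D x%:P = lmap (@polyC A) (D x).
Proof. by rewrite lextendE horner_morphC. Qed.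

End Extend.

Section KernelTranslate.
Context (F : fieldType) (A : algType F).
Local Notation PA := (polyalg A : algType F).
Implicit Types y z : nat -> A.

(** The variable 'X of the polynomials is a. *)
Definition atrans y (r : nat) : polyalg A := trans ('X : {poly A}) (fun k => (y k)%:P) r.

Let aX : laurent PA := lconst 'X.
Let aXC (f : laurent PA) : GRing.comm aX f. Proof. exact: lconstXC. Qed.

Lemma lconst_atrans y r :
  lconst (atrans y r) = trans aX (fun k => lconst (y k)%:P) r :> laurent PA.
Proof. exact: rmorph_trans. Qed.

Let trans_aX_bounded (y : nat -> laurent PA) M r :
  (forall k, lbounded (y k) M) -> lbounded (trans aX y r) M.
Proof.
elim: r y => [|r IH] y yM; first exact: yM.
apply: lboundedD; first exact: IH.
by rewrite -[M]add0r; apply: lboundedM; [apply: lbounded_const | apply: IH].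
Qed.

(** Translating both variables by a does not affect w + s - v. *)
Lemma kshift_atrans2 (y z : nat -> A) q p :
  kshift (fun q p => atrans y q * atrans z p) q p =
  trans aX (fun k => trans aX (fun l =>
    lmap (@polyC A) (kshift (fun q p => y q * z p) k l) : laurent PA) p) q.
Proof.
pose K k l : laurent PA := lmap (@polyC A) (kshift (fun q p => y q * z p) k l).
apply/esym; move: q p; apply: (@kshift_unique _ _ _ _ (-1)) => q p.
  do 2!apply: trans_aX_bounded => ?.
  exact/lmap_bounded/kshift_bounded.
have sK k l : lvar * K k l = K k l.+1 - K k.+1 l + lconst (y k)%:P * lconst (z l)%:P.
  have := congr1 (lmap (@polyC A)) (kshift_rec (fun q p => y q * z p) k l).
  rewrite rmorphM rmorphD rmorphB /= lmap_var lmap_const /= polyCM => E.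
  by rewrite [LHS]E; congr (_ + _); apply: (rmorphM (@lconst {poly A})).
have sC := @lvarC PA.
have -> : lconst (atrans y q * atrans z p) = trans aX (fun k => trans aX (fun l =>
    lconst (y k)%:P * lconst (z l)%:P) p) q :> laurent PA.
  rewrite lconstM !lconst_atrans -transMr; apply: eq_trans => k.
  by rewrite -transMl.
rewrite -[LHS]transMl // [X in _ - X]transSr // -transB -transD.
apply: eq_trans => k; rewrite -transMl // transSr // -/(K _ _).
rewrite -[X in _ - X + _]transD -transB -transD -[LHS]transMl //.
apply: eq_trans => l; rewrite -/(K k l) sK.
by rewrite [in RHS]opprD [in RHS]addrACA subrr addr0.
Qed.

(** Translating w alone amounts to translating s. *)
Lemma kshift_atrans1 (y z : nat -> A) q p :
  kshift (fun q p => atrans y q * (z p)%:P : polyalg A) q p =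
  trans aX (fun k => @ltranslate A (kshift (fun q p => y q * z p) k p) : laurent PA) q.
Proof.
pose K k l : laurent PA := @ltranslate A (kshift (fun q p => y q * z p) k l).
apply/esym; move: q p; apply: (@kshift_unique _ _ _ _ (-1)) => q p.
  by apply: trans_aX_bounded => ?; apply/ltranslate_bounded'/kshift_bounded.
have sK k l : (lvar + aX) * K k l = K k l.+1 - K k.+1 l + lconst (y k)%:P * lconst (z l)%:P.
  have := congr1 (@ltranslate A) (kshift_rec (fun q p => y q * z p) k l).
  rewrite rmorphM rmorphD rmorphB /= ltranslate_var ltranslate_const /= polyCM => E.
  by rewrite [LHS]E; congr (_ + _); apply: (rmorphM (@lconst {poly A})).
have sC := @lvarC PA.
have -> : lconst (atrans y q * (z p)%:P : polyalg A) =
    trans aX (fun k => lconst (y k)%:P * lconst (z p)%:P) q :> laurent PA.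
  by rewrite lconstM lconst_atrans -transMr.
rewrite -[LHS]transMl // [X in _ - X]transSr // -transB -transD.
apply: eq_trans => k; rewrite -/(K _ _) -/(K _ _) -/(K _ _).
have := sK k p; rewrite mulrDl => /(canRL (addrK _)) ->.
by rewrite opprD addrAC addrA.
Qed.

End KernelTranslate.

(** * The deformed Drinfeld coproduct of the Yangian *)

Section YangianTools.
Context (F : fieldType) (I : finType).
Variables (hbar : F) (d : I -> F) (a : I -> I -> F).
Local Notation Y := (yangian hbar d a).

Lemma yangian_rel_map (R S : algType F) (h : {lrmorphism R -> S}) x xi :
    yangian_rel hbar d a x xi ->
  yangian_rel hbar d a (fun e i r => h (x e i r)) (fun i r => h (xi i r)).
Proof.
have hR y z : rcomm (h y) (h z) = h (rcomm y z) by rewrite (rmorph_rcomm h).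
move=> H; split=> [i j r s|e i j s|e i j r s|e i j r s|i j r s|e i j m r s ij mE].
- by rewrite hR (yrel_xixi H) rmorph0.
- by rewrite hR (yrel_xi0x H) linearZ.
- by rewrite !hR -(rmorphB h) (yrel_xix H) /= linearZ /= (rmorphD h) !(rmorphM h).
- by rewrite !hR -(rmorphB h) (yrel_xx H) /= linearZ /= (rmorphD h) !(rmorphM h).
- by rewrite hR (yrel_xpxm H); case: eqP; rewrite ?rmorph0.
have := congr1 h (yrel_serre H e r s ij mE); rewrite rmorph0 rmorph_sum => E.
rewrite -[RHS]E; apply: eq_bigr => p _.
by elim: (enum _) => //= k l ->; rewrite hR.
Qed.

(** The elements xi are commutators of the elements x, which therefore generate
    the Yangian. *)
Lemma yangian_rmorph_ext (S : nzRingType) (f g : {rmorphism Y -> S}) :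
    (forall c : F, f c%:A = g c%:A) ->
    (forall e i r, f (yX hbar d a e i r) = g (yX hbar d a e i r)) ->
  f =1 g.
Proof.
move=> fgc fgX; apply: yangian_ind => // [i r|y z fy fz|y z fy fz].
- have E : yXi hbar d a i r = rcomm (yX hbar d a true i 0) (yX hbar d a false i r).
    by rewrite (yrel_xpxm (yangian_relP hbar d a)) eqxx.
  by rewrite E (rmorph_rcomm f) (rmorph_rcomm g) !fgX.
- by rewrite !rmorphD fy fz.
by rewrite !rmorphM fy fz.
Qed.

End YangianTools.

Section LogCoefficients.
Context (F : fieldType) (S : algType F).
Hypothesis F0 : forall n, n.+1%:R != 0 :> F.

(** The coefficient of 'X^(r+1) in log (1 + p), if p has no constant term. *)
Definition logcoef (p : {poly S}) (r : nat) : S :=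
  \sum_(1 <= n < r.+2) ((-1) ^+ n.-1 / n%:R) *: (p ^+ n)`_(r.+1).

(** The derivative of p^n / n is p^(n-1) p'. *)
Lemma logcoef_dlog (p : {poly S}) r : GRing.comm p p^`() ->
  r.+1%:R *: logcoef p r = (dlog r.+1 p)`_r.
Proof.
move=> pC; rewrite /dlog mulr_suml coef_sum /logcoef big_add1 big_mkord scaler_sumr.
apply: eq_bigr => n _; rewrite /= scalerA mulrC -scalerA scaler_nat -coef_deriv.
rewrite deriv_exp_comm // coefMn /= -scaler_nat scalerA divfK //.
rewrite -(signr_odd F); have -> : (- p) ^+ n = (-1) ^+ odd n * p ^+ n.
  by rewrite [LHS]exprNn; congr (_ * _); rewrite signr_odd.
case: (odd n); last by rewrite !expr0 scale1r mul1r.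
by rewrite !expr1 scaleN1r mulN1r mulNr coefN.
Qed.

End LogCoefficients.

Section YangianCoproduct.
Context (F : fieldType) (I : finType).
Variables (hbar : F) (d : I -> F) (a : I -> I -> F).
Hypothesis F0 : forall n, n.+1%:R != 0 :> F.
Hypothesis hbar_neq0 : hbar != 0.
Hypothesis da_sym : forall i j, d i * a i j = d j * a j i.
Hypothesis d_neq0 : forall i, d i != 0.
Hypothesis a_diag : forall i, a i i = 2%:R.

Local Notation Y := (yangian hbar d a).
Local Notation Y2 := (yangian2 hbar d a : algType F).
Local Notation L := (laurent Y2 : algType F).
Local Notation yx := (yX hbar d a).
Local Notation yxi := (yXi hbar d a).
Local Notation x1 := (fun e i r => tensl (yx e i r) : Y2).
Local Notation x2 := (fun e i r => tensr (yx e i r) : Y2).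
Local Notation xi1 := (fun i r => tensl (yxi i r) : Y2).
Local Notation xi2 := (fun i r => tensr (yxi i r) : Y2).
Local Notation X := (cox hbar x1 x2 xi1 xi2).
Local Notation Xi := (coxi hbar xi1 xi2).

Lemma tensl_tensr (y z : Y) : (tensl y : Y2) * tensr z = tens y z.
Proof. by rewrite /tensl /tensr [LHS]tensM mulr1 mul1r. Qed.

Lemma tensl_comm (y z : Y) : GRing.comm (tensl y : Y2) (tensr z).
Proof.
by rewrite /GRing.comm tensl_tensr /tensl /tensr [RHS]tensM mulr1 mul1r.
Qed.

Lemma yangian2_cox_rel : yangian_rel hbar d a X Xi.
Proof.
apply: (cox_rel (F0 1) hbar_neq0 da_sym _ _ _ _ _ _ F0 d_neq0 a_diag).
- exact: (yangian_rel_map (@tensl F I hbar d a) (yangian_relP hbar d a)).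
- exact: (yangian_rel_map (@tensr F I hbar d a) (yangian_relP hbar d a)).
- by move=> *; apply: tensl_comm.
- by move=> *; apply: tensl_comm.
- by move=> *; apply: tensl_comm.
by move=> *; apply: tensl_comm.
Qed.

Definition ddelta : Y -> L := ylift yangian2_cox_rel.
HB.instance Definition _ := GRing.LRMorphism.on ddelta.

Lemma ddeltaX e i r : ddelta (yx e i r) = X e i r.
Proof. exact: yliftX. Qed.
Lemma ddeltaXi i r : ddelta (yxi i r) = Xi i r.
Proof. exact: yliftXi. Qed.

(** The algebra morphism y |-> tau_s(y) (x) 1. *)
Definition yfst (y : Y) : L := lpoly (map_poly (@tensl F I hbar d a) (ytau y)).
Definition ysnd (y : Y) : L := lconst (tensr y : Y2).

Lemma yfst_is_zmod_morphism : zmod_morphism yfst.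
Proof. by move=> y z; rewrite /yfst !rmorphB. Qed.
HB.instance Definition _ := GRing.isZmodMorphism.Build Y L yfst yfst_is_zmod_morphism.
Lemma yfst_is_monoid_morphism : monoid_morphism yfst.
Proof. by split=> [|y z]; rewrite /yfst ?rmorph1 // !rmorphM. Qed.
HB.instance Definition _ := GRing.isMonoidMorphism.Build Y L yfst yfst_is_monoid_morphism.
Lemma yfst_is_scalable : scalable yfst.
Proof.
move=> c y; rewrite -mulr_algl rmorphM -[RHS]mulr_algl; congr (_ * _).
rewrite -[LHS]/(yfst _) /yfst linearZ /= rmorph1 polyalgZE mulr1 map_polyC /=.
rewrite lpolyC linearZ /=.
by rewrite rmorph1 lconstZ.
Qed.
HB.instance Definition _ := GRing.isScalable.Build F Y L *:%R yfst yfst_is_scalable.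
HB.instance Definition _ := GRing.LRMorphism.on yfst.

HB.instance Definition _ := GRing.LRMorphism.copy ysnd (@lconst Y2 \o @tensr F I hbar d a).

Lemma yfst_shift (y : nat -> Y) (z : Y) r : ytau z = shiftp y r ->
  yfst z = trans lvar (fun k => lconst (tensl (y k) : Y2)) r.
Proof.
move=> E; rewrite /yfst E.
have fX : (@lpoly Y2 \o map_poly (@tensl F I hbar d a)) 'X = lvar.
  by rewrite /= map_polyX lpolyX.
rewrite [LHS](trans_shiftp (@lvarC Y2) _ _ fX).
by apply: eq_trans => k; rewrite /= map_polyC lpolyC.
Qed.

Lemma yfstX e i r : yfst (yx e i r) = trans lvar (fun k => lconst (x1 e i k)) r.
Proof. exact/yfst_shift/ytauX. Qed.
Lemma yfstXi i r : yfst (yxi i r) = coxi1 xi1 i r.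
Proof. exact/yfst_shift/ytauXi. Qed.

(** * The formula for t *)

Lemma yt_map (S : algType F) (f : {lrmorphism Y -> S}) i r :
  f (yt hbar d a i r) = hbar^-1 *: logcoef (map_poly f (xi_poly hbar d a i r)) r.
Proof.
rewrite /yt linearZ linear_sum /=; congr (_ *: _); apply: eq_bigr => n _.
by rewrite linearZ /= -rmorphXn coef_map.
Qed.

Lemma coef_xi_poly (S : algType F) (f : {lrmorphism Y -> S}) i r k : (k <= r.+1)%N ->
  (1 + map_poly f (xi_poly hbar d a i r))`_k = xiser hbar (fun r => f (yxi i r)) k.
Proof.
move=> kr; rewrite coefD coef_map coef1 /xi_poly coef_sum /=; case: k kr => [|k] kr.
  rewrite big1 => [|j _]; first by rewrite rmorph0 addr0.
  by rewrite coefZ coefXn mulr0.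
rewrite add0r /= (bigD1 (Ordinal kr)) //= big1 ?addr0 => [|j jk].
  by rewrite coefZ coefXn eqxx mulr1 linearZ.
rewrite coefZ coefXn eqSS; case: eqP => [E|_]; last by rewrite mulr0.
by case/eqP: jk; apply: val_inj.
Qed.

Lemma coef_xi_poly0 (S : algType F) (f : {lrmorphism Y -> S}) i r :
  (map_poly f (xi_poly hbar d a i r))`_0 = 0.
Proof.
apply: (addrI (1 : S)); rewrite addr0 -[RHS](coef_xi_poly f i (leq0n r.+1)).
by rewrite coefD coef1.
Qed.

Lemma map_xi_polyC (S : algType F) (f g : {lrmorphism Y -> S}) i r j k :
    (forall p q, GRing.comm (f (yxi i p)) (g (yxi i q))) ->
  GRing.comm (map_poly f (xi_poly hbar d a i r))`_j (map_poly g (xi_poly hbar d a i r))`_k.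
Proof.
move=> fg; rewrite !coef_map /= /xi_poly !coef_sum !rmorph_sum /=.
apply: commr_sum => q _; apply/commr_sym/commr_sum => p _; apply/commr_sym.
rewrite !coefZ !coefXn; case: eqP => _; case: eqP => _;
  rewrite ?mulr0 ?rmorph0 ?mulr1; do ?[exact: commr0 | exact/commr_sym/commr0].
by rewrite !linearZ /GRing.comm /= -!scalerAl -!scalerAr fg scalerA mulrC -scalerA.
Qed.

(** The image of xi(u) is the product of its commuting images in the two factors,
    so the logarithms add up; they are compared through their derivatives. *)
Lemma ddelta_yt i r : ddelta (yt hbar d a i r) = primitive (yt hbar d a i r).
Proof.
rewrite /primitive -/(yfst _) -/(ysnd _) !yt_map -scalerDr; congr (_ *: _).
set w := map_poly ddelta _; set p := map_poly yfst _; set q := map_poly ysnd _.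
have xiC u v : GRing.comm (yxi i u) (yxi i v).
  exact/subr0_eq/(yrel_xixi (yangian_relP hbar d a)).
have polC (f g : {lrmorphism Y -> L}) j k :
    (forall u v, GRing.comm (f (yxi i u)) (g (yxi i v))) ->
    GRing.comm (map_poly f (xi_poly hbar d a i r))`_j
      ((map_poly g (xi_poly hbar d a i r))^`())`_k.
  by move=> fg; rewrite coef_deriv; apply: commrMn; apply: map_xi_polyC.
have fC (f : {lrmorphism Y -> L}) u v : GRing.comm (f (yxi i u)) (f (yxi i v)).
  by rewrite /GRing.comm -!rmorphM xiC.
have pqC u v : GRing.comm (yfst (yxi i u)) (ysnd (yxi i v)).
  rewrite yfstXi; apply: coxi1_comm => k; apply: lconst_comm.
  exact: tensl_comm.
have wC : GRing.comm w w^`() by apply: comm_poly_coef => j k; apply/polC/fC.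
have pC : GRing.comm p p^`() by apply: comm_poly_coef => j k; apply/polC/fC.
have qC : GRing.comm q q^`() by apply: comm_poly_coef => j k; apply/polC/fC.
apply: (scalerI (F0 r)); rewrite scalerDr !logcoef_dlog // -coefD.
apply: dlog_mul => //; try exact: coef_xi_poly0.
- by apply: comm_poly_coef => j k; apply/map_xi_polyC/pqC.
- by apply: comm_poly_coef => j k; apply/polC/pqC.
move=> k kr; rewrite coefM coef_xi_poly //.
transitivity (xiser hbar (Xi i) k).
  by case: k kr => [|k] kr //=; rewrite ddeltaXi.
rewrite (xiser_coxi (F0 1) hbar_neq0); apply: eq_bigr => j _.
have jk : (j <= r.+1)%N by have := ltn_ord j; lia.
have jk' : (k - j <= r.+1)%N by lia.
rewrite !coef_xi_poly //; congr (_ * _).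
  by case: (nat_of_ord j) => [|m] //=; rewrite yfstXi.
by case: (k - j)%N => [|m] //=; rewrite lconstZ.
Qed.

(** * The formulae for x *)

Lemma lvarX_series (n : nat) (M : int) (c : nat -> Y2) :
  lvar ^+ n * lseries M c = lseries (M + n%:Z) c :> L.
Proof.
elim: n M => [|n IH] M; first by rewrite mul1r addr0.
rewrite exprSr -mulrA (_ : lvar * lseries M c = lseries (M + 1) c).
  by rewrite IH; congr lseries; lia.
by apply: laurentP => k; rewrite lcoef_varl /=; congr (if _ is Posz n then _ else _); lia.
Qed.

Lemma drinfeld_xp i r : primitive (yx true i r) +
    hbar *: lseries (-1) (fun N => \sum_(n < N.+1)
      ((-1) ^+ n.+1 * 'C(N, n)%:R) *: tens (yxi i n) (yx true i (r + N - n)%N)) =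
  X true i r.
Proof.
rewrite /primitive -/(yfst _) yfstX -addrA; congr (_ + (_ + _)).
rewrite -scalerN; congr (_ *: _); apply: laurentP => k; rewrite lcoefN /=.
case: (-1 - k) => [N|N]; last by rewrite oppr0.
rewrite -sumrN; apply: eq_bigr => n _.
rewrite exprS mulN1r mulNr scaleNr tensl_tensr.
by congr (- (_ *: tens (yxi i _) (yx true i _))); have := ltn_ord n; lia.
Qed.

Lemma drinfeld_xm i r : primitive (yx false i r) +
    hbar *: \sum_(k < r.+1) lseries (r%:Z - k%:Z - 1) (fun N => \sum_(n < N.+1)
      ((-1) ^+ n * ('C(N, n) * 'C(r, k))%N%:R) *:
        tens (yx false i (n + k)%N) (yxi i (N - n)%N)) =
  X false i r.
Proof.
rewrite /primitive -/(yfst _) yfstX -addrA addrCA addrC /cox; congr (_ + _).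
rewrite /coc transD; congr (_ + _).
rewrite (@eq_trans _ _ _ (fun k => hbar%:A * kxy x1 xi2 i false k 0)); last first.
  by move=> k; rewrite mulr_algl.
rewrite transMl; last by move=> f; apply: lvarC.
rewrite mulr_algl transE; congr (_ *: _); apply: eq_bigr => k _.
rewrite /kxy /kshift /lker lvarX_series.
have -> : -1 + (r - k)%N%:Z = r%:Z - k%:Z - 1 by have := ltn_ord k; lia.
apply: laurentP => p; rewrite lcoefMn /=; case: (_ - p) => [N|N]; last by rewrite mul0rn.
rewrite -sumrMnl; apply: eq_bigr => n _.
rewrite tensl_tensr addn0 -scaler_nat scalerA natrM mulrA.
by congr (_ *: _); rewrite [RHS]mulrC.
Qed.

Lemma ddelta_drinfeld : deformed_drinfeld ddelta.
Proof.
split=> i r; first exact: ddelta_yt.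
- by rewrite [LHS]ddeltaX -drinfeld_xp.
by rewrite [LHS]ddeltaX -drinfeld_xm.
Qed.

Lemma drinfeld_unique (D : {lrmorphism Y -> laurent Y2}) :
  deformed_drinfeld D -> D =1 ddelta.
Proof.
move=> DD; apply: yangian_rmorph_ext => [c|[] i r].
- by rewrite /= !linearZ /= !rmorph1.
- by rewrite [LHS](ddrinfeld_xp DD) drinfeld_xp [RHS]ddeltaX.
by rewrite [LHS](ddrinfeld_xm DD) drinfeld_xm [RHS]ddeltaX.
Qed.

End YangianCoproduct.

(** * Naturality of the coproduct formulae *)

Section LinearMaps.
Context (F : fieldType) (A B : algType F) (h : {lrmorphism A -> B}).

Lemma lmapZ (c : F) (f : laurent A) : lmap h (c *: f) = c *: lmap h f.
Proof. by apply: laurentP => k; rewrite lcoefZ /= linearZ. Qed.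

Lemma lmap_kshift (g : nat -> nat -> A) q p :
  lmap h (kshift g q p) = kshift (fun i j => h (g i j)) q p.
Proof. by apply: lker_morph => c i j; rewrite /= linearZ. Qed.

Context (I : finType) (hbar : F).
Variables (x1 x2 : bool -> I -> nat -> A) (xi1 xi2 : I -> nat -> A).

Lemma lmap_cox e i r : lmap h (cox hbar x1 x2 xi1 xi2 e i r) =
  cox hbar (fun e i r => h (x1 e i r)) (fun e i r => h (x2 e i r))
    (fun i r => h (xi1 i r)) (fun i r => h (xi2 i r)) e i r.
Proof.
have hK g g' q p : (forall i j, h (g i j) = g' i j) ->
    lmap h (hbar *: kshift g q p) = hbar *: kshift g' q p.
  by move=> gg; rewrite lmapZ lmap_kshift; congr (_ *: _); apply: eq_kshift.
rewrite /cox; case: e; rewrite rmorphD rmorph_trans /= lmap_var; congr (_ + _).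
- by apply: eq_trans => k; rewrite lmap_const.
- by rewrite rmorphB /= lmap_const; congr (_ - _); apply: hK => q p; rewrite rmorphM.
- apply: eq_trans => k; rewrite /coc rmorphD /= lmap_const; congr (_ + _).
  by apply: hK => q p; rewrite rmorphM.
exact: lmap_const.
Qed.

End LinearMaps.

Section PolynomialTranslates.
Context (F : fieldType) (A : algType F).
Local Notation PA := (polyalg A : algType F).

Definition polyalgC (x : A) : polyalg A := x%:P.
HB.instance Definition _ := GRing.RMorphism.copy polyalgC (@polyC A).
Lemma polyalgC_is_scalable : scalable polyalgC.
Proof. by move=> c x; rewrite /polyalgC polyalgCZ. Qed.
HB.instance Definition _ :=
  GRing.isScalable.Build F A (polyalg A) *:%R polyalgC polyalgC_is_scalable.
HB.instance Definition _ := GRing.LRMorphism.on polyalgC.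

Context (I : finType) (hbar : F).
Variables (x1 x2 : bool -> I -> nat -> A) (xi1 xi2 : I -> nat -> A).

Let aX : laurent PA := lconst 'X.
Let aXC (f : laurent PA) : GRing.comm aX f. Proof. exact: lconstXC. Qed.
Let sC := @lvarC PA.

Lemma trans_lconst_atrans (y : nat -> A) r :
  trans lvar (fun k => lconst (atrans y k)) r =
  trans aX (fun k => trans lvar (fun l => lconst (polyalgC (y l))) k) r :> laurent PA.
Proof.
rewrite (eq_trans _ _ (lconst_atrans y)) !trans_trans //.
by congr trans; apply: addrC.
Qed.

Lemma cox_atrans2 e i r :
  cox hbar (fun e i => atrans (x1 e i)) (fun e i => atrans (x2 e i))
    (fun i => atrans (xi1 i)) (fun i => atrans (xi2 i)) e i r =
  trans aX (fun k => lmap polyalgC (cox hbar x1 x2 xi1 xi2 e i k)) r.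
Proof.
rewrite (eq_trans _ _ (lmap_cox polyalgC hbar x1 x2 xi1 xi2 e i)) /cox.
case: e; rewrite transD; congr (_ + _).
- exact: trans_lconst_atrans.
- rewrite /cob transB lconst_atrans transZ; congr (_ - _ *: _).
  rewrite /kxx kshift_atrans2 /=; apply: eq_trans => k.
  by apply: etrans (lmap_kshift polyalgC _ _ _) _; apply: eq_kshift => *; apply: polyCM.
- rewrite trans_trans // (addrC aX) -trans_trans //; apply: eq_trans => k.
  rewrite /coc transD lconst_atrans transZ; congr (_ + _ *: _).
  rewrite /kxy kshift_atrans2 /=; apply: eq_trans => l.
  by apply: etrans (lmap_kshift polyalgC _ _ _) _; apply: eq_kshift => *; apply: polyCM.
exact: lconst_atrans.
Qed.

Lemma ltranslateZ (c : F) (f : laurent A) :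
  @ltranslate A (c *: f) = c *: (@ltranslate A f : laurent PA).
Proof.
apply: laurentP => m; rewrite lcoefZ; apply/polyP => j.
by rewrite coef_polyalgZ !coef_ltranslate lcoefZ scalerMzr.
Qed.

Lemma cox_atrans1 e i r :
  cox hbar (fun e i => atrans (x1 e i)) (fun e i r => polyalgC (x2 e i r))
    (fun i => atrans (xi1 i)) (fun i r => polyalgC (xi2 i r)) e i r =
  @ltranslate A (cox hbar x1 x2 xi1 xi2 e i r).
Proof.
have trl (y : nat -> laurent A) k : @ltranslate A (trans lvar y k) =
    trans (lvar + aX) (fun l => @ltranslate A (y l)) k :> laurent PA.
  by apply: etrans (rmorph_trans _ _ _ _) _; congr trans; apply: ltranslate_var.
rewrite /cox; case: e; rewrite rmorphD /= trl; congr (_ + _).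
- rewrite (eq_trans _ _ (lconst_atrans (x1 true i))) trans_trans //.
  by apply: eq_trans => k; rewrite ltranslate_const.
- rewrite /cob rmorphB /= ltranslate_const ltranslateZ; congr (_ - _ *: _).
  by rewrite /kxx kshift_atrans1.
- rewrite -trans_trans //; apply: eq_trans => k.
  rewrite (eq_trans _ _ (fun l => rmorphD (@ltranslate A) _ _)) transD /=.
  rewrite /coc lconst_atrans; congr (_ + _).
    by apply: eq_trans => l; rewrite ltranslate_const.
  have -> : trans aX (fun l => @ltranslate A (hbar *: kxy x1 xi2 i false l 0)) k =
      hbar *: trans aX (fun l => @ltranslate A (kxy x1 xi2 i false l 0)) k :> laurent PA.
    by rewrite -transZ; apply: eq_trans => l; apply: ltranslateZ.
  by congr (_ *: _); rewrite /kxy kshift_atrans1.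
by rewrite ltranslate_const.
Qed.

End PolynomialTranslates.

(** * The filtration *)

Section Filtration.
Context (F : fieldType) (I : finType).
Variables (hbar : F) (d : I -> F) (a : I -> I -> F).
Local Notation Y := (yangian hbar d a).
Local Notation Y2 := (yangian2 hbar d a : algType F).
Local Notation tfilt := (@tfilt F I hbar d a).
Local Notation lfilt := (@lfilt F I hbar d a).

Lemma tfilt_le m n (t : Y2) : (m <= n)%N -> tfilt m t -> tfilt n t.
Proof.
move=> mn; elim=> [|p q y z pq yp zq|c u v _ un _ vn].
- exact: tfilt0.
- exact: tfilt_tens (leq_trans pq mn) yp zq.
exact: tfilt_lin.
Qed.
Lemma tfiltD n (t u : Y2) : tfilt n t -> tfilt n u -> tfilt n (t + u).
Proof. by move=> tn un; rewrite -[t]scale1r; apply: tfilt_lin. Qed.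
Lemma tfiltZ n c (t : Y2) : tfilt n t -> tfilt n (c *: t).
Proof. by move=> tn; rewrite -[_ *: _]addr0; apply: tfilt_lin => //; apply: tfilt0. Qed.
Lemma tfiltM m n (t u : Y2) : tfilt m t -> tfilt n u -> tfilt (m + n) (t * u).
Proof.
move=> tm; elim=> [|p q y z pq yp zq|c v w _ vn _ wn].
- by rewrite mulr0; apply: tfilt0.
- elim: tm => [|p' q' y' z' pq' yp' zq'|c v w _ vn _ wn].
  + by rewrite mul0r; apply: tfilt0.
  + rewrite [_ * _]tensM; apply: (@tfilt_tens _ _ _ _ _ _ (p' + p) (q' + q)).
    * by lia.
    * exact: yfiltM.
    exact: yfiltM.
  by rewrite mulrDl -scalerAl; apply: tfilt_lin.
by rewrite mulrDr -scalerAr; apply: tfilt_lin.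
Qed.
Lemma tfilt_sum n (J : Type) (r : seq J) (P : pred J) (G : J -> Y2) :
  (forall j, P j -> tfilt n (G j)) -> tfilt n (\sum_(j <- r | P j) G j).
Proof. by move=> nG; elim/big_ind: _ => //; [apply: tfilt0 | apply: tfiltD]. Qed.

Lemma lfiltD k (f g : laurent Y2) : lfilt k f -> lfilt k g -> lfilt k (f + g).
Proof.
move=> [fb fn] [gb gn]; split; first exact: lboundedD.
by move=> n; rewrite lcoefD; apply: tfiltD.
Qed.
Lemma lfiltZ k c (f : laurent Y2) : lfilt k f -> lfilt k (c *: f).
Proof.
move=> [fb fn]; split; first exact: lboundedZ.
by move=> n; rewrite lcoefZ; apply: tfiltZ.
Qed.
Lemma lfiltB k (f g : laurent Y2) : lfilt k f -> lfilt k g -> lfilt k (f - g).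
Proof. by move=> fk gk; rewrite -scaleN1r; apply/lfiltD/lfiltZ. Qed.
Lemma lfilt_le k l (f : laurent Y2) : (k <= l)%N -> lfilt k f -> lfilt l f.
Proof.
move=> kl [fb fn]; split; first by apply: lbounded_le fb; lia.
move=> n; case: (leqP (l - k) n) => kn.
  rewrite (_ : l%:Z - n%:Z = k%:Z - (n - (l - k))%N%:Z); last by lia.
  by apply: tfilt_le (fn _); lia.
by rewrite fb; [apply: tfilt0 | lia].
Qed.
Lemma lfiltM k l (f g : laurent Y2) : lfilt k f -> lfilt l g -> lfilt (k + l) (f * g).
Proof.
move=> [fb fn] [gb gn]; split; first by rewrite PoszD; apply: lboundedM.
move=> n; rewrite /= (lmul_coefE fb gb (_ : _ = k%:Z + l%:Z - n%:Z)); last by lia.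
apply: tfilt_sum => j _; have jn := ltn_ord j.
by apply: tfilt_le (tfiltM (fn _) (gn _)); lia.
Qed.
Lemma lfilt_const k (t : Y2) : tfilt k t -> lfilt k (lconst t).
Proof.
move=> tk; split; first by apply: lbounded_le (lbounded_const _); lia.
move=> n /=; case: eqP => [E|_]; last exact: tfilt0.
by rewrite (_ : n = k) //; lia.
Qed.
Lemma lfilt_var k (f : laurent Y2) : lfilt k f -> lfilt k.+1 (lvar * f).
Proof.
move=> [fb fn]; split.
  by rewrite (_ : k.+1%:Z = 1 + k%:Z) //; apply: lboundedM => //; apply: lbounded_var.
move=> n; rewrite lcoef_varl (_ : k.+1%:Z - n%:Z - 1 = k%:Z - n%:Z) //; lia.
Qed.
Lemma lfilt_trans (y : nat -> laurent Y2) r :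
  (forall k, lfilt k (y k)) -> lfilt r (trans lvar y r).
Proof.
have gen m : (forall k, lfilt (k + m) (y k)) -> lfilt (r + m) (trans lvar y r).
  elim: r y m => [|r IH] y m yk; first exact: yk.
  apply: lfiltD; last by rewrite addSn; apply/lfilt_var/IH.
  by rewrite addSnnS; apply: IH => k; rewrite -addSnnS.
by move=> yk; have := gen 0%N; rewrite !addn0; apply=> k; rewrite addn0.
Qed.
(** 1 / (w + s - v) is homogeneous, of degree -1, when s, v and w have
    degree 1. *)
Lemma lfilt_kshift (g : nat -> nat -> Y2) q p :
  (forall i j, tfilt (i + j) (g i j)) -> lfilt (q + p) (kshift g q p).
Proof.
move=> gn; split; first by apply: lbounded_le (@kshift_bounded _ _ g q p); lia.
move=> n /=; case E: (-1 - _) => [N|N]; last exact: tfilt0.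
apply: tfilt_sum => j _; apply/tfiltZ/(tfilt_le _ (gn _ _)).
by have := ltn_ord j; lia.
Qed.

End Filtration.

(** * Properties of the deformed Drinfeld coproduct *)

Section Yangian2Morphisms.
Context (F : fieldType) (I : finType).
Variables (hbar : F) (d : I -> F) (a : I -> I -> F).
Local Notation Y := (yangian hbar d a).
Local Notation Y2 := (yangian2 hbar d a : algType F).

(** It suffices to compare on pure tensors, which span. *)
Lemma tens_multiplicative (S : algType F) (h : {linear Y2 -> S}) :
    (forall y z y' z' : Y, h (tens (y * y') (z * z')) = h (tens y z) * h (tens y' z')) ->
  forall t u, h (t * u) = h t * h u.
Proof.
move=> hM; apply: tens_ind => [|y z t IHt] u; first by rewrite mul0r linear0 mul0r.
rewrite mulrDl !linearD /= IHt mulrDl; congr (_ + _).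
elim/tens_ind: u => [|y' z' u IHu]; first by rewrite mulr0 linear0 mulr0.
by rewrite mulrDr !linearD /= IHu mulrDr -hM; congr (h _ + _); apply: tensM.
Qed.

Lemma counit_l_is_monoid_morphism : monoid_morphism (@counit_l F I hbar d a).
Proof.
split; first by rewrite [LHS]counit_l_tens rmorph1 scale1r.
apply: tens_multiplicative => y z y' z' /=.
by rewrite !counit_l_tens rmorphM -scalerAl -scalerAr scalerA.
Qed.
HB.instance Definition _ := GRing.isMonoidMorphism.Build Y2 Y
  (@counit_l F I hbar d a) counit_l_is_monoid_morphism.

Lemma counit_r_is_monoid_morphism : monoid_morphism (@counit_r F I hbar d a).
Proof.
split; first by rewrite [LHS]counit_r_tens rmorph1 scale1r.
apply: tens_multiplicative => y z y' z' /=.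
by rewrite !counit_r_tens rmorphM -scalerAl -scalerAr scalerA.
Qed.
HB.instance Definition _ := GRing.isMonoidMorphism.Build Y2 Y
  (@counit_r F I hbar d a) counit_r_is_monoid_morphism.

(** The maps tau_tau and tau_one, with values in the F-algebra of polynomials
    instead of its underlying ring. *)
Definition tau2 : Y2 -> polyalg Y2 := tlift (@tau_tau_bilinear F I hbar d a).
HB.instance Definition _ := GRing.Linear.on tau2.
Definition tau1 : Y2 -> polyalg Y2 := tlift (@tau_one_bilinear F I hbar d a).
HB.instance Definition _ := GRing.Linear.on tau1.

Lemma map_tens_comm (p q : {poly Y}) :
  GRing.comm (map_poly (@tensl F I hbar d a) p) (map_poly (@tensr F I hbar d a) q).
Proof.
by apply: comm_poly_coef => i j; rewrite !coef_map; apply: tensl_comm.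
Qed.

Lemma tau2_is_monoid_morphism : monoid_morphism tau2.
Proof.
split; first by rewrite [LHS]tau_tau_tens !rmorph1 mulr1.
apply: tens_multiplicative => y z y' z' /=.
rewrite ![tau2 _]tau_tau_tens !rmorphM /= -!mulrA; congr (_ * _).
by rewrite !mulrA; congr (_ * _); apply: map_tens_comm.
Qed.
HB.instance Definition _ := GRing.isMonoidMorphism.Build Y2 (polyalg Y2)
  tau2 tau2_is_monoid_morphism.
HB.instance Definition _ := GRing.LRMorphism.on tau2.

Lemma tau1_is_monoid_morphism : monoid_morphism tau1.
Proof.
split; first by rewrite [LHS]tau_one_tens !rmorph1 mulr1.
apply: tens_multiplicative => y z y' z' /=.
rewrite ![tau1 _]tau_one_tens !rmorphM /= -!mulrA; congr (_ * _).
rewrite !mulrA; congr (_ * _); rewrite -!(map_polyC (@tensr F I hbar d a)).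
exact: map_tens_comm.
Qed.
HB.instance Definition _ := GRing.isMonoidMorphism.Build Y2 (polyalg Y2)
  tau1 tau1_is_monoid_morphism.
HB.instance Definition _ := GRing.LRMorphism.on tau1.

Lemma map_shiftp (f : {rmorphism Y -> Y2}) (y : nat -> Y) r :
  map_poly f (shiftp y r) = atrans (fun k => f (y k)) r.
Proof.
have E := @trans_shiftp {poly Y2} 'X (fun p => esym (commr_polyX p)) Y
  (map_poly f) y r (map_polyX f).
by rewrite [LHS]E; apply: eq_trans => k; rewrite /= map_polyC.
Qed.

Lemma tau2_tensl (y : nat -> Y) (z : Y) r :
  ytau z = shiftp y r -> tau2 (tensl z) = atrans (fun k => tensl (y k) : Y2) r.
Proof. by move=> E; rewrite [LHS]tau_tau_tens E !rmorph1 mulr1 map_shiftp. Qed.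
Lemma tau2_tensr (y : nat -> Y) (z : Y) r :
  ytau z = shiftp y r -> tau2 (tensr z) = atrans (fun k => tensr (y k) : Y2) r.
Proof. by move=> E; rewrite [LHS]tau_tau_tens E !rmorph1 mul1r map_shiftp. Qed.
Lemma tau1_tensl (y : nat -> Y) (z : Y) r :
  ytau z = shiftp y r -> tau1 (tensl z) = atrans (fun k => tensl (y k) : Y2) r.
Proof. by move=> E; rewrite [LHS]tau_one_tens E !rmorph1 mulr1 map_shiftp. Qed.
Lemma tau1_tensr (z : Y) : tau1 (tensr z) = polyalgC (tensr z : Y2).
Proof. by rewrite [LHS]tau_one_tens !rmorph1 mul1r. Qed.

End Yangian2Morphisms.

Section CoproductUnit.
Context (F : fieldType) (A : algType F) (I : finType) (hbar : F).
Variables (x1 x2 : bool -> I -> nat -> A) (xi1 xi2 : I -> nat -> A).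

Let kshift_eq0 (g : nat -> nat -> A) q p : (forall i j, g i j = 0) -> kshift g q p = 0.
Proof. by move=> g0; rewrite (@eq_kshift _ _ _ (fun _ _ => 0)) ?kshift0. Qed.

Lemma cox_unit_l e i r : (forall e i r, x1 e i r = 0) -> (forall i r, xi1 i r = 0) ->
  cox hbar x1 x2 xi1 xi2 e i r = lconst (x2 e i r).
Proof.
move=> x10 xi10; rewrite /cox; case: e.
  rewrite (@eq_trans _ _ _ (fun=> 0)) => [|k]; last by rewrite x10 lconst0.
  rewrite trans0 add0r /cob /kxx kshift_eq0 ?scaler0 ?subr0 // => q p.
  by rewrite xi10 mul0r.
rewrite (@eq_trans _ _ _ (fun=> 0)) => [|k]; first by rewrite trans0 add0r.
rewrite /coc /kxy x10 lconst0 add0r kshift_eq0 ?scaler0 // => q p.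
by rewrite x10 mul0r.
Qed.

Lemma cox_unit_r e i r : (forall e i r, x2 e i r = 0) -> (forall i r, xi2 i r = 0) ->
  cox hbar x1 x2 xi1 xi2 e i r = trans lvar (fun k => lconst (x1 e i k)) r.
Proof.
move=> x20 xi20; rewrite /cox; case: e.
  rewrite /cob /kxx kshift_eq0 ?x20 ?lconst0 ?scaler0 ?subr0 ?addr0 // => q p.
  by rewrite x20 mulr0.
rewrite x20 lconst0 addr0; apply: eq_trans => k.
rewrite /coc /kxy kshift_eq0 ?scaler0 ?addr0 // => q p.
by rewrite xi20 mulr0.
Qed.

Lemma eq_cox (y1 y2 : bool -> I -> nat -> A) (yi1 yi2 : I -> nat -> A) e i r :
    (forall e i r, x1 e i r = y1 e i r) -> (forall e i r, x2 e i r = y2 e i r) ->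
    (forall i r, xi1 i r = yi1 i r) -> (forall i r, xi2 i r = yi2 i r) ->
  cox hbar x1 x2 xi1 xi2 e i r = cox hbar y1 y2 yi1 yi2 e i r.
Proof.
move=> e1 e2 ei1 ei2; have -> : x1 = y1 by do 3!apply/funext => ?.
have -> : x2 = y2 by do 3!apply/funext => ?.
have -> : xi1 = yi1 by do 2!apply/funext => ?.
by have -> : xi2 = yi2 by do 2!apply/funext => ?.
Qed.

End CoproductUnit.

Section CoproductProperties.
Context (F : fieldType) (I : finType).
Variables (hbar : F) (d : I -> F) (a : I -> I -> F).
Hypothesis F0 : forall n, n.+1%:R != 0 :> F.
Hypothesis hbar_neq0 : hbar != 0.
Hypothesis da_sym : forall i j, d i * a i j = d j * a j i.
Hypothesis d_neq0 : forall i, d i != 0.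
Hypothesis a_diag : forall i, a i i = 2%:R.

Local Notation Y := (yangian hbar d a).
Local Notation Y2 := (yangian2 hbar d a : algType F).
Local Notation L := (laurent Y2 : algType F).
Local Notation yx := (yX hbar d a).
Local Notation yxi := (yXi hbar d a).
Local Notation D := (ddelta F0 hbar_neq0 da_sym d_neq0 a_diag).

Let ytau_const (c : F) : ytau (c%:A : Y) = (c%:A)%:P.
Proof. by rewrite linearZ /= rmorph1 polyalgZE mulr1. Qed.
Let D_const (c : F) : D c%:A = lconst c%:A.
Proof. by rewrite linearZ /= rmorph1 lconstZ rmorph1. Qed.

Let epsX e i r : ycounit (yx e i r) = 0 := yliftX _ e i r.
Let epsXi i r : ycounit (yxi i r) = 0 := yliftXi _ i r.

Lemma ddelta_counit_l x : lmap (@counit_l F I hbar d a) (D x) = lconst x.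
Proof.
pose f := lmap (@counit_l F I hbar d a) \o D.
apply: (yangian_rmorph_ext (f := f) (g := @lconst Y)) => [c|e i r].
  by rewrite /f /= D_const lmap_const; congr lconst; rewrite /= linearZ /= rmorph1.
rewrite /f /= ddeltaX lmap_cox cox_unit_l => [|e' j t|j t].
- by congr lconst; rewrite [LHS]counit_l_tens rmorph1 scale1r.
- by rewrite [LHS]counit_l_tens epsX scale0r.
by rewrite [LHS]counit_l_tens epsXi scale0r.
Qed.

Lemma ddelta_counit_r x : lmap (@counit_r F I hbar d a) (D x) = lpoly (ytau x).
Proof.
pose f := lmap (@counit_r F I hbar d a) \o D.
pose g := @lpoly Y \o @ytau F I hbar d a.
apply: (yangian_rmorph_ext (f := f) (g := g)) => [c|e i r].
  rewrite /f /g /= D_const lmap_const ytau_const lpolyC.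
  by congr lconst; rewrite /= linearZ /= rmorph1.
rewrite /f /g /= ddeltaX lmap_cox cox_unit_r => [|e' j t|j t]; last 2 first.
- by rewrite [LHS]counit_r_tens epsX scale0r.
- by rewrite [LHS]counit_r_tens epsXi scale0r.
rewrite ytauX (trans_shiftp (@lvarC Y) _ _ (lpolyX Y)).
apply: eq_trans => k; rewrite /= lpolyC; congr lconst.
by rewrite [LHS]counit_r_tens rmorph1 scale1r.
Qed.

Lemma ddelta_tau_tau x : lmap (@tau_tau F I hbar d a) (D x) = lextend D (ytau x).
Proof.
suff E : lmap (@tau2 F I hbar d a) (D x) = lextend D (ytau x) by rewrite -E; apply: laurentP.
pose f := lmap (@tau2 F I hbar d a) \o D.
pose g := @lextend _ _ D \o @ytau F I hbar d a.
apply: (yangian_rmorph_ext (f := f) (g := g)) => [c|e i r].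
  rewrite /f /g /= D_const lmap_const ytau_const lextendC /= D_const lmap_const.
  by congr lconst; rewrite /= linearZ /= rmorph1 polyalgZE mulr1.
rewrite /f /g /= ddeltaX lmap_cox ytauX.
rewrite [RHS](trans_shiftp (@lconstXC Y2) _ _ (lextendX D)).
rewrite (@eq_trans _ _ _ (fun k => lmap (@polyalgC F Y2)
  (cox hbar (fun e i r => tensl (yx e i r) : Y2) (fun e i r => tensr (yx e i r) : Y2)
    (fun i r => tensl (yxi i r) : Y2) (fun i r => tensr (yxi i r) : Y2) e i k)))
  => [|k]; last by rewrite /= lextendC /= ddeltaX.
apply: etrans _ (cox_atrans2 hbar _ _ _ _ e i r).
apply: eq_cox => *; [exact/tau2_tensl/ytauX | exact/tau2_tensr/ytauX |
  exact/tau2_tensl/ytauXi | exact/tau2_tensr/ytauXi].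
Qed.

Lemma ddelta_tau_one x : lmap (@tau_one F I hbar d a) (D x) = ltranslate (D x).
Proof.
suff E : lmap (@tau1 F I hbar d a) (D x) = ltranslate (D x) by rewrite -E; apply: laurentP.
pose f := lmap (@tau1 F I hbar d a) \o D.
pose g := @ltranslate Y2 \o D.
apply: (yangian_rmorph_ext (f := f) (g := g)) => [c|e i r].
  rewrite /f /g /= D_const lmap_const ltranslate_const.
  by congr lconst; rewrite /= linearZ /= rmorph1 polyalgZE mulr1.
rewrite /f /g /= ddeltaX lmap_cox; apply: etrans _ (cox_atrans1 hbar _ _ _ _ e i r).
apply: eq_cox => *; [exact/tau1_tensl/ytauX | exact: tau1_tensr |
  exact/tau1_tensl/ytauXi | exact: tau1_tensr].
Qed.

Lemma lfilt_cox e i r : lfilt r (D (yx e i r)).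
Proof.
rewrite ddeltaX /cox.
have yX k n (y : Y) : yfilt k y -> k = n -> tfilt n (tens y 1 : Y2).
  by move=> yk <-; apply: (tfilt_tens _ yk (@yfilt1 _ _ _ _ _)); rewrite addn0.
have yXr k n (y : Y) : yfilt k y -> k = n -> tfilt n (tens 1 y : Y2).
  by move=> yk <-; apply: (tfilt_tens _ (@yfilt1 _ _ _ _ _) yk); rewrite add0n.
have lX k y : yfilt k y -> lfilt k (lconst (tensl y : Y2)).
  by move=> yk; apply: lfilt_const; apply: yX yk _.
have rX k y : yfilt k y -> lfilt k (lconst (tensr y : Y2)).
  by move=> yk; apply: lfilt_const; apply: yXr yk _.
have lr k n y z : yfilt k y -> yfilt n z -> tfilt (k + n) (tensl y * tensr z : Y2).
  by move=> yk zn; rewrite tensl_tensr; apply: tfilt_tens yk zn.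
case: e; apply: lfiltD.
- by apply: lfilt_trans => k; apply/lX/yfiltX.
- apply: lfiltB; first exact/rX/yfiltX.
  apply: lfiltZ; rewrite -[r in lfilt r]add0n; apply: lfilt_kshift => p q.
  by apply: lr; [apply: yfiltXi | apply: yfiltX].
- apply: lfilt_trans => k; apply: lfiltD; first exact/lX/yfiltX.
  apply: lfiltZ; rewrite -[k in lfilt k]addn0; apply: lfilt_kshift => p q.
  by apply: lr; [apply: yfiltX | apply: yfiltXi].
exact/rX/yfiltX.
Qed.

Lemma ddelta_filtered k x : yfilt k x -> lfilt k (D x).
Proof.
elim=> [e i r|i r||m n y z _ ym _ zn|n c y z _ yn _ zn|m n y mn _ ym].
- exact: lfilt_cox.
(* xi_r is the commutator of x^+_0 and x^-_r, whose degrees add up to r. *)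
- have -> : yxi i r = rcomm (yx true i 0) (yx false i r).
    by rewrite (yrel_xpxm (yangian_relP hbar d a)) eqxx.
  rewrite (rmorph_rcomm D) -[r in lfilt r]add0n; apply: lfiltB.
    by apply: lfiltM; apply: lfilt_cox.
  by rewrite addnC; apply: lfiltM; apply: lfilt_cox.
- rewrite rmorph1; apply: lfilt_const.
  by apply: (@tfilt_tens _ _ _ _ _ 0 0 0 1 1) => //; apply: yfilt1.
- by rewrite rmorphM; apply: lfiltM.
- by rewrite linearP; apply: lfiltD => //; apply: lfiltZ.
exact: lfilt_le ym.
Qed.

End CoproductProperties.

Theorem theorem3p4 (R : realType) (g : vectType R[i]) (br : g -> g -> g)
    (form : g -> g -> R[i]) (h : {vspace g}) (I : finType)
    (alpha : I -> hdual h) (hbar : R[i])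
    (g_lie : lie_bracket br) (g_semisimple : lie_semisimple br)
    (form_invariant : invariant_form br form)
    (h_cartan : cartan_subalgebra br h)
    (alpha_simple : simple_roots br alpha)
    (form_normalized : short_roots_normalized br h form)
    (hbar_neq0 : hbar != 0) :
  let d := half_square form alpha in
  let a := cartan_matrix form alpha in
  let Y := yangian hbar d a in
  let Y2 := yangian2 hbar d a in
  (exists Delta : {lrmorphism Y -> laurent Y2}, deformed_drinfeld Delta) /\
  forall Delta : {lrmorphism Y -> laurent Y2}, deformed_drinfeld Delta ->
    [/\ (forall x : Y, lmap (@counit_l _ _ hbar d a) (Delta x) = lconst x) /\
        (forall x : Y, lmap (@counit_r _ _ hbar d a) (Delta x) = lpoly (ytau x)),
        forall x : Y,
          lmap (@tau_tau _ _ hbar d a) (Delta x) = lextend Delta (ytau x) /\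
          lmap (@tau_one _ _ hbar d a) (Delta x) = ltranslate (Delta x)
      & forall (k : nat) (x : Y), yfilt k x -> lfilt k (Delta x)].
Proof.
move=> d a Y Y2.
have F0 n : n.+1%:R != 0 :> R[i] by rewrite pnatr_eq0.
have aa i : dual_form form (alpha i) (alpha i) != 0.
  have [le2 _] := form_normalized _ (simple_root alpha_simple i).
  by apply/eqP => aa0; move: le2; rewrite aa0 lern0.
have d_neq0 i : d i != 0 by rewrite mulf_neq0 ?invr_eq0 ?(F0 1).
have a_diag i : a i i = 2%:R by rewrite /a /cartan_matrix mulfK.
have da i j : d i * a i j = dual_form form (alpha i) (alpha j).
  by rewrite /d /a /half_square /cartan_matrix; field; rewrite ?aa ?(F0 1 : 2%:R != 0).
have da_sym i j : d i * a i j = d j * a j i.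
  by rewrite !da /dual_form (form_sym form_invariant).
split; first by exists (ddelta F0 hbar_neq0 da_sym d_neq0 a_diag); apply: ddelta_drinfeld.
move=> Delta DD; have E := drinfeld_unique F0 hbar_neq0 da_sym d_neq0 a_diag DD.
have Ef : Delta = ddelta F0 hbar_neq0 da_sym d_neq0 a_diag :> (Y -> laurent Y2).
  exact/funext.
split=> [|x|k x xk].
- by split=> x; rewrite E; [apply: ddelta_counit_l | apply: ddelta_counit_r].
- rewrite E; split; last exact: ddelta_tau_one.
  by rewrite Ef; apply: ddelta_tau_tau.
by rewrite E; apply: ddelta_filtered.
Qed.
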